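(* Let $\{f_\theta:\theta\in\Theta=H_p\}$, $p\ge0$, be an infinite-dimensional exponential family (see context). Let $\theta_0\in H_\beta$ with $\beta>p$, and let $\Pi$ be the $\alpha$-regular Gaussian series prior with $\alpha>p$. Assume the following. (1) (Coercivity and boundedness of the Fisher information.) There are $R_0>0$ and $0<c_0\le C_0<\infty$ such that $E_\theta^{(1)}[\|\beta_{X_1}\|_{\Theta^*}]<\infty$ for all $\theta\in B^\Theta_{R_0}(\theta_0)$; $I(\theta_0)[h]\le C_0\|h\|_{H_0}^2$ for all $h\in\Theta$; and $I(\theta)[h]\ge c_0\|h\|_{H_0}^2$ for all $h\in\Theta$ and all $\theta\in B^\Theta_{R_0}(\theta_0)$. (2) (Expansion of the Kullback--Leibler divergence.) $M$ is twice continuously Fréchet differentiable on $\Theta$, and there are $m_K\in(d/2,p]$, $q_K\in(0,1]$ and $C_K,R_K>0$ such that $\big|K(\theta|\theta_0)-\tfrac12 I(\theta_0)[\theta-\theta_0]\big|\le C_K\|\theta-\theta_0\|_{H_{m_K}}^{2+q_K}$ for all $\theta\in\Theta\cap B^{H_{m_K}}_{R_K}(\theta_0)$. (3) (Global lower bound for the Kullback--Leibler divergence.) There are a nondecreasing $\varphi:[0,\infty)\to[0,\infty)$ with $\varphi(u)>0$ for $u>0$ and $\varphi(u)\gtrsim u^2$ as $u\to0^+$, and constants $c_\varphi>0$, $r_K\ge0$, such that $K(\theta|\theta_0)\ge\varphi(c_\varphi\|\theta-\theta_0\|_{H_{-r_K}})$ for all $\theta\in\Theta$. (4) (Concentration of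 the sufficient statistic.) For $m_K$ from (2), there is $A_T>0$ with $E_{\theta_0}^{(1)}\exp\{\|\beta_{X_1}-T_{\theta_0}\|_{H_{-m_K}}/A_T\}<\infty$. Assume further that $$q_K(\alpha\wedge\beta)>\max\{(2+q_K)p+2r_K,\ (2+q_K)m_K+d\},$$ and, in the case $\alpha>\beta$, that in addition $$\alpha<\frac{(2+q_K)(\beta-m_K)-d}{2}.$$ Then, for every $0\le s<\alpha\wedge\beta$ and every sequence $M_n\to\infty$, $$E_{\theta_0}^{(n)}\Big[\Pi\big(\theta\in\Theta:\|\theta-\theta_0\|_{H_s}>M_n\,n^{-\frac{(\alpha\wedge\beta)-s}{2\alpha+d}}\,\big|\,X^{(n)}\big)\Big]\to0\qquad\text{as }n\to\infty.$$
   Context: Hilbert scale. $H_0$ is a separable real Hilbert space with orthonormal basis $(e_k)_{k\ge1}$; $d\in\mathbb N$; $0<\lambda_1\le\lambda_2\le\cdots$ satisfies $\lambda_k\asymp k^{1/d}$ as $k\to\infty$ (two-sided bounds up to positive constants). For $s\ge0$, $H_s=\{h=\sum_kh_ke_k:\|h\|_{H_s}^2=\sum_k\lambda_k^{2s}h_k^2<\infty\}$; for $s<0$, $H_s$ is the completion of $H_0$ under the norm given by the same formula, identified with the dual of $H_{-s}$ via the $\langle\cdot,\cdot\rangle_{H_0}$-pairing. $B^{H_m}_r(\theta_0)=\{\theta:\|\theta-\theta_0\|_{H_m}\le r\}$. Exponential family. $\Theta=H_p$, $\|\cdot\|_\Theta=\|\cdot\|_{H_p}$, $\Theta^*=H_{-p}$,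 $B^\Theta_r(\theta_0)=B_r^{H_p}(\theta_0)$. $(\mathbb X,\mathcal X,\lambda)$ is a $\sigma$-finite measure space and $x\mapsto\beta_x$ is a measurable map $\mathbb X\to\Theta^*$ (the map $x\mapsto\beta_x$ is unrelated to the smoothness index $\beta$). $M(\theta)=\log\int_{\mathbb X}e^{\beta_x(\theta)}d\lambda(x)$ is assumed finite for all $\theta\in\Theta$, and $f_\theta(x)=\exp\{\beta_x(\theta)-M(\theta)\}$. The data $X^{(n)}=(X_1,\dots,X_n)$ are i.i.d. with $\lambda$-density $f_\theta$; $E_\theta^{(n)}$ is expectation under the corresponding law $\mu_\theta^{(n)}$. $T_\theta=E_\theta^{(1)}[\beta_{X_1}]\in\Theta^*$ (Bochner integral, whenever $E_\theta^{(1)}\|\beta_{X_1}\|_{\Theta^*}<\infty$). Fisher information: $I(\theta)[h]=\mathrm{Var}_\theta^{(1)}(\beta_{X_1}(h))\in[0,\infty]$, $h\in\Theta$. Kullback--Leibler divergence: $K(\vartheta|\theta)=\int_{\mathbb X}\log\frac{f_\theta(x)}{f_\vartheta(x)}f_\theta(x)\,d\lambda(x)$. Prior and posterior. The $\alpha$-regular Gaussian series prior $\Pi$ is the law of $\theta=\sum_{k\ge1}\lambda_k^{-\alpha-d/2}t_ke_k$ with $t_k$ i.i.d. $N(0,1)$; since $\alpha>p$ it is a Borel probability measure on $\Theta$. With $\hat T_n=\frac1n\sum_{i=1}^n\beta_{X_i}$, the posterior is $$\Pi(A|X^{(n)})=\frac{\int_Ae^{n[\hat T_n(\theta)-M(\theta)]}d\Pi(\theta)}{\int_\Theta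 e^{n[\hat T_n(\theta)-M(\theta)]}d\Pi(\theta)},\quad A\subseteq\Theta\text{ measurable}.$$ Standing assumption: $\int_\Theta e^{n[\tau(\theta)-M(\theta)]}d\Pi(\theta)<\infty$ for all $n\in\mathbb N$, $\tau\in\Theta^*$. *)

(* Defs.v *)
From HB Require Import structures.
From mathcomp Require Import all_boot all_order all_algebra.
From mathcomp Require Import all_classical all_reals all_analysis.
From mathcomp Require Import measurable_realfun.
From mathcomp Require Import ring lra.
Set Implicit Arguments.
Unset Strict Implicit.
Unset Printing Implicit Defensive.
Import Order.TTheory GRing.Theory Num.Theory.
Import numFieldNormedType.Exports.
Local Open Scope classical_set_scope.
Local Open Scope ring_scope.

Section weighted_ell2.
Context {R : realType}.
Implicit Types (w a b : nat -> R).

Definition wsum w a : \bar R := (\sum_(0 <= k <oo) (w k * a k ^+ 2)%:E)%E.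

Lemma cauchy_schwarz_sum (n : nat) a b :
  (\sum_(0 <= k < n) a k * b k) ^+ 2 <=
  (\sum_(0 <= k < n) a k ^+ 2) * (\sum_(0 <= k < n) b k ^+ 2).
Proof.
elim: n => [|n IH]; first by rewrite !big_geq// expr0n mul0r.
rewrite !big_nat_recr//=.
set C := \sum_(0 <= k < n) a k * b k in IH *.
set A := \sum_(0 <= k < n) a k ^+ 2 in IH *.
set B := \sum_(0 <= k < n) b k ^+ 2 in IH *.
have A0 : 0 <= A by apply: sumr_ge0 => k _; exact: sqr_ge0.
have B0 : 0 <= B by apply: sumr_ge0 => k _; exact: sqr_ge0.
have D : 2 * C * (a n * b n) <= A * b n ^+ 2 + a n ^+ 2 * B.
  have sA := sqr_sqrtr A0; have sB := sqr_sqrtr B0.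
  have CAB : `|C| <= Num.sqrt A * Num.sqrt B.
    rewrite -(@ler_pXn2r _ 2)// ?nnegrE ?mulr_ge0 ?sqrtr_ge0//.
    by rewrite real_normK ?num_real// exprMn sA sB.
  have : C * (a n * b n) <= Num.sqrt A * Num.sqrt B * `|a n * b n|.
    by rewrite (le_trans (ler_norm _))// normrM ler_wpM2r.
  have := sqr_ge0 (Num.sqrt A * `|b n| - Num.sqrt B * `|a n|).
  rewrite sqrrB !exprMn sA sB !real_normK ?num_real// normrM.
  nra.
nra.
Qed.

Section fixed_weight.
Variable w : nat -> R.
Hypothesis w0 : forall k, 0 <= w k.

Lemma wsum_ge0 a : (0 <= wsum w a)%E.
Proof.
by apply: nneseries_ge0 => k _ _; rewrite lee_fin mulr_ge0// sqr_ge0.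
Qed.

Lemma psum_le_wsum a n :
  ((\sum_(0 <= k < n) w k * a k ^+ 2)%:E <= wsum w a)%E.
Proof.
rewrite -sumEFin; apply: nneseries_lim_ge => k _.
by rewrite lee_fin mulr_ge0// sqr_ge0.
Qed.

Lemma wsum_le a (B : R) :
  (forall n, \sum_(0 <= k < n) w k * a k ^+ 2 <= B) -> (wsum w a <= B%:E)%E.
Proof.
move=> aB; apply: lime_le.
  by apply: is_cvg_nneseries => k _ _; rewrite lee_fin mulr_ge0// sqr_ge0.
by apply: nearW => n; rewrite sumEFin lee_fin.
Qed.

Lemma wsum_fin a : (wsum w a < +oo)%E -> wsum w a \is a fin_num.
Proof. by move=> ?; rewrite ge0_fin_numE// wsum_ge0. Qed.

Lemma psum_le_fine a n : (wsum w a < +oo)%E ->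
  \sum_(0 <= k < n) w k * a k ^+ 2 <= fine (wsum w a).
Proof. by move=> /wsum_fin/fineK fa; rewrite -lee_fin fa psum_le_wsum. Qed.

Lemma wsumD_le a b : (wsum w a < +oo)%E -> (wsum w b < +oo)%E ->
  (wsum w (fun k => a k + b k)%R <=
   ((Num.sqrt (fine (wsum w a)) + Num.sqrt (fine (wsum w b))) ^+ 2)%:E)%E.
Proof.
move=> fa fb; apply: wsum_le => n.
set sa := fine (wsum w a); set sb := fine (wsum w b).
have sa0 : 0 <= sa by rewrite fine_ge0// wsum_ge0.
have sb0 : 0 <= sb by rewrite fine_ge0// wsum_ge0.
have la : _ <= sa := psum_le_fine n fa.
have lb : _ <= sb := psum_le_fine n fb.
have := cauchy_schwarz_sum n (fun k => Num.sqrt (w k) * a k)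
          (fun k => Num.sqrt (w k) * b k).
have E c d : \sum_(0 <= k < n) Num.sqrt (w k) * c k * (Num.sqrt (w k) * d k) =
    \sum_(0 <= k < n) w k * (c k * d k).
  by apply: eq_bigr => k _; rewrite mulrACA -expr2 sqr_sqrtr.
have E2 c : \sum_(0 <= k < n) (Num.sqrt (w k) * c k) ^+ 2 =
    \sum_(0 <= k < n) w k * c k ^+ 2.
  by apply: eq_bigr => k _; rewrite exprMn sqr_sqrtr.
rewrite E !E2.
set C := \sum_(0 <= k < n) w k * (a k * b k) => CS.
have -> : \sum_(0 <= k < n) w k * (a k + b k) ^+ 2 =
    \sum_(0 <= k < n) w k * a k ^+ 2 + 2 * C + \sum_(0 <= k < n) w k * b k ^+ 2.
  rewrite mulr_sumr -!big_split/=; apply: eq_bigr => k _; ring.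
have CAB : C <= Num.sqrt sa * Num.sqrt sb.
  rewrite (le_trans (ler_norm _))//.
  rewrite -(@ler_pXn2r _ 2)// ?nnegrE ?mulr_ge0 ?sqrtr_ge0//.
  rewrite real_normK ?num_real// exprMn !sqr_sqrtr//.
  rewrite (le_trans CS)// ler_pM// sumr_ge0// => k _;
    by rewrite mulr_ge0// sqr_ge0.
rewrite sqrrD !sqr_sqrtr//; nra.
Qed.

Lemma wsumZ a (c : R) : wsum w (fun k => c * a k)%R = ((c ^+ 2)%:E * wsum w a)%E.
Proof.
rewrite /wsum -nneseriesZl; last first.
  by move=> k _; rewrite lee_fin mulr_ge0// sqr_ge0.
by apply: eq_eseriesr => k _; rewrite -EFinM; congr EFin; ring.
Qed.

Definition wnorm a : R := Num.sqrt (fine (wsum w a)).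

Lemma wnormD a b : (wsum w a < +oo)%E -> (wsum w b < +oo)%E ->
  wnorm (fun k => a k + b k) <= wnorm a + wnorm b.
Proof.
move=> fa fb; have ab := wsumD_le fa fb.
rewrite -[leRHS]ger0_norm ?addr_ge0 ?sqrtr_ge0// -sqrtr_sqr ler_wsqrtr//.
by rewrite -lee_fin fineK//; apply: wsum_fin; rewrite (le_lt_trans ab)// ltry.
Qed.

Lemma wnormZ a (c : R) : (wsum w a < +oo)%E ->
  wnorm (fun k => c * a k) = `|c| * wnorm a.
Proof.
move=> /wsum_fin fa; rewrite /wnorm wsumZ fineM//=.
by rewrite sqrtrM ?sqr_ge0// sqrtr_sqr.
Qed.

Lemma wsum0 : wsum w (fun=> 0) = 0%E.
Proof. by rewrite /wsum eseries0// => k _ _; rewrite expr0n mulr0. Qed.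

End fixed_weight.

Lemma wsum_eq0 w a : (forall k, 0 < w k) ->
  wsum w a = 0%E -> forall k, a k = 0.
Proof.
move=> w0 a0 k; have w0' j : 0 <= w j by exact: ltW.
have := psum_le_wsum w0' a k.+1.
rewrite a0 lee_fin big_nat_recr//= => h.
have s0 : 0 <= \sum_(0 <= j < k) w j * a j ^+ 2.
  by apply: sumr_ge0 => j _; rewrite mulr_ge0// sqr_ge0.
have : w k * a k ^+ 2 <= 0 by lra.
by rewrite pmulr_rle0// real_exprn_even_le0 ?num_real// => /eqP.
Qed.

End weighted_ell2.

(* Indices are shifted by one: [hs_basis k] and [hs_lam k] are the e_(k+1) and
   lambda_(k+1) of the mathematical text. *)
Record hilbert_scale (R : realType) := HilbertScale {
  hs_space :> completeNormedModType R ;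
  hs_ip : hs_space -> hs_space -> R ;
  hs_ipC : forall g h, hs_ip g h = hs_ip h g ;
  hs_ip_linear : forall c f g h,
    hs_ip (c *: f + g) h = c * hs_ip f h + hs_ip g h ;
  hs_ip_norm : forall h, hs_ip h h = `|h| ^+ 2 ;
  hs_basis : nat -> hs_space ;
  hs_orthonormal : forall j k, hs_ip (hs_basis j) (hs_basis k) = (j == k)%:R ;
  hs_expansion : forall h,
    series (fun k => hs_ip h (hs_basis k) *: hs_basis k) @ \oo --> h ;
  hs_dim : nat ;
  hs_dim_gt0 : (0 < hs_dim)%N ;
  hs_lam : nat -> R ;
  hs_lam_gt0 : forall k, 0 < hs_lam k ;
  hs_lam_ndecr : {homo hs_lam : j k / (j <= k)%N >-> j <= k} ;
  hs_lam_asymp : exists a b : R, [/\ 0 < a, 0 < b & \forall k \near \oo,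
    a * k.+1%:R `^ (hs_dim%:R^-1) <= hs_lam k <=
    b * k.+1%:R `^ (hs_dim%:R^-1)]
}.

Section scale_norms.
Context {R : realType} (S : hilbert_scale R).

Definition coef (h : S) (k : nat) : R := hs_ip h (hs_basis S k).

Definition weight (s : R) (k : nat) : R := hs_lam S k `^ (2 * s).

(* Equal to +oo when the sequence is not in the space of order s. *)
Definition seqnorm (s : R) (a : nat -> R) : \bar R := sqrte (wsum (weight s) a).

Definition hnorm (s : R) (h : S) : \bar R := seqnorm s (coef h).

Lemma weight_gt0 s k : 0 < weight s k.
Proof. by rewrite powR_gt0// hs_lam_gt0. Qed.

Lemma weight_ge0 s k : 0 <= weight s k.
Proof. by rewrite ltW// weight_gt0. Qed.

Lemma seqnorm_fin s a : (seqnorm s a < +oo)%E = (wsum (weight s) a < +oo)%E.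
Proof.
rewrite /seqnorm; have := wsum_ge0 (weight_ge0 s) a.
by case: wsum => //= r _; rewrite !ltry.
Qed.

Lemma coefD (g h : S) : coef (g + h) = (fun k => coef g k + coef h k).
Proof.
by apply/funext => k; rewrite /coef -[g]scale1r hs_ip_linear mul1r scale1r.
Qed.

Lemma coef0 : coef 0 = fun=> 0.
Proof.
apply/funext => k; have := congr1 (fun f => f k) (coefD 0 0).
by rewrite addr0 => /eqP; rewrite -subr_eq0 opprD addrA subrr sub0r oppr_eq0 => /eqP.
Qed.

Lemma coefZ c (h : S) : coef (c *: h) = (fun k => c * coef h k).
Proof.
apply/funext => k; rewrite /coef -[c *: h]addr0 hs_ip_linear.
by rewrite -/(coef 0 k) coef0 addr0.
Qed.

Lemma coef_inj (h : S) : (forall k, coef h k = 0) -> h = 0.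
Proof.
move=> h0; have := @hs_expansion R S h.
rewrite (_ : series _ = cst 0); last first.
  apply/funext => n; rewrite /series/= big1// => k _.
  by rewrite -/(coef h k) h0 scale0r.
move=> /cvg_lim <-//; first by rewrite lim_cst.
Qed.

Definition in_scale (s : R) : {pred S} := mem [set h | (hnorm s h < +oo)%E].

Lemma in_scale_submod s : submod_closed (in_scale s).
Proof.
split.
  by apply/mem_set; rewrite /= /hnorm coef0 seqnorm_fin wsum0 ltry.
move=> c g h /set_mem/= gs /set_mem/= hs; apply/mem_set => /=.
move: gs hs; rewrite /hnorm !seqnorm_fin => gs hs.
rewrite coefD coefZ (le_lt_trans (wsumD_le (weight_ge0 s) _ hs)) ?ltry//.
by rewrite wsumZ ?lte_mul_pinfty// ?lee_fin ?sqr_ge0//; exact: weight_ge0.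
Qed.

HB.instance Definition _ s :=
  GRing.isSubmodClosed.Build R S (in_scale s) (in_scale_submod s).

End scale_norms.

(* H_s as a subspace of H_0, with its own norm; to be used for s >= 0 only, as
   for s < 0 no completion is taken. Negative orders are reached through
   [Hdual] below. *)
Record Hs (R : realType) (S : hilbert_scale R) (s : R) :=
  MkHs { hval :> S ; _ : hval \in @in_scale R S s }.

Section Hs_theory.
Context {R : realType} (S : hilbert_scale R) (s : R).

HB.instance Definition _ := [isSub for @hval R S s].
HB.instance Definition _ := [Choice of Hs S s by <:].
HB.instance Definition _ := [SubChoice_isSubLmodule of Hs S s by <:].

Definition Hs_norm (h : Hs S s) : R := fine (hnorm s (h : S)).

Lemma Hs_fin (h : Hs S s) : (wsum (weight S s) (coef (h : S)) < +oo)%E.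
Proof. by case: h => h /= /set_mem /=; rewrite /hnorm seqnorm_fin. Qed.

Lemma Hs_normE (h : Hs S s) :
  Hs_norm h = Num.sqrt (fine (wsum (weight S s) (coef (h : S)))).
Proof.
rewrite /Hs_norm /hnorm /seqnorm.
by have := wsum_fin (weight_ge0 S s) (Hs_fin h); case: wsum.
Qed.

Lemma Hs_normD (g h : Hs S s) : Hs_norm (g + h) <= Hs_norm g + Hs_norm h.
Proof.
by rewrite !Hs_normE coefD; apply: (wnormD (weight_ge0 S s)); exact: Hs_fin.
Qed.

Lemma Hs_normZ c (h : Hs S s) : Hs_norm (c *: h) = `|c| * Hs_norm h.
Proof.
by rewrite !Hs_normE coefZ; exact: (wnormZ (weight_ge0 S s) c (Hs_fin h)).
Qed.

Lemma Hs_norm0_eq0 (h : Hs S s) : Hs_norm h = 0 -> h = 0.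
Proof.
rewrite Hs_normE => /eqP; rewrite sqrtr_eq0 => h0.
apply/val_inj/coef_inj/(wsum_eq0 (weight_gt0 S s)).
have fh := wsum_fin (weight_ge0 S s) (Hs_fin h).
apply/eqP; rewrite eq_le wsum_ge0 ?andbT; last exact: weight_ge0.
by rewrite -(fineK fh) lee_fin.
Qed.

HB.instance Definition _ := @Lmodule_isNormed.Build R (Hs S s)
  Hs_norm Hs_normD Hs_normZ Hs_norm0_eq0.

HB.instance Definition _ :=
  Measurable.copy (Hs S s) (g_sigma_algebraType (@open (Hs S s))).

Lemma Hs_normrE (h : Hs S s) :
  `|h| = Num.sqrt (fine (wsum (weight S s) (coef (h : S)))).
Proof. by rewrite -Hs_normE. Qed.

Lemma coef_basis (k : nat) :
  coef (hs_basis S k) = (fun j => (j == k)%:R : R).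
Proof. by apply/funext => j; rewrite /coef hs_orthonormal eq_sym. Qed.

Lemma basis_in_scale (k : nat) : hs_basis S k \in @in_scale R S s.
Proof.
apply/mem_set; rewrite /= /hnorm seqnorm_fin coef_basis.
apply: (@le_lt_trans _ _ (weight S s k)%:E); last exact: ltry.
apply: (wsum_le (weight_ge0 S s)) => n; suff -> : \sum_(0 <= j < n) weight S s j * (j == k)%:R ^+ 2 =
    if (k < n)%N then weight S s k else 0.
  by case: ifP => // _; exact: weight_ge0.
elim: n => [|n IH]; first by rewrite big_geq.
rewrite big_nat_recr//= IH ltnS [in RHS]leq_eqVlt.
have [->|nk] := eqVneq n k; first by rewrite ltnn add0r expr1n mulr1.
by rewrite expr0n mulr0 addr0.
Qed.

Definition Hs_basis (k : nat) : Hs S s := MkHs (basis_in_scale k).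

Lemma hval_sum (n : nat) (c : nat -> R) :
  coef (\sum_(0 <= k < n) c k *: Hs_basis k : Hs S s) =
  (fun j => if (j < n)%N then c j else 0).
Proof.
elim: n => [|n IH]; apply/funext => j; first by rewrite big_geq// coef0.
rewrite big_nat_recr//= coefD IH coefZ coef_basis ltnS [in RHS]leq_eqVlt.
have [->|jn] := eqVneq j n; first by rewrite ltnn add0r mulr1.
by rewrite mulr0 addr0.
Qed.

Lemma Hs_expansion (h : Hs S s) :
  (fun n => \sum_(0 <= k < n) coef (h : S) k *: Hs_basis k) @ \oo --> h.
Proof.
apply/cvgrPdist_le => e e0.
have fh := wsum_fin (weight_ge0 S s) (Hs_fin h).
have w0 k (x : R) : 0 <= weight S s k * x ^+ 2.
  by rewrite mulr_ge0 ?sqr_ge0 ?weight_ge0.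
pose W n := fine (wsum (weight S s) (coef (h : S))) -
  \sum_(0 <= k < n) weight S s k * coef (h : S) k ^+ 2.
have cW : W @ \oo --> (0 : R).
  rewrite -(subrr (fine (wsum (weight S s) (coef (h : S))))).
  apply: cvgB; first exact: cvg_cst.
  rewrite (_ : (fun n => _) = fine \o (fun n => \sum_(0 <= k < n)
    (weight S s k * coef (h : S) k ^+ 2)%:E)%E); last first.
    by apply/funext => n /=; rewrite sumEFin.
  apply: fine_cvg; rewrite fineK//.
  by apply: is_cvg_nneseries => k _ _; rewrite lee_fin.
have e2 : 0 < e ^+ 2 by rewrite exprn_gt0.
near=> n.
have tn : W n <= e ^+ 2.
  by apply: le_trans (ler_norm _) _; near: n; exact: (cvgr0_norm_le _ cW).
rewrite Hs_normrE -[leRHS]ger0_norm; last exact: ltW.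
rewrite -sqrtr_sqr ler_wsqrtr// (le_trans _ tn)//.
rewrite -lee_fin fineK; last exact/(wsum_fin (weight_ge0 S s))/Hs_fin.
apply: (wsum_le (weight_ge0 S s)) => m.
rewrite /W lerBrDl.
apply: le_trans (psum_le_fine (weight_ge0 S s) (maxn n m) (Hs_fin h)).
rewrite (big_cat_nat _ (leq_maxl n m))//= lerD2l.
rewrite (le_trans (y := \sum_(0 <= k < maxn n m) weight S s k *
  coef ((h - \sum_(0 <= k < n) coef (h : S) k *: Hs_basis k : Hs S s) : S) k
  ^+ 2))//.
  rewrite [leRHS](big_cat_nat _ (leq_maxr n m))//= lerDl.
  exact: sumr_ge0.
have E : coef ((h - \sum_(0 <= k < n) coef (h : S) k *: Hs_basis k : Hs S s) : S)
    = fun k => if (k < n)%N then 0 else coef (h : S) k.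
  rewrite -scaleN1r coefD coefZ hval_sum; apply/funext => k.
  by case: ifP; rewrite ?mulr0 ?addr0 ?mulN1r ?subrr.
rewrite E (big_cat_nat _ (leq_maxl n m))//= big_nat big1 ?add0r; last first.
  by move=> k /= kn; rewrite kn expr0n mulr0.
by rewrite big_nat [leRHS]big_nat; apply: ler_sum => k /andP[nk _];
  rewrite ltnNge nk.
Unshelve. all: by end_near. Qed.

End Hs_theory.

Section dual.
Context {R : realType} (S : hilbert_scale R) (p : R).

Definition in_dual : {pred Hs S p -> R^o} :=
  mem [set f : Hs S p -> R^o | linear f /\ continuous f].

Lemma in_dual_submod : submod_closed in_dual.
Proof.
split.
  apply/mem_set; split=> [c g h /=|]; first by rewrite scaler0 addr0.
  by move=> h; exact: cst_continuous.
move=> c f g /set_mem[lf cf] /set_mem[lg cg]; apply/mem_set; split.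
  move=> b h k /=; rewrite !fctE lf lg !scalerDr addrACA !scalerA.
  by rewrite (mulrC c).
move=> h; apply: (@continuousD _ R^o); last exact: cg.
by exact: (@cvgZl_tmp _ R^o) (cf h).
Qed.

HB.instance Definition _ := GRing.isSubmodClosed.Build R (Hs S p -> R^o)
  in_dual in_dual_submod.

End dual.

(* The topological dual of H_p. *)
Record Hdual (R : realType) (S : hilbert_scale R) (p : R) :=
  MkHdual { dual_fun :> Hs S p -> R^o ; _ : dual_fun \in @in_dual R S p }.

Section Hdual_theory.
Context {R : realType} (S : hilbert_scale R) (p : R).

HB.instance Definition _ := [isSub for @dual_fun R S p].
HB.instance Definition _ := [Choice of Hdual S p by <:].
HB.instance Definition _ := [SubChoice_isSubLmodule of Hdual S p by <:].

Lemma dual_linear (f : Hdual S p) : linear (f : Hs S p -> R^o).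
Proof. by case: f => f /= /set_mem[]. Qed.

Lemma dual_continuous (f : Hdual S p) : continuous (f : Hs S p -> R^o).
Proof. by case: f => f /= /set_mem[]. Qed.

HB.instance Definition _ (f : Hdual S p) :=
  GRing.isLinear.Build R (Hs S p) R^o *:%R (f : Hs S p -> R^o) (dual_linear f).

(* The element of H_(-s) identified with f through the H_0-pairing has these
   coefficients, so [dual_hnorm (- s) f] is its H_(-s) norm, with value +oo when
   f is not in H_(-s). *)
Definition dual_coef (f : Hdual S p) (k : nat) : R := f (Hs_basis S p k).

Definition dual_hnorm (s : R) (f : Hdual S p) : \bar R :=
  seqnorm S s (dual_coef f).

Lemma dual_coefD (f g : Hdual S p) :
  dual_coef (f + g) = (fun k => dual_coef f k + dual_coef g k).
Proof. by []. Qed.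

Lemma dual_coefZ c (f : Hdual S p) :
  dual_coef (c *: f) = (fun k => c * dual_coef f k).
Proof. by []. Qed.

Lemma dual_eval_sum (f : Hdual S p) n (c : nat -> R) :
  f (\sum_(0 <= k < n) c k *: Hs_basis S p k) =
  \sum_(0 <= k < n) c k * dual_coef f k.
Proof.
rewrite (linear_sum (f : {linear Hs S p -> R^o})).
by apply: eq_bigr => k _; rewrite linearZ.
Qed.

Lemma weightNM k : weight S (- p) k * weight S p k = 1.
Proof.
rewrite /weight mulrN -powRD; last first.
  by rewrite (gt_eqF (hs_lam_gt0 S k)) implybT.
by rewrite addNr powRr0.
Qed.

Lemma dual_fin (f : Hdual S p) : (wsum (weight S (- p)) (dual_coef f) < +oo)%E.
Proof.
have [C C0 fC] : exists2 C : R, 0 <= C & forall h, `|f h| <= C * `|h|.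
  have := @dual_continuous f.
  move=> /(_ 0) /(continuous_linear_bounded 0 (f := (f : {linear Hs S p -> R^o}))).
  move=> /linear_boundedP/pinfty_ex_gt0[C C0 fC].
  by exists C => //; exact: ltW.
apply: (@le_lt_trans _ _ (C ^+ 2)%:E); last exact: ltry.
apply: (wsum_le (weight_ge0 S (- p))) => n.
set Sn := \sum_(0 <= k < n) _.
have Sn0 : 0 <= Sn.
  by apply: sumr_ge0 => k _; rewrite mulr_ge0 ?sqr_ge0 ?weight_ge0.
pose h : Hs S p :=
  \sum_(0 <= k < n) (weight S (- p) k * dual_coef f k) *: Hs_basis S p k.
have fh : f h = Sn.
  rewrite dual_eval_sum; apply: eq_bigr => k _; ring.
have hn : `|h| <= Num.sqrt Sn.
  rewrite Hs_normrE ler_wsqrtr// -lee_fin fineK; last first.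
    exact/(wsum_fin (weight_ge0 S p))/Hs_fin.
  apply: (wsum_le (weight_ge0 S p)) => m.
  apply: (@le_trans _ _ (\sum_(0 <= k < maxn n m) weight S p k * coef (h : S) k ^+ 2)).
    rewrite [leRHS](big_cat_nat _ (leq_maxr n m))//= lerDl.
    by apply: sumr_ge0 => k _; rewrite mulr_ge0 ?sqr_ge0 ?weight_ge0.
  rewrite (big_cat_nat _ (leq_maxl n m))//= hval_sum.
  rewrite [X in _ + X]big_nat [X in _ + X]big1 ?addr0; last first.
    by move=> k /andP[nk _]; rewrite ltnNge nk/= expr0n mulr0.
  rewrite /Sn big_nat [leRHS]big_nat; apply: ler_sum => k /= ->.
  rewrite exprMn mulrA (_ : weight S p k * _ ^+ 2 = weight S (- p) k)//.
  by rewrite expr2 mulrA (mulrC (weight S p k)) weightNM mul1r.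
have : Sn <= C * Num.sqrt Sn.
  by rewrite -{1}fh (le_trans (ler_norm _))// (le_trans (fC h))// ler_wpM2l.
have := sqr_sqrtr Sn0; have := sqrtr_ge0 Sn.
set r := Num.sqrt Sn => r0 <-.
have [->|rn0] := eqVneq r 0; first by rewrite expr0n sqr_ge0.
have rp : 0 < r by rewrite lt_neqAle eq_sym rn0.
by rewrite expr2 ler_pM2r// => rC; rewrite -expr2 ler_pXn2r// nnegrE.
Qed.

Definition Hdual_norm (f : Hdual S p) : R := fine (dual_hnorm (- p) f).

Lemma Hdual_normE (f : Hdual S p) :
  Hdual_norm f = Num.sqrt (fine (wsum (weight S (- p)) (dual_coef f))).
Proof.
rewrite /Hdual_norm /dual_hnorm /seqnorm.
by have := wsum_fin (weight_ge0 S (- p)) (dual_fin f); case: wsum.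
Qed.

Lemma dual_le_norm (f : Hdual S p) (h : Hs S p) :
  `|f h| <= Hdual_norm f * `|h|.
Proof.
have fc : (fun n => f (\sum_(0 <= k < n) coef (h : S) k *: Hs_basis S p k))
    @ \oo --> (f h : R).
  exact: (cvg_comp _ _ (Hs_expansion (h := h)) (@dual_continuous f h)).
apply: (ler_cvg_to (cvg_norm fc) (cvg_cst _)); apply: nearW => n /=.
rewrite dual_eval_sum Hdual_normE Hs_normrE.
have ww k : Num.sqrt (weight S p k) * Num.sqrt (weight S (- p) k) = 1.
  by rewrite -sqrtrM ?weight_ge0// mulrC weightNM sqrtr1.
have := cauchy_schwarz_sum n (fun k => Num.sqrt (weight S p k) * coef (h : S) k)
  (fun k => Num.sqrt (weight S (- p) k) * dual_coef f k).
have E (w c : nat -> R) : (forall k, 0 <= w k) ->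
    \sum_(0 <= k < n) (Num.sqrt (w k) * c k) ^+ 2 =
    \sum_(0 <= k < n) w k * c k ^+ 2.
  by move=> w0; apply: eq_bigr => k _; rewrite exprMn sqr_sqrtr.
rewrite (E _ _ (weight_ge0 S p)) (E _ _ (weight_ge0 S (- p))).
under eq_bigr do rewrite mulrACA ww mul1r.
move=> CS; rewrite -(@ler_pXn2r _ 2)// ?nnegrE ?mulr_ge0 ?sqrtr_ge0//.
rewrite real_normK ?num_real// (le_trans CS)// mulrC exprMn !sqr_sqrtr; last 2 first.
- by rewrite fine_ge0// wsum_ge0//; exact: weight_ge0.
- by rewrite fine_ge0// wsum_ge0//; exact: weight_ge0.
apply: ler_pM.
- by apply: sumr_ge0 => k _; rewrite mulr_ge0 ?sqr_ge0 ?weight_ge0.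
- by apply: sumr_ge0 => k _; rewrite mulr_ge0 ?sqr_ge0 ?weight_ge0.
- exact/(psum_le_fine (weight_ge0 S (- p)))/dual_fin.
- exact/(psum_le_fine (weight_ge0 S p))/Hs_fin.
Qed.

Lemma Hdual_normD (f g : Hdual S p) :
  Hdual_norm (f + g) <= Hdual_norm f + Hdual_norm g.
Proof.
by rewrite !Hdual_normE dual_coefD; apply: (wnormD (weight_ge0 S _));
  exact: dual_fin.
Qed.

Lemma Hdual_normZ c (f : Hdual S p) :
  Hdual_norm (c *: f) = `|c| * Hdual_norm f.
Proof.
rewrite !Hdual_normE dual_coefZ.
exact: (wnormZ (weight_ge0 S (- p)) c (dual_fin f)).
Qed.

Lemma Hdual_norm0_eq0 (f : Hdual S p) : Hdual_norm f = 0 -> f = 0.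
Proof.
move=> f0; apply/val_inj/funext => h /=; apply/eqP.
by rewrite -normr_le0 (le_trans (dual_le_norm f h))// f0 mul0r.
Qed.

(* The norm of [Hdual S p] is the H_(-p) norm, which is also the operator norm
   on functionals on H_p. *)
HB.instance Definition _ := @Lmodule_isNormed.Build R (Hdual S p)
  Hdual_norm Hdual_normD Hdual_normZ Hdual_norm0_eq0.

HB.instance Definition _ :=
  Measurable.copy (Hdual S p) (g_sigma_algebraType (@open (Hdual S p))).

End Hdual_theory.

Arguments seqnorm {R} S s%_R a%_R.
Arguments hnorm {R S} s%_R h%_R.
Arguments dual_hnorm {R S p} s%_R f%_R.

Section dual_borel.
Context {R : realType} (S : hilbert_scale R) (p : R).

Lemma dual_le (f : Hdual S p) (h : Hs S p) : `|f h| <= `|f| * `|h|.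
Proof. exact: dual_le_norm. Qed.

Lemma measurable_dual_eval (h : Hs S p) :
  measurable_fun setT (fun f : Hdual S p => f h : R).
Proof.
have cev : continuous (fun f : Hdual S p => f h : R).
  move=> f; apply/(@cvgrPdist_le _ _ _ (nbhs f)) => e e0; near=> g.
  rewrite (_ : f h - g h = (f - g) h)//.
  rewrite (le_trans (dual_le _ _))// (le_trans (y := `|f - g| * (`|h| + 1)))//.
    by apply: ler_wpM2l; [exact: normr_ge0|rewrite lerDl].
  rewrite -ler_pdivlMr ?ltr_wpDl//.
  near: g; apply/(@nbhs_normP R (Hdual S p) f); exists (e / (`|h| + 1)) => /=.
    by rewrite divr_gt0// ltr_wpDl.
  by move=> g /ltW.
apply: (measurability _ (RGenOpens.measurableE R)) => _ [_ [a [b ->]] <-].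
rewrite setTI; apply: sub_sigma_algebra.
by move/continuousP : cev; apply; exact: interval_open.
Unshelve. all: by end_near. Qed.

End dual_borel.

Section iid.
Context {R : realType} d (X : measurableType d).

Definition tuple_cons n (x : X * n.-tuple X) : n.+1.-tuple X :=
  [the n.+1.-tuple X of x.1 :: x.2].

Lemma measurable_tuple_cons n : measurable_fun setT (@tuple_cons n).
Proof. exact: measurable_cons. Qed.

HB.instance Definition _ n :=
  @isMeasurableFun.Build _ _ _ _ (@tuple_cons n) (@measurable_tuple_cons n).

(* The n-fold product of P with itself. *)
Fixpoint iid_law (P : probability X R) (n : nat) : probability (n.-tuple X) R :=
  match n with
  | 0 => \d_ [tuple]
  | n'.+1 => distribution (P \x iid_law P n')%E (@tuple_cons n')
  end.

End iid.

Section bochner.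
Context {R : realType} d (X : measurableType d) (P : probability X R)
  (V : normedModType R).

Definition simple_map (s : X -> V) : Prop :=
  finite_set (range s) /\ forall v, measurable (s @^-1` [set v]).

Definition simple_integral (s : X -> V) : V :=
  \sum_(v \in range s) fine (P (s @^-1` [set v])) *: v.

Definition is_bochner_integral (f : X -> V) (v : V) : Prop :=
  exists s : nat -> X -> V,
    [/\ forall n, simple_map (s n),
        (\int[P]_x (`|f x - s n x|)%:E)%E @[n --> \oo] --> 0%E &
        simple_integral (s n) @[n --> \oo] --> v].

(* Arbitrary value when f is not Bochner integrable. *)
Definition bochner_integral (f : X -> V) : V := get (is_bochner_integral f).

End bochner.

(* [ef_fin]: the log-partition function is finite on the whole of H_p; the
   value 0 of the integral is excluded since [lne 0 = -oo]. *)
Record exp_family (R : realType) (S : hilbert_scale R) (p : R)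
    d (X : measurableType d) := ExpFamily {
  ef_mu : {sigma_finite_measure set X -> \bar R} ;
  ef_beta : X -> Hdual S p ;
  ef_beta_measurable : measurable_fun setT ef_beta ;
  ef_fin : forall h : Hs S p,
    lne (\int[ef_mu]_x (expR (ef_beta x h))%:E)%E \is a fin_num
}.

Section exp_family_theory.
Context {R : realType} (S : hilbert_scale R) (p : R) d (X : measurableType d)
  (F : exp_family S p X).
Local Notation Theta := (Hs S p).
Local Notation Theta' := (Hdual S p).
Local Notation mu := (ef_mu F).
Local Notation beta := (ef_beta F).

(* M(h) *)
Definition logpart (h : Theta) : R :=
  fine (lne (\int[mu]_x (expR (beta x h))%:E)%E).

Definition density (h : Theta) (x : X) : R := expR (beta x h - logpart h).

Lemma measurable_beta (h : Theta) : measurable_fun setT (fun x => beta x h : R).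
Proof.
apply: (measurableT_comp (measurable_dual_eval h)).
exact: ef_beta_measurable.
Qed.

Lemma measurable_density h : measurable_fun setT (density h).
Proof.
apply: measurableT_comp => //; apply: measurable_funB => //.
exact: measurable_beta.
Qed.

Lemma measurable_density_EFin h :
  measurable_fun setT (EFin \o density h).
Proof. by apply/measurable_EFinP; exact: measurable_density. Qed.

Definition ef_law (h : Theta) (A : set X) : \bar R :=
  (\int[mu]_(x in A) (density h x)%:E)%E.

Section ef_law_probability.
Variable h : Theta.

Let law0 : ef_law h set0 = 0%E.
Proof. by rewrite /ef_law integral_set0. Qed.

Let law_ge0 A : (0 <= ef_law h A)%E.
Proof. by apply: integral_ge0 => x _; rewrite lee_fin expR_ge0. Qed.

Let law_sigma_additive : semi_sigma_additive (ef_law h).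
Proof.
move=> A mA tA mUA; rewrite /ef_law ge0_integral_bigcup//=.
- apply: is_cvg_ereal_nneg_natsum_cond => n _ _.
  by apply: integral_ge0 => x _; rewrite lee_fin expR_ge0.
- by apply: measurable_funTS; exact: measurable_density_EFin.
- by move=> x _; rewrite lee_fin expR_ge0.
Qed.

HB.instance Definition _ := isMeasure.Build _ _ _ (ef_law h)
  law0 law_ge0 law_sigma_additive.

Let law_setT : ef_law h setT = 1%E.
Proof.
have := ef_fin F h; rewrite /ef_law /density /logpart.
set I := (\int[mu]_x (expR (beta x h))%:E)%E => finI.
have I0 : (0 < I)%E.
  by rewrite ltNge; apply/negP => /le0_lneNy I0; rewrite I0 in finI.
have : (I \is a fin_num)%E.
  by rewrite ge0_fin_numE ?(ltW I0)// ltey; apply/negP => /eqP II; rewrite II in finI.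
move=> /fineK Ifin; rewrite -Ifin in I0 *.
rewrite lne_EFin//=.
under eq_integral do rewrite expRD mulrC EFinM.
rewrite ge0_integralZl//=.
- by rewrite -/I expRN lnK ?posrE// -Ifin -EFinM mulVf// gt_eqF.
- apply/measurable_EFinP; apply: measurableT_comp => //; exact: measurable_beta.
Qed.

HB.instance Definition _ :=
  @Measure_isProbability.Build _ _ R (ef_law h) law_setT.

End ef_law_probability.

Definition data_law (h : Theta) (n : nat) : probability (n.-tuple X) R :=
  iid_law (ef_law h) n.

(* T_theta *)
Definition mean_beta (h : Theta) : Theta' := bochner_integral (ef_law h) beta.

(* I(h)[k] *)
Definition fisher (h k : Theta) : \bar R := 'V_(ef_law h)[fun x => beta x k : R].

(* K(g | h): the integral is taken under the law of the second argument. *)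
Definition KL (g h : Theta) : \bar R :=
  (\int[mu]_x (ln (density h x / density g x) * density h x)%:E)%E.

Definition empirical_beta n (x : n.-tuple X) : Theta' :=
  n%:R^-1 *: \sum_(i < n) beta (tnth x i).

Definition posterior_mass (Pi : probability Theta R) n (x : n.-tuple X)
    (A : set Theta) : \bar R :=
  (\int[Pi]_(h in A) (expR (n%:R * (empirical_beta x h - logpart h)))%:E)%E.

Definition posterior (Pi : probability Theta R) n (x : n.-tuple X)
    (A : set Theta) : R :=
  fine (posterior_mass Pi x A) / fine (posterior_mass Pi x setT).

(* [differentiable] is Frechet differentiability; the last clause is continuity
   of the second derivative Theta -> L(Theta, Theta') in operator norm. *)
Definition C2_frechet (M : Theta -> R^o) : Prop :=
  exists DM : Theta -> Theta',
    [/\ forall h, differentiable M h /\ 'd M h = DM h :> (Theta -> R^o),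
        forall h, differentiable DM h &
        forall h (e : R), 0 < e -> \forall g \near h, forall k,
          `|'d DM g k - 'd DM h k| <= e * `|k|].

End exp_family_theory.

Arguments logpart {R S p d X} F h%_R.
Arguments density {R S p d X} F h%_R x.
Arguments ef_law {R S p d X} F h%_R A.
Arguments data_law {R S p d X} F h%_R n%_N.
Arguments mean_beta {R S p d X} F h%_R.
Arguments fisher {R S p d X} F h%_R k%_R.
Arguments KL {R S p d X} F g%_R h%_R.
Arguments posterior {R S p d X} F Pi {n} x A.

Section prior.
Context {R : realType} (S : hilbert_scale R).

Definition mutually_independent d (O : measurableType d) (P : probability O R)
    (t : nat -> O -> R) : Prop :=
  forall (J : seq nat) (B : nat -> set R), uniq J ->
    (forall k, measurable (B k)) ->
    P (\bigcap_(k in [set` J]) (t k @^-1` B k)) =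
    (\prod_(k <- J) P (t k @^-1` B k))%E.

Definition gaussian_series_prior (p alpha : R) (Pi : probability (Hs S p) R)
  : Prop :=
  exists d (O : measurableType d) (P : probability O R)
    (t : nat -> {RV P >-> R}) (theta : {RV P >-> Hs S p}),
  [/\ mutually_independent P t,
      forall k (B : set R), measurable B ->
        distribution P (t k) B = normal_prob 0 1 B,
      {ae P, forall o,
        series (fun k =>
          (hs_lam S k `^ (- alpha - (hs_dim S)%:R / 2) * t k o)
            *: Hs_basis S p k) @ \oo --> theta o} &
      forall A : set (Hs S p), measurable A -> Pi A = distribution P theta A].

End prior.

(* Main.v *)
Require Import Defs.
From HB Require Import structures.
From mathcomp Require Import all_boot all_order all_algebra.
From mathcomp Require Import all_classical all_reals all_analysis.
From mathcomp Require Import measurable_realfun.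
From mathcomp Require Import ring lra.
Import Order.TTheory GRing.Theory Num.Theory.
Import numFieldNormedType.Exports.
Set Implicit Arguments.
Unset Strict Implicit.
Unset Printing Implicit Defensive.
Local Open Scope classical_set_scope.
Local Open Scope ring_scope.

(** Write [g] for the minimum of [alpha] and [beta], [L] for the resolution
    [n `^ (2 * alpha + dim)^-1] and [e] for [L `^ (- g)]; the rate claimed in
    H_s is then [L `^ s * e]. With [h = theta - theta0], the log-likelihood
    ratio is exactly [n * (N h - K h)], where the noise [N] is the centred
    empirical mean of the sufficient statistic, a linear functional of [h], and
    [K h = M (theta0 + h) - M theta0 - T0 h] is the Kullback-Leibler divergence
    ([loglik_ratio_centred], [KL_formula]). So it is enough to compare [N] and
    [K] on a set that the prior charges up to an error negligible with respect
    to the evidence. Frequencies below and above [L] are treated differently,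
    through weights that depend on [L]; the number of frequencies below [L] is
    at most of order [L `^ dim] ([spectral_count]).

    Noise. Each coordinate of [N] has second moment at most [C0 / n]. Measured
    in the dual of the norm with weight 1 up to frequency [L] and
    [(lam / L) `^ (2 * m)] beyond, its mean square is of order
    [L `^ dim / n = L `^ (- 2 * alpha)], because [dim < 2 * m]; this is at most
    of order [e ^+ 2] ([noise_moment], [mixed_weight_inv_sum]). By Markov's
    inequality [N h] is at most a constant times [e] times that norm of [h],
    off an event of small probability.

    Prior. The sieve of those [theta] whose frequencies below [L] are bounded
    in H_a with [a = alpha + dim / 2], those above [L] in H_s', with [s'] the
    maximum of [s] and [m], has a complement of mass at most
    [expR (- c * n * e ^+ 2)] for any prescribed [c], by Chernoff's bound for a
    weighted sum of squares ([prior_sieve_tail]). A product of intervals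
    for the coordinates shows that a ball of radius of order [e] around
    [theta0] has mass at least [expR (- C * n * e ^+ 2)]
    ([prior_small_ball]); on it the divergence is of order [e ^+ 2]
    ([divergence_upper]), so the evidence has the same lower bound.

    Divergence. On the sieve the high frequencies of [h] are under control, so
    a point far from [theta0] in H_s has a low-frequency part of norm [u] much
    larger than [e] ([far_low_frequency]). For moderate [u] the local expansion
    applies with a negligible remainder and gives [K h] of order [u ^+ 2]; for
    larger [u] the global bound in a negative norm takes over, because low
    frequencies lose at most the factor [L `^ (- r)] in that norm
    ([divergence_lower]). Either way [K h] exceeds a large multiple of [e * u],
    while the noise is at most a fixed multiple of it, so the likelihood ratio
    is below [expR (- c * n * e ^+ 2)] at such points ([loglik_ratio_sieve]).

    Outside the sieve the likelihood ratio is not bounded pointwise, but its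
    mean is one, so that the mean of its integral over the complement of the
    sieve is the prior mass of this complement ([mean_partial_evidence]).
    Dividing by the evidence bounds the posterior ([posterior_le_evidence],
    [contraction_level]). The conditions on the exponents only
    make finitely many exponents of [L] negative. *)

(** * Powers and counting of frequencies *)

Section powers.
Context {R : realType}.
Implicit Types x y a b e c : R.

Lemma powRD_gt0 x a b : 0 < x -> x `^ (a + b) = x `^ a * x `^ b.
Proof. by move=> x0; rewrite powRD// (gt_eqF x0) implybT. Qed.

Lemma powRV x a : 0 <= x -> x^-1 `^ a = (x `^ a)^-1.
Proof. by move=> x0; rewrite -powR_inv1// -powRrM mulrC powRrM powR_inv1// powR_ge0. Qed.

Lemma powR_div x y a : 0 <= x -> 0 <= y -> (x / y) `^ a = x `^ a / y `^ a.
Proof. by move=> x0 y0; rewrite powRM ?invr_ge0// powRV. Qed.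

Lemma ler_powR_le0 x y a : 0 < x -> x <= y -> a <= 0 -> y `^ a <= x `^ a.
Proof.
move=> x0 xy a0; have y0 := lt_le_trans x0 xy.
rewrite -[a]opprK !(powRN _ (- a)) lef_pV2 ?posrE ?powR_gt0//.
by apply: ge0_ler_powR; rewrite ?nnegrE ?oppr_ge0// ltW.
Qed.

Lemma powR_le1 x a : 1 <= x -> a <= 0 -> x `^ a <= 1.
Proof. by move=> x1 a0; rewrite -(powRr0 x) ler_powR. Qed.

Lemma powR_ge1 x a : 1 <= x -> 0 <= a -> 1 <= x `^ a.
Proof. by move=> x1 a0; rewrite -{1}(powRr0 x) ler_powR. Qed.

Lemma powR_ge1_le0 x a : 0 < x -> x <= 1 -> a <= 0 -> 1 <= x `^ a.
Proof. by move=> x0 x1 a0; rewrite -{1}(powRr0 x); apply: ger_powR; rewrite ?x0. Qed.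

Lemma powR_le1_ge0 x a : 0 < x -> x <= 1 -> 0 <= a -> x `^ a <= 1.
Proof. by move=> x0 x1 a0; rewrite -[leRHS](powRr0 x); apply: ger_powR; rewrite ?x0. Qed.

(** Strict inequalities between exponents are used in this form: a negative
    power of the resolution absorbs any constant. *)
Lemma powR_small c e : e < 0 ->
  exists2 L0, 1 <= L0 & forall L, L0 <= L -> c * L `^ e <= 1.
Proof.
move=> e0; have e0' : - e > 0 by rewrite oppr_gt0.
pose d := Num.max c 1.
have d1 : 1 <= d by rewrite le_max lexx orbT.
have d0 : 0 < d by exact: lt_le_trans d1.
have e1 : 0 <= (- e)^-1 by rewrite invr_ge0 ltW.
exists (d `^ (- e)^-1) => [|L hL]; first exact: powR_ge1.
have L0 : 0 < L by apply: lt_le_trans hL; rewrite powR_gt0.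
have dL : d <= L `^ (- e).
  rewrite -[leLHS](powRr1 (ltW d0)) -(mulVf (lt0r_neq0 e0')) powRrM.
  by apply: ge0_ler_powR => //; rewrite ?nnegrE ?powR_ge0// ltW.
rewrite -[e]opprK powRN ler_pdivrMr ?powR_gt0// mul1r.
by rewrite (le_trans _ dL)// le_max lexx.
Qed.

(** Comparison of a power with the integral over the preceding unit interval,
    obtained from two uses of [1 + x <= expR x]. *)
Lemma powR_telescope (k t : R) : 1 < k -> 0 < t ->
  (t + 1) `^ (- k) <= (k - 1)^-1 * (t `^ (1 - k) - (t + 1) `^ (1 - k)).
Proof.
move=> k1 t0; have k10 : 0 < k - 1 by rewrite subr_gt0.
have t10 : 0 < t + 1 by rewrite addr_gt0.
rewrite ler_pdivlMl//.
have Ht : t `^ (1 - k) = (t + 1) `^ (1 - k) * expR ((k - 1) * - ln (t / (t + 1))).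
  rewrite /powR !gt_eqF// -expRD; congr expR.
  rewrite ln_div ?posrE//; ring.
have Hs : (t + 1) `^ (1 - k) = (t + 1) * (t + 1) `^ (- k).
  by rewrite powRD_gt0// powRr1// ltW.
rewrite Ht Hs; set E := expR _; set u := (t + 1) `^ (- k).
have -> : (t + 1) * u * E - (t + 1) * u = ((t + 1) * (E - 1)) * u by ring.
rewrite ler_wpM2r ?powR_ge0//.
have h1 : (t + 1)^-1 <= - ln (t / (t + 1)).
  have q0 : 0 < t / (t + 1) by rewrite divr_gt0.
  have := expR_ge1Dx (ln (t / (t + 1))); rewrite lnK ?posrE//.
  have -> : t / (t + 1) = 1 - (t + 1)^-1 by field; rewrite gt_eqF.
  lra.
have h3 : (k - 1) * (t + 1)^-1 <= E - 1.
  rewrite lerBrDl (le_trans _ (expR_ge1Dx _))// lerD2l ler_wpM2l// ltW//.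
have -> : k - 1 = (t + 1) * ((k - 1) * (t + 1)^-1) by field; rewrite gt_eqF.
by rewrite ler_wpM2l// ltW.
Qed.

Lemma sum_powR_le (k N : R) (n : nat) : 1 < k -> 0 < N ->
  \sum_(0 <= j < n) (N + j.+1%:R) `^ (- k) <= (k - 1)^-1 * N `^ (1 - k).
Proof.
move=> k1 N0; have k10 : 0 <= (k - 1)^-1 by rewrite invr_ge0 subr_ge0 ltW.
apply: (@le_trans _ _ ((k - 1)^-1 * (N `^ (1 - k) - (N + n%:R) `^ (1 - k)))).
  elim: n => [|n IH]; first by rewrite big_geq// addr0 subrr mulr0.
  rewrite big_nat_recr//=; have := @powR_telescope k (N + n%:R) k1.
  move=> /(_ (ltr_wpDr (ler0n _ _) N0)).
  by rewrite -addrA -natr1; move: IH; rewrite !mulrBr; lra.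
by rewrite ler_wpM2l// lerBlDr lerDl powR_ge0.
Qed.

(** The inverse square root of [j.+1] is at most twice the increment of the
    square root, so the sum telescopes. *)
Lemma sum_invsqrt_le (N : R) (n : nat) : 0 < N ->
  \sum_(0 <= j < n) (if j.+1%:R <= N then Num.sqrt (N / j.+1%:R) else 0) <= 2 * N.
Proof.
move=> N0.
have E j : Num.sqrt (N / j.+1%:R) <=
    2 * Num.sqrt N * (Num.sqrt j.+1%:R - Num.sqrt j%:R).
  rewrite sqrtrM ?(ltW N0)// sqrtrV ?ler0n// mulrAC [leRHS]mulrC.
  apply: ler_wpM2l; first exact: sqrtr_ge0.
  set u := Num.sqrt j.+1%:R; set v := Num.sqrt j%:R.
  have u0 : 0 < u by rewrite sqrtr_gt0 ltr0n.
  have v0 : 0 <= v by rewrite sqrtr_ge0.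
  have uu : u ^+ 2 = 1 + v ^+ 2 by rewrite !sqr_sqrtr ?ler0n// nat1r.
  rewrite -[leLHS]mul1r ler_pdivrMr//; nra.
apply: (@le_trans _ _ (2 * Num.sqrt N * Num.sqrt (Num.min n%:R N))).
  elim: n => [|n IH].
    by rewrite big_geq// mulr_ge0 ?mulr_ge0 ?sqrtr_ge0//.
  rewrite big_nat_recr//=; case: ifPn => [nN|_]; last first.
    rewrite addr0 (le_trans IH)// ler_wpM2l ?mulr_ge0 ?sqrtr_ge0// ler_wsqrtr//.
    by rewrite le_min !ge_min lexx ler_nat leqnSn orbT.
  rewrite (min_idPl nN); rewrite (min_idPl _) in IH.
    by have := E n; rewrite mulrBr; lra.
  by rewrite (le_trans _ nN)// ler_nat.
rewrite -mulrA ler_wpM2l// -[leRHS](sqr_sqrtr (ltW N0)) expr2.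
by rewrite ler_wpM2l ?sqrtr_ge0// ler_wsqrtr// ge_min lexx orbT.
Qed.

End powers.

Section counting.
Context {R : realType} (S : hilbert_scale R).
Local Notation lam := (hs_lam S).
Local Notation dim := ((hs_dim S)%:R : R).

Lemma hs_dimR_gt0 : 0 < dim.
Proof. by rewrite ltr0n hs_dim_gt0. Qed.

(** Finitely many frequencies escape the asymptotic bound; being positive,
    they are covered by lowering the constant. *)
Lemma hs_lam_lower : exists2 a : R, 0 < a &
  forall k, a * k.+1%:R `^ dim^-1 <= lam k.
Proof.
have [a [b [a0 _ [N _ hN]]]] := hs_lam_asymp S.
have lam0 := hs_lam_gt0 S.
pose c := lam 0%N / N.+1%:R `^ dim^-1.
have N0 : 0 < N.+1%:R `^ dim^-1 by rewrite powR_gt0// ltr0n.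
exists (Num.min a c) => [|k]; first by rewrite lt_min a0 divr_gt0.
have [Nk|kN] := leqP N k.
  have /andP[h _] := hN k Nk.
  by rewrite (le_trans _ h)// ler_wpM2r ?powR_ge0// ge_min lexx.
apply: (@le_trans _ _ (lam 0%N)); last exact: hs_lam_ndecr.
apply: (@le_trans _ _ (c * k.+1%:R `^ dim^-1)).
  by rewrite ler_wpM2r ?powR_ge0// ge_min lexx orbT.
rewrite /c mulrAC ler_pdivrMr// ler_wpM2l ?(ltW (lam0 _))//.
apply: ge0_ler_powR; rewrite ?nnegrE ?ler0n ?invr_ge0//.
by rewrite ler_nat ltnW.
Qed.

(** The growth allowed below 1 is chosen to dominate the logarithm of [x]
    while keeping the sum in [spectral_count] of the order of the number of
    frequencies. *)
Definition spectral_profile (kappa x : R) : R :=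
  if x <= 1 then x `^ (- (dim / 2)) else x `^ (- kappa).

(** With [N] of order [L `^ dim], the ratio [lam k / L] is at least
    [(k.+1 / N) `^ dim^-1]. The profile is therefore at most
    [(k.+1 / N) `^ (- 2^-1)] for the first [N] indices and
    [(k.+1 / N) `^ (- q)], with [q = kappa / dim > 1], for the others, and
    both parts sum to a multiple of [N]. *)
Lemma spectral_count (kappa : R) : dim < kappa -> exists2 C : R, 0 < C &
  forall (L : R) (n : nat), 1 <= L ->
  \sum_(0 <= k < n) spectral_profile kappa (lam k / L) <= C * L `^ dim.
Proof.
move=> dk; have d0 := hs_dimR_gt0; have k0 : 0 < kappa by exact: lt_trans dk.
have [a a0 ha] := hs_lam_lower.
pose q := kappa / dim.
have q1 : 1 < q by rewrite ltr_pdivlMr// mul1r.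
pose A := a `^ (- dim).
have A0 : 0 < A by rewrite powR_gt0.
exists ((2 + 2 `^ q * (q - 1)^-1) * A) => [|L n L1].
  by rewrite mulr_gt0// ltr_pwDl// mulr_ge0 ?powR_ge0// invr_ge0 subr_ge0 ltW.
have L0 : 0 < L by exact: lt_le_trans L1.
have [N NE] : {N | N = A * L `^ dim} by exists (A * L `^ dim).
have N0 : 0 < N by rewrite NE mulr_gt0// powR_gt0.
have lx k : (k.+1%:R / N) `^ dim^-1 <= lam k / L.
  have Nd : N `^ dim^-1 = L / a.
    rewrite NE powRM ?powR_ge0// -!powRrM mulNr mulfV ?gt_eqF//.
    by rewrite powRN !powRr1 ?(ltW a0) ?(ltW L0)// mulrC.
  rewrite powR_div ?ler0n ?(ltW N0)// Nd ler_pdivlMr// invf_div mulrA divfK ?gt_eqF//.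
  by rewrite mulrC.
have y0 k : 0 < k.+1%:R / N by rewrite divr_gt0.
have x0 k : 0 < lam k / L by rewrite divr_gt0// hs_lam_gt0.
(* Replacing [k.+1] by the average of [N] and [k.+1] makes the second summand
   usable for every [k], at the price of the factor [2 `^ q]. *)
have term k : spectral_profile kappa (lam k / L) <=
   (if k.+1%:R <= N then Num.sqrt (N / k.+1%:R) else 0) +
   2 `^ q * N `^ q * (N + k.+1%:R) `^ (- q).
  have t0 : 0 <= 2 `^ q * N `^ q * (N + k.+1%:R) `^ (- q).
    by rewrite !mulr_ge0 ?powR_ge0.
  have s0 : 0 <= if k.+1%:R <= N then Num.sqrt (N / k.+1%:R) else 0.
    by case: ifP => // _; exact: sqrtr_ge0.
  rewrite /spectral_profile; case: ifPn => [x1|]; last rewrite -ltNge => x1.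
  - have kN : k.+1%:R <= N.
      rewrite leNgt; apply/negP => Nk; have h : 1 < k.+1%:R / N.
        by rewrite ltr_pdivlMr// mul1r.
      have := le_trans (lx k) x1; rewrite leNgt => /negP; apply.
      have : 1 `^ dim^-1 < (k.+1%:R / N) `^ dim^-1.
        by apply: gt0_ltr_powR; rewrite ?nnegrE ?invr_gt0// ltW.
      by rewrite powR1.
    rewrite kN -[leLHS]addr0 lerD//.
    have -> : Num.sqrt (N / k.+1%:R) = ((k.+1%:R / N) `^ dim^-1) `^ (- (dim / 2)).
      rewrite -powRrM mulrN mulrA mulVf ?gt_eqF// mul1r powRN powR12_sqrt ?ltW//.
      by rewrite -sqrtrV ?invf_div// ltW.
    by apply: ler_powR_le0; rewrite ?powR_gt0// oppr_le0 divr_ge0// ltW.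
  - rewrite -[leLHS]add0r lerD//.
    have Nk0 : 0 < N + k.+1%:R by rewrite addr_gt0.
    have -> : 2 `^ q * N `^ q * (N + k.+1%:R) `^ (- q) =
        ((N + k.+1%:R) / (2 * N)) `^ (- q).
      rewrite (powR_div (- q) (ltW Nk0)) ?mulr_ge0 ?(ltW N0)//.
      rewrite [(2 * N) `^ _]powRN invrK.
      by rewrite powRM ?(ltW N0)// mulrC.
    have NN0 : 0 < (N + k.+1%:R) / (2 * N) by rewrite divr_gt0// mulr_gt0.
    have [kN|Nk] := leP k.+1%:R N.
      apply: (@le_trans _ _ 1).
        by apply: powR_le1; rewrite ?oppr_le0 ltW.
      apply: powR_ge1_le0 => //; last by rewrite oppr_le0; lra.
      by rewrite ler_pdivrMr ?mulr_gt0// mul1r; lra.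
    apply: (@le_trans _ _ ((k.+1%:R / N) `^ (- q))).
      have -> : (k.+1%:R / N) `^ (- q) = ((k.+1%:R / N) `^ dim^-1) `^ (- kappa).
        by rewrite -powRrM mulrN; congr (_ `^ - _); rewrite mulrC.
      by apply: ler_powR_le0; rewrite ?powR_gt0// oppr_le0 ltW.
    apply: ler_powR_le0 => //; last by rewrite oppr_le0; lra.
    rewrite ler_pdivrMr ?mulr_gt0// mulrCA divfK ?gt_eqF//; lra.
have le1 : _ <= _ := ler_sum _ (fun k (_ : true) => term k).
rewrite (le_trans (le1 _))// big_split/= -mulr_sumr.
have h1 := sum_invsqrt_le n N0.
have h2 := sum_powR_le n q1 N0.
have h3 : 2 `^ q * N `^ q * (\sum_(0 <= j < n) (N + j.+1%:R) `^ (- q)) <=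
    2 `^ q * (q - 1)^-1 * N.
  apply: (@le_trans _ _ (2 `^ q * N `^ q * ((q - 1)^-1 * N `^ (1 - q)))).
    by rewrite ler_wpM2l// mulr_ge0 ?powR_ge0.
  have -> : 2 `^ q * (q - 1)^-1 * N = 2 `^ q * (q - 1)^-1 * (N `^ q * N `^ (1 - q)).
    by rewrite -powRD_gt0// addrCA subrr addr0 powRr1// ltW.
  by rewrite le_eqVlt; apply/orP; left; apply/eqP; ring.
have -> : (2 + 2 `^ q / (q - 1)) * A * L `^ dim = (2 + 2 `^ q / (q - 1)) * N.
  by rewrite NE mulrA.
by rewrite mulrDl; apply: lerD.
Qed.

End counting.

(** * Integrals against a density and Gaussian estimates on the line *)

Section upper_integral.
Local Open Scope ereal_scope.
Context d (T : measurableType d) {R : realType} (mu : {measure set T -> \bar R}).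

(** The integral of a nonnegative function is a supremum over the simple
    functions below it, hence monotone whatever the measurability. The
    posterior mass of an arbitrary set is bounded in mean through this. *)
Lemma ge0_le_integral_nonmeasurable (f g : T -> \bar R) :
  (forall x, 0 <= f x) -> (forall x, f x <= g x) ->
  \int[mu]_x f x <= \int[mu]_x g x.
Proof.
move=> f0 fg; rewrite !ge0_integralTE//; last first.
  by move=> x; exact: le_trans (fg x).
by apply: le_ereal_sup => _ [h hf <-]; exists h => // x; exact: le_trans (fg x).
Qed.

End upper_integral.

Section density.
Local Open Scope ereal_scope.
Context d (T : measurableType d) {R : realType}.
Variables (mu nu : {measure set T -> \bar R}) (g : T -> R).
Hypothesis g0 : forall x, (0 <= g x)%R.
Hypothesis mg : measurable_fun setT g.
Hypothesis nuE : forall A, measurable A -> nu A = \int[mu]_(x in A) (g x)%:E.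

Import HBNNSimple.

(** The two sides agree on indicators by [nuE], hence on simple functions, and
    monotone convergence carries both to the limit. *)
Lemma ge0_integral_density (f : T -> \bar R) : measurable_fun setT f ->
  (forall x, 0 <= f x) -> \int[nu]_x f x = \int[mu]_x (f x * (g x)%:E).
Proof.
move=> mf f0; pose h := nnsfun_approx measurableT mf.
have mgE : measurable_fun setT (EFin \o g) by exact/measurable_EFinP.
have hf x : EFin \o h^~ x @ \oo --> f x by exact: cvg_nnsfun_approx.
have ndh x : {homo (fun n => h n x) : a b / (a <= b)%N >-> (a <= b)%R}.
  by move=> a b ab; exact/lefP/nd_nnsfun_approx.
have h0 n x : (0 <= h n x)%R by [].
have mh n : measurable_fun setT (h n) by exact: measurable_funP.
have -> : \int[nu]_x f x = limn (fun n => \int[nu]_x (h n x)%:E).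
  under eq_integral => x _ do rewrite -(cvg_lim _ (hf x))//.
  apply: monotone_convergence => //.
  - by move=> n; exact/measurable_EFinP.
  - by move=> n x _; rewrite lee_fin.
  - by move=> x _ a b ab; rewrite lee_fin; exact: ndh.
have -> : \int[mu]_x (f x * (g x)%:E) =
    limn (fun n => \int[mu]_x ((h n x)%:E * (g x)%:E)).
  have hfg x : (h n x)%:E * (g x)%:E @[n --> \oo] --> f x * (g x)%:E.
    by apply: cvgeZr => //; exact: hf.
  under eq_integral => x _ do rewrite -(cvg_lim _ (hfg x))//.
  apply: monotone_convergence => //.
  - by move=> n; apply: emeasurable_funM => //; exact/measurable_EFinP.
  - by move=> n x _; rewrite mule_ge0// lee_fin.
  - by move=> x _ a b ab; rewrite lee_wpmul2r ?lee_fin//; exact: ndh.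
congr (limn _); apply/funext => n.
have indm r : measurable_fun setT (fun x => (r * \1_(h n @^-1` [set r]) x)%:E).
  by apply/measurable_EFinP; apply: measurable_funM => //; exact: measurable_indic.
under eq_integral do rewrite fimfunE -fsumEFin//.
rewrite ge0_integral_fsum//; last by move=> r x _; exact: nnfun_muleindic_ge0.
under [RHS]eq_integral => x _.
  rewrite fimfunE -fsumEFin// ge0_mule_fsuml; last first.
    by move=> r; exact: nnfun_muleindic_ge0.
  over.
rewrite ge0_integral_fsum//; last 2 first.
- by move=> r; exact: emeasurable_funM.
- by move=> r x _; apply: mule_ge0; [exact: nnfun_muleindic_ge0|rewrite lee_fin].
apply: eq_fsbigr => r rhn.
have r0 : (0 <= r)%R by move: rhn; rewrite inE => -[t _ <-].
under eq_integral do rewrite EFinM.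
under [RHS]eq_integral do rewrite EFinM -muleA.
have mA : measurable (h n @^-1` [set r]) by [].
rewrite !ge0_integralZl//.
- rewrite integral_indic// setIT nuE//; congr (_ * _).
  rewrite integral_mkcond; apply: eq_integral => x _.
  by rewrite epatch_indic muleC.
- apply: emeasurable_funM => //; apply/measurable_EFinP.
  exact: measurable_indic.
- by move=> x _; rewrite mule_ge0 ?lee_fin.
- by apply/measurable_EFinP; exact: measurable_indic.
Qed.

Lemma integrable_density (f : T -> R) : measurable_fun setT f ->
  nu.-integrable setT (EFin \o f) ->
  mu.-integrable setT (fun x => (f x * g x)%:E) /\
  \int[nu]_x (f x)%:E = \int[mu]_x (f x * g x)%:E.
Proof.
move=> mf /integrableP[_ fi].
have mfg : measurable_fun setT (fun x => (f x * g x)%:E).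
  by apply/measurable_EFinP; exact: measurable_funM.
split.
  apply/integrableP; split => //.
  move: fi; rewrite ge0_integral_density//; last first.
    by apply: measurableT_comp => //; exact/measurable_EFinP.
  congr (_ < _); apply: eq_integral => x _ /=.
  by rewrite -EFinM normrM (ger0_norm (g0 x)).
rewrite integralE [RHS]integralE !ge0_integral_density//; last 2 first.
- by apply: measurable_funeneg; exact/measurable_EFinP.
- by apply: measurable_funepos; exact/measurable_EFinP.
by congr (_ - _); apply: eq_integral => x _;
  rewrite ?funeposE ?funenegE -?EFinN -!EFin_max -EFinM maxr_pMl ?mul0r ?mulNr.
Qed.

End density.

Section gaussian.
Context {R : realType}.
Local Notation gauss := (normal_prob (0 : R) 1).
Local Notation leb := (@lebesgue_measure R).

Lemma integral_gauss (f : R -> R) : measurable_fun setT f ->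
  (forall x, 0 <= f x) ->
  (\int[gauss]_x (f x)%:E = \int[leb]_x (f x * normal_pdf 0 1 x)%:E)%E.
Proof.
move=> mf f0; rewrite (@ge0_integral_density _ _ _ leb gauss (normal_pdf 0 1))//.
- by move=> x; exact: normal_pdf_ge0.
- exact: measurable_normal_pdf.
- exact/measurable_EFinP.
Qed.

Definition gauss_exp_sq : R := normal_peak 1 / normal_peak (Num.sqrt 2).

Lemma gauss_exp_sq_gt0 : 0 < gauss_exp_sq.
Proof. by rewrite divr_gt0// normal_peak_gt0// gt_eqF// sqrtr_gt0. Qed.

(** Multiplying by [expR (x ^+ 2 / 4)] turns the standard Gaussian density
    into a multiple of the centred one of variance 2. *)
Lemma integral_gauss_exp_sq :
  (\int[gauss]_x (expR (x ^+ 2 / 4))%:E = gauss_exp_sq%:E)%E.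
Proof.
have s2 : Num.sqrt 2 != 0 :> R by rewrite gt_eqF// sqrtr_gt0.
rewrite integral_gauss//; last first.
  by apply: measurableT_comp => //; apply: measurable_funM => //; exact: exprn_measurable.
under eq_integral => x _.
  have -> : expR (x ^+ 2 / 4) * normal_pdf 0 1 x =
      gauss_exp_sq * normal_pdf 0 (Num.sqrt 2) x.
    rewrite !normal_pdfE// ?oner_eq0// /gauss_exp_sq /normal_fun !subr0.
    rewrite [RHS]mulrA divfK ?gt_eqF ?normal_peak_gt0// mulrCA -expRD.
    by congr (_ * expR _); rewrite sqr_sqrtr//; field.
  rewrite EFinM; over.
rewrite ge0_integralZl//.
- by rewrite integral_normal_pdf mule1.
- by apply/measurable_EFinP; exact: measurable_normal_pdf.
- by move=> x _; rewrite lee_fin normal_pdf_ge0.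
- by rewrite lee_fin ltW// gauss_exp_sq_gt0.
Qed.

(** Convexity gives [expR (w * y) <= 1 - w + w * expR y], so the bound is
    exponential in [w]; in a product over the coordinates only the sum of the
    weights is then left. *)
Lemma gauss_mgf_sq (w : R) : 0 <= w <= 1 ->
  (\int[gauss]_x (expR (w * x ^+ 2 / 4))%:E <= (expR (gauss_exp_sq * w))%:E)%E.
Proof.
move=> /andP[w0 w1].
have mE : measurable_fun setT (fun x : R => expR (x ^+ 2 / 4)).
  by apply: measurableT_comp => //; apply: measurable_funM => //; exact: exprn_measurable.
apply: (@le_trans _ _ (\int[gauss]_x (1 + w * expR (x ^+ 2 / 4))%:E)%E).
  apply: ge0_le_integral_nonmeasurable => x; rewrite lee_fin ?expR_ge0//.
  have := @convex_expR R (Itv01 w0 w1) (x ^+ 2 / 4) 0.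
  rewrite !convRE/= expR0 mulr0 addr0 mulr1 mulrA => /le_trans; apply.
  by rewrite addrC lerD2r lerBlDr lerDl.
under eq_integral do rewrite EFinD.
rewrite ge0_integralD//; last 2 first.
- by move=> x _; rewrite lee_fin mulr_ge0// expR_ge0.
- by apply/measurable_EFinP; exact: measurable_funM.
under [X in (_ + X)%E]eq_integral do rewrite EFinM.
rewrite ge0_integralZl//; last exact/measurable_EFinP.
rewrite integral_gauss_exp_sq integral_cst//= -[normal_prob _ _ _]/(gauss setT).
by rewrite probability_setT mule1 -EFinM -EFinD lee_fin mulrC expR_ge1Dx.
Qed.

Definition gauss_ball_const : R := normal_peak 1 * expR (- 2^-1).

Lemma gauss_ball_const_gt0 : 0 < gauss_ball_const.
Proof. by rewrite mulr_gt0 ?expR_gt0// normal_peak_gt0. Qed.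

(** The factor [expR (- 2^-1)] in the constant pays for the 1 in the bound on
    [y ^+ 2]. *)
Lemma gauss_itv_ge (u t b : R) : 0 <= t ->
  (forall y, u <= y <= u + t -> y ^+ 2 <= b ^+ 2 + 1) ->
  ((gauss_ball_const * t * expR (- (b ^+ 2 / 2)))%:E
    <= gauss `[u, (u + t)%R]%classic)%E.
Proof.
move=> t0 hb; pose c := gauss_ball_const * expR (- (b ^+ 2 / 2)).
have c0 : 0 <= c by rewrite mulr_ge0 ?expR_ge0// ltW// gauss_ball_const_gt0.
apply: (@le_trans _ _ (\int[leb]_(x in `[u, (u + t)%R]%classic) c%:E)%E).
  rewrite integral_cst//= lebesgue_measure_itv/= lte_fin.
  case: ifPn => [_|]; last first.
    by rewrite ltrDl -leNgt => t0'; rewrite (_ : t = 0) ?mulr0 ?mul0r ?mule0//; lra.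
  by rewrite -EFinB -EFinM lee_fin /c (addrC u) addrK mulrAC.
apply: ge0_le_integral => //.
- apply: measurable_funTS; apply/measurable_EFinP.
  exact: measurable_normal_pdf.
- move=> y; rewrite /= in_itv/= => /hb yb; rewrite lee_fin normal_pdfE ?oner_eq0//.
  rewrite /c /gauss_ball_const /normal_fun -mulrA -expRD.
  rewrite ler_wpM2l ?normal_peak_ge0// ler_expR subr0 expr1n; lra.
Qed.

(** The half of the interval on the side of the origin suffices: there
    [y ^+ 2 <= b ^+ 2 + 1]. *)
Lemma gauss_ball_ge (b t : R) : 0 <= t <= 1 ->
  ((gauss_ball_const * t * expR (- (b ^+ 2 / 2)))%:E
    <= gauss `[(b - t)%R, (b + t)%R]%classic)%E.
Proof.
move=> /andP[t0 t1]; have [b0|b0] := leP 0 b.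
  apply: le_trans (gauss_itv_ge (u := b - t) t0 _) _ => [y /andP[]|].
    rewrite subrK => y1 y2; nra.
  by apply: le_measure; rewrite ?inE// => y /=; rewrite !in_itv/=; lra.
apply: le_trans (gauss_itv_ge (u := b) t0 _) _ => [y /andP[] y1 y2|].
  nra.
by apply: le_measure; rewrite ?inE// => y /=; rewrite !in_itv/=; lra.
Qed.

(** The exponential moment dominates every even moment, so Markov's inequality
    gives polynomial decay of any order. *)
Lemma gauss_tail (j : nat) : exists2 C : R, 0 < C & forall t : R, 0 < t ->
  (gauss [set x | (t < `|x|)%R] <= (C / t ^+ (2 * j.+1))%:E)%E.
Proof.
exists (gauss_exp_sq * (4 ^+ j.+1 * (j.+1)`!%:R)) => [|t t0].
  by rewrite mulr_gt0 ?gauss_exp_sq_gt0// mulr_gt0 ?exprn_gt0// ltr0n fact_gt0.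
have mt : measurable [set x : R | t < `|x|].
  rewrite (_ : mkset _ = `]-oo, (- t)[%classic `|` `]t, +oo[%classic).
    by apply: measurableU; exact: measurable_itv.
  apply/seteqP; split => x /=; rewrite !in_itv/= andbT real_ltr_normr ?num_real//.
    by move=> /orP[|h]; [right|left; lra].
  by move=> [h|->//]; apply/orP; right; lra.
set F := (j.+1)`!%:R : R; have F0 : 0 < F by rewrite ltr0n fact_gt0.
have c0 : 0 < t ^+ (2 * j.+1) / (4 ^+ j.+1 * F).
  by rewrite divr_gt0 ?exprn_gt0// mulr_gt0// exprn_gt0.
suff : ((t ^+ (2 * j.+1) / (4 ^+ j.+1 * F))%:E * gauss [set x | (t < `|x|)%R]
    <= gauss_exp_sq%:E)%E.
  rewrite -lee_pdivlMl// -EFinM => /le_trans; apply; rewrite lee_fin.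
  by rewrite invf_div -mulrA mulrC mulrA.
rewrite -integral_gauss_exp_sq -integral_cst//.
apply: (@le_trans _ _ (\int[gauss]_(x in [set x | (t < `|x|)%R])
    (expR (x ^+ 2 / 4))%:E)%E); last first.
  apply: ge0_subset_integral => //.
  apply/measurable_EFinP; apply: measurableT_comp => //.
  by apply: measurable_funM => //; exact: exprn_measurable.
apply: ge0_le_integral => //.
- by move=> x _; rewrite lee_fin ltW.
- apply: measurable_funTS; apply/measurable_EFinP; apply: measurableT_comp => //.
  by apply: measurable_funM => //; exact: exprn_measurable.
- move=> x /= tx; rewrite lee_fin.
  have x0 : 0 <= x ^+ 2 / 4 by rewrite divr_ge0// sqr_ge0.
  have := expR_ge1Dxn j x0 => h.
  apply: (@le_trans _ _ ((x ^+ 2 / 4) ^+ j.+1 / F)); last by rewrite /F; lra.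
  rewrite expr_div_n -exprM invfM mulrA ler_pM2r ?invr_gt0//.
  rewrite ler_pM2r ?invr_gt0 ?exprn_gt0//.
  rewrite exprM (exprM x) -(real_normK (num_real x)) -!exprM.
  by rewrite lerXn2r ?nnegrE// ltW.
Qed.

(** Once the probability of the interval is bounded below, minus its logarithm
    is at most a multiple of the tail probability. *)
Lemma gauss_ball_ge_tail (j : nat) : exists2 C : R, 0 < C &
  forall t : R, 1 <= t ->
  ((expR (- (C / t ^+ (2 * j.+1))))%:E <= gauss `[(- t)%R, t]%classic)%E.
Proof.
have [A A0 hA] := gauss_tail j.
have c0 := gauss_ball_const_gt0.
exists (A / gauss_ball_const) => [|t t1]; first by rewrite divr_gt0.
have t0 : 0 < t by lra.
have hc : (gauss_ball_const%:E <= gauss `[(- t)%R, t]%classic)%E.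
  apply: le_trans (le_trans (gauss_ball_ge 0 (t := 1) _) _); rewrite ?ler01 ?lexx//.
    by rewrite expr0n mul0r oppr0 expR0 !mulr1.
  by apply: le_measure; rewrite ?inE// => y /=; rewrite !in_itv/=; lra.
have := hA _ t0.
have -> : [set x : R | t < `|x|] = ~` `[(- t)%R, t]%classic.
  apply/seteqP; split => x /=; rewrite in_itv/= -ler_norml.
    by rewrite ltNge => /negP.
  by move=> /negP; rewrite -ltNge.
rewrite probability_setC// => hp.
have [q gq] : exists q, gauss `[(- t)%R, t]%classic = q%:E.
  by exists (fine (gauss `[(- t)%R, t]%classic)); rewrite fineK// fin_num_measure.
have {}hp : 1 - q <= A / t ^+ (2 * j.+1).
  by rewrite -lee_fin EFinB -gq; exact: hp.
have hq : gauss_ball_const <= q by rewrite -lee_fin -gq.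
rewrite gq lee_fin.
have q0 : 0 < q by exact: lt_le_trans hq.
apply: (@le_trans _ _ (expR (- ((1 - q) / q)))); last first.
  rewrite expRN -[leRHS]invrK lef_pV2 ?posrE ?expR_gt0 ?invr_gt0//.
  apply: le_trans (expR_ge1Dx _); rewrite mulrBl divff ?gt_eqF//; lra.
rewrite ler_expR lerN2.
have y0 : 0 < t ^+ (2 * j.+1) by rewrite exprn_gt0.
apply: (@le_trans _ _ (A / t ^+ (2 * j.+1) / q)).
  by rewrite ler_pM2r ?invr_gt0.
rewrite [leRHS]mulrAC ler_wpM2l ?divr_ge0 ?(ltW y0) ?(ltW A0)//.
by rewrite lef_pV2.
Qed.

End gaussian.

(** * Sequences of independent Gaussian variables *)

Section density_measure.
Local Open Scope ereal_scope.
Context d (T : measurableType d) {R : realType} (mu : {measure set T -> \bar R}).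
Variables (g : T -> R).
Hypothesis g0 : forall x, (0 <= g x)%R.
Hypothesis mg : measurable_fun setT g.

(** The two proofs are arguments so that the measure structure can be inferred
    from the term. *)
Definition density_measure of (forall x, (0 <= g x)%R) & measurable_fun setT g
  := fun A => \int[mu]_(x in A) (g x)%:E.

Local Notation nu := (density_measure g0 mg).

Let nu0 : nu set0 = 0.
Proof. by rewrite /density_measure integral_set0. Qed.

Let nu_ge0 A : 0 <= nu A.
Proof. by apply: integral_ge0 => x _; rewrite lee_fin. Qed.

Let nu_sigma_additive : semi_sigma_additive nu.
Proof.
move=> A mA tA mUA; rewrite /density_measure ge0_integral_bigcup//=.
- apply: is_cvg_ereal_nneg_natsum_cond => n _ _.
  by apply: integral_ge0 => x _; rewrite lee_fin.
- by apply: measurable_funTS; exact/measurable_EFinP.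
- by move=> x _; rewrite lee_fin.
Qed.

HB.instance Definition _ := isMeasure.Build _ _ _ nu
  nu0 nu_ge0 nu_sigma_additive.

End density_measure.

Section independence.
Local Open Scope ereal_scope.
Context d (O : measurableType d) {R : realType} (P : probability O R).

(** By hypothesis [U] times [P] and [c] times [P] agree on the sets
    [t @^-1` B]; pushed forward by [t] they are the same measure on the
    line. *)
Lemma integral_mul_independent (U : O -> R) (t : {RV P >-> R}) (c : R)
    (f : R -> R) :
  (forall o, 0 <= U o)%R -> measurable_fun setT U -> (0 <= c)%R ->
  (forall B, measurable B ->
    \int[P]_(o in t @^-1` B) (U o)%:E = c%:E * P (t @^-1` B)) ->
  (forall x, 0 <= f x)%R -> measurable_fun setT f ->
  \int[P]_o (f (t o) * U o)%:E = c%:E * \int[P]_o (f (t o))%:E.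
Proof.
move=> U0 mU c0 tU f0 mf; have mt : measurable_fun setT t by [].
have mfE : measurable_fun setT (EFin \o f) by exact/measurable_EFinP.
have mft : measurable_fun setT (EFin \o (f \o t)).
  by apply/measurable_EFinP; exact: measurableT_comp.
transitivity (\int[pushforward (density_measure P U0 mU) t]_x (f x)%:E).
  rewrite ge0_integral_pushforward//; last by move=> x _; rewrite lee_fin.
  transitivity (\int[density_measure P U0 mU]_o (f (t o))%:E) => //.
  rewrite (@ge0_integral_density _ _ _ P (density_measure P U0 mU) U)//.
  by move=> o; rewrite lee_fin.
transitivity (\int[mscale (NngNum c0) (distribution P t)]_x (f x)%:E).
  by apply: eq_measure_integral => A mA _; exact: tU.
rewrite ge0_integral_mscale//=; last by move=> x _; rewrite lee_fin.
by rewrite ge0_integral_distribution// => x; rewrite lee_fin.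
Qed.

(** Independence speaks of events, so indicators are replaced by arbitrary
    functions one coordinate at a time: [j] counts the coordinates already
    replaced, and [integral_mul_independent] makes one replacement. *)
Lemma integral_prod_independent (t : nat -> {RV P >-> R}) (n : nat)
    (f : nat -> R -> R) :
  mutually_independent P (fun k => t k) ->
  (forall k x, 0 <= f k x)%R -> (forall k, measurable_fun setT (f k)) ->
  (forall k, \int[P]_o (f k (t k o))%:E < +oo) ->
  \int[P]_o (\prod_(k < n) f k (t k o))%:E =
  (\prod_(k < n) fine (\int[P]_o (f k (t k o))%:E))%:E.
Proof.
move=> indep f0 mf ffin.
suff H j : forall f : nat -> R -> R, (forall k x, 0 <= f k x)%R ->
    (forall k, measurable_fun setT (f k)) ->
    (forall k, \int[P]_o (f k (t k o))%:E < +oo) ->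
    (forall k, (j <= k < n)%N -> exists2 B, measurable B & f k = \1_B) ->
    \int[P]_o (\prod_(k < n) f k (t k o))%:E =
    (\prod_(k < n) fine (\int[P]_o (f k (t k o))%:E))%:E.
  by apply: (H n) => // k /andP[nk kn]; move: (leq_ltn_trans nk kn); rewrite ltnn.
elim: j => [|j IH] {f0 mf ffin}f f0 mf ffin find.
  have /choice[B HB] : forall k, exists B, (k < n)%N ->
      measurable B /\ f k = \1_B.
    move=> k; have [kn|kn] := ltnP k n; last by exists set0.
    by have [B mB fB] := find k kn; exists B.
  pose B' k := if (k < n)%N then B k else setT.
  have mB' k : measurable (B' k).
    by rewrite /B'; case: ifPn => // kn; have [] := HB k kn.
  have := indep (iota 0 n) B' (iota_uniq 0 n) mB'.
  have -> : \bigcap_(k in [set` iota 0 n]) (t k @^-1` B' k) =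
      [set o | forall k : 'I_n, B' k (t k o)].
    apply/seteqP; split => o /= h k; first by apply: h => /=; rewrite mem_iota/=.
    by rewrite /= mem_iota/= add0n => kn; exact: (h (Ordinal kn)).
  move=> PE; transitivity (P [set o | forall k : 'I_n, B' k (t k o)]).
    rewrite -[X in _ = P X]setIT -integral_indic//; last first.
      rewrite (_ : mkset _ = \bigcap_(k in [set` iota 0 n]) (t k @^-1` B' k)).
        apply: bigcap_measurableType => k _; rewrite -[X in measurable X]setTI.
        exact: measurable_funP.
      apply/seteqP; split => o /= h k; last by apply: h => /=; rewrite mem_iota/=.
      by rewrite /= mem_iota/= add0n => kn; exact: (h (Ordinal kn)).
    apply: eq_integral => o _; congr EFin.
    have [h|/existsNP[k hk]] := pselect (forall k : 'I_n, B' k (t k o)).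
      rewrite [RHS]indicE mem_set// big1// => k _.
      have [_ ->] := HB k (ltn_ord k).
      by rewrite indicE mem_set//; have := h k; rewrite /B' ltn_ord.
    rewrite [RHS]indicE memNset; last by move=> /(_ k).
    rewrite (bigD1 k)//=; have [_ ->] := HB k (ltn_ord k).
    by rewrite indicE memNset ?mul0r//; move: hk; rewrite /B' ltn_ord.
  rewrite PE -[X in iota 0 X]subn0 -/(index_iota 0 n) big_mkord.
  rewrite -prodEFin; apply: eq_bigr => k _.
  have [mB ->] := HB k (ltn_ord k).
  have -> : (fun o => (\1_(B k) (t k o))%:E) =
      (fun o => (\1_(t k @^-1` B k) o)%:E) :> (O -> \bar R) by [].
  have mtB : measurable (t k @^-1` B k).
    by rewrite -[X in measurable X]setTI; exact: measurable_funP.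
  rewrite integral_indic// setIT fineK ?fin_num_measure//.
  by rewrite /B' ltn_ord.
have [nj|jn] := leqP n j.
  apply: IH => // k /andP[jk kn].
  by move: (leq_ltn_trans jk kn); rewrite ltnNge nj.
pose m k := fine (\int[P]_o (f k (t k o))%:E).
have m0 k : (0 <= m k)%R.
  by rewrite fine_ge0// integral_ge0// => o _; rewrite lee_fin.
pose J := Ordinal jn.
pose U o := (\prod_(k < n | k != J) f k (t k o))%R.
pose c := (\prod_(k < n | k != J) m k)%R.
have mt k : measurable_fun setT (t k) by exact: measurable_funP.
have -> : (fun o => (\prod_(k < n) f k (t k o))%:E) =
    (fun o => (f j (t j o) * U o)%:E).
  by apply/funext => o; rewrite (bigD1 J).
rewrite (bigD1 J)//= -[X in (_ * X)%R%:E]/c.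
rewrite (@integral_mul_independent U (t j) c (f j))//.
- rewrite muleC EFinM fineK// ge0_fin_numE//.
  by apply: integral_ge0 => o _; rewrite lee_fin.
- by move=> o; apply: prodr_ge0.
- rewrite /U; under eq_fun do rewrite big_mkcond/=.
  apply: (@measurable_prod _ _ _ _ _ (index_enum _)
    (fun (k : 'I_n) o => if k != J then f k (t k o) else 1%R)) => k _.
  by have [_|_] := boolP (k != J); [exact: measurableT_comp|exact: measurable_cst].
- by apply: prodr_ge0.
move=> B mB.
pose g k := if k == j then \1_B else f k.
have gJ : g J = \1_B by rewrite /g eqxx.
have gk (k : 'I_n) : k != J -> g k = f k.
  by rewrite /g -val_eqE => /negbTE/= ->.
have mtB : measurable (t j @^-1` B).
  by rewrite -[X in measurable X]setTI; exact: mt.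
have intB : \int[P]_o (\1_B (t j o))%:E = P (t j @^-1` B).
  have -> : (fun o => (\1_B (t j o))%:E) =
      (fun o => (\1_(t j @^-1` B) o)%:E) :> (O -> \bar R) by [].
  by rewrite integral_indic// setIT.
have := IH g; rewrite (bigD1 J)//= gJ intB.
under eq_integral do rewrite (bigD1 J)//= gJ.
have -> : (\prod_(k < n | k != J) fine (\int[P]_o (g k (t k o))%:E) = c)%R.
  by apply: eq_bigr => k kJ; rewrite gk.
move=> H; transitivity (\int[P]_o (\1_B (t j o) * \prod_(k < n | k != J) g k (t k o))%:E).
  rewrite integral_mkcond; apply: eq_integral => o _.
  rewrite (_ : (\prod_(k < n | k != J) g k (t k o) = U o)%R); last first.
    by apply: eq_bigr => k kJ; rewrite gk.
  rewrite patchE indicE/=; case: ifPn => [/set_mem/= h|/negP h].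
    by rewrite mem_set// mul1r.
  by rewrite memNset ?mul0r// => h'; apply: h; exact: mem_set.
rewrite H.
- by rewrite EFinM fineK ?fin_num_measure// muleC.
- by move=> k x; rewrite /g; case: ifP.
- by move=> k; rewrite /g; case: ifP.
- move=> k; rewrite /g; case: ifP => [/eqP ->|_ //].
  by rewrite intB (le_lt_trans (probability_le1 _ _))// ltry.
- move=> k /andP[jk kn]; rewrite /g; case: ifPn => [_|kj]; first by exists B.
  by apply: find; rewrite kn andbT ltn_neqAle eq_sym kj.
Qed.

End independence.

Lemma integral_gauss_law d (O : measurableType d) {R : realType}
    (P : probability O R) (X : {RV P >-> R}) (f : R -> R) :
  (forall B : set R, measurable B -> distribution P X B = normal_prob 0 1 B) ->
  measurable_fun setT f -> (forall x, 0 <= f x) ->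
  (\int[P]_o (f (X o))%:E = \int[normal_prob 0 1]_x (f x)%:E)%E.
Proof.
move=> H mf f0.
have mX : measurable_fun setT (X : O -> measurableTypeR R).
  by move=> mO B mB; exact: (@measurable_funP _ _ _ _ setT X).
have mfE : measurable_fun setT ((EFin \o f) : measurableTypeR R -> \bar R).
  exact/measurable_EFinP.
have := @ge0_integral_pushforward _ _ O (measurableTypeR R) R X mX P setT
  (EFin \o f) measurableT mfE.
rewrite preimage_setT => <-; last by move=> x _; rewrite lee_fin.
apply: eq_measure_integral => A mA _.
exact: H.
Qed.

Section gaussian_sequences.
Context d (O : measurableType d) {R : realType} (P : probability O R).
Variable t : nat -> {RV P >-> R}.
Hypothesis t_indep : mutually_independent P (fun k => t k).
Hypothesis t_gauss : forall k (B : set R), measurable B ->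
  distribution P (t k) B = normal_prob 0 1 B.

Let mt k : measurable_fun setT (t k).
Proof. by []. Qed.

Let mtB k (B : set R) : measurable B -> measurable (t k @^-1` B).
Proof. by move=> mB; rewrite -[X in measurable X]setTI; exact: mt. Qed.

(** Chernoff's bound with parameter [4^-1], the product of the exponential
    moments being controlled by [gauss_mgf_sq]. *)
Lemma gauss_weighted_tail_fin (w : nat -> R) (W y : R) (n : nat) :
  (forall k, 0 <= w k <= 1) -> \sum_(0 <= k < n) w k <= W ->
  (P [set o | (y < \sum_(0 <= k < n) w k * t k o ^+ 2)%R]
    <= (expR (gauss_exp_sq * W - y / 4))%:E)%E.
Proof.
move=> w01 wW.
pose f k (x : R) := expR (w k * x ^+ 2 / 4).
have mf k : measurable_fun setT (f k).
  apply: measurableT_comp => //; apply: measurable_funM => //.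
  by apply: measurable_funM => //; exact: exprn_measurable.
have fE k : (\int[P]_o (f k (t k o))%:E <= (expR (gauss_exp_sq * w k))%:E)%E.
  apply: le_trans (gauss_mgf_sq (w01 k)).
  rewrite (@integral_gauss_law _ _ _ P (t k) (f k))//; first exact: t_gauss.
  by move=> x; exact: expR_ge0.
have f0 k x : 0 <= f k x by exact: expR_ge0.
have ffin k : (\int[P]_o (f k (t k o))%:E < +oo)%E.
  by rewrite (le_lt_trans (fE k))// ltry.
pose Y o := \sum_(0 <= k < n) w k * t k o ^+ 2.
have mY : measurable_fun setT Y.
  apply: measurable_sum => k; apply: measurable_funM => //.
  exact: measurable_funX.
have mA : measurable [set o | y < Y o].
  rewrite (_ : mkset _ = Y @^-1` `]y, +oo[%classic).
    by rewrite -[X in measurable X]setTI; exact: mY.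
  by apply/seteqP; split => o /=; rewrite in_itv/= andbT.
have expY o : expR (Y o / 4) = \prod_(k < n) f k (t k o).
  rewrite /Y mulr_suml big_mkord expR_sum; apply: eq_bigr => k _.
  by rewrite /f.
have EY : (\int[P]_o (expR (Y o / 4))%:E <= (expR (gauss_exp_sq * W))%:E)%E.
  under eq_integral do rewrite expY.
  rewrite integral_prod_independent// lee_fin.
  apply: (@le_trans _ _ (\prod_(k < n) expR (gauss_exp_sq * w k))).
    apply: ler_prod => k _; rewrite fine_ge0/=; last first.
      by apply: integral_ge0 => o _; rewrite lee_fin.
    rewrite -lee_fin fineK// ge0_fin_numE//.
    by apply: integral_ge0 => o _; rewrite lee_fin.
  rewrite -expR_sum ler_expR -mulr_sumr.
  rewrite ler_wpM2l ?(ltW (gauss_exp_sq_gt0))//.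
  by rewrite -(big_mkord xpredT w).
have e0 : 0 < expR (y / 4) by exact: expR_gt0.
rewrite expRB EFinM.
have : ((expR (y / 4))%:E * P [set o | (y < Y o)%R]
    <= (expR (gauss_exp_sq * W))%:E)%E.
  apply: le_trans EY; rewrite -integral_cst//.
  apply: (@le_trans _ _ (\int[P]_(o in [set o | (y < Y o)%R]) (expR (Y o / 4))%:E)%E).
    apply: ge0_le_integral => //.
    - by move=> o _; rewrite lee_fin ltW.
    - apply: measurable_funTS; apply/measurable_EFinP; apply: measurableT_comp => //.
      exact: measurable_funM.
    - move=> o /= yo; rewrite lee_fin ler_expR ler_pM2r ?invr_gt0//; exact: ltW.
  apply: ge0_subset_integral => //.
    apply/measurable_EFinP; apply: measurableT_comp => //.
    exact: measurable_funM.
by rewrite muleC -lee_pdivlMr.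
Qed.

(** The event is the increasing union of the events for the partial sums. *)
Lemma gauss_weighted_tail (w : nat -> R) (W y : R) :
  (forall k, 0 <= w k <= 1) -> (forall n, \sum_(0 <= k < n) w k <= W) ->
  (P [set o | (y%:E < wsum w (fun k => t k o))%E]
    <= (expR (gauss_exp_sq * W - y / 4))%:E)%E.
Proof.
move=> w01 wW.
pose Y n o := \sum_(0 <= k < n) w k * t k o ^+ 2.
have wt0 k o : 0 <= w k * t k o ^+ 2.
  by rewrite mulr_ge0 ?sqr_ge0//; have /andP[] := w01 k.
have ndY o : {homo Y^~ o : a b / (a <= b)%N >-> a <= b}.
  move=> a b ab; rewrite /Y (big_cat_nat _ ab)//= lerDl.
  exact: sumr_ge0.
have mA n : measurable [set o | y < Y n o].
  have mY : measurable_fun setT (Y n).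
    apply: measurable_sum => k; apply: measurable_funM => //.
    exact: measurable_funX.
  rewrite (_ : mkset _ = Y n @^-1` `]y, +oo[%classic).
    by rewrite -[X in measurable X]setTI; exact: mY.
  by apply/seteqP; split => o /=; rewrite in_itv/= andbT.
have -> : [set o | (y%:E < wsum w (fun k => t k o))%E] =
    \bigcup_n [set o | y < Y n o].
  apply/seteqP; split => o /=; last first.
    move=> [n _ /= yn]; apply: (@lt_le_trans _ _ (Y n o)%:E); first by rewrite lte_fin.
    by apply: psum_le_wsum => k; have /andP[] := w01 k.
  move=> yo; apply: contrapT => h; move: yo; apply/negP; rewrite -leNgt.
  apply: (wsum_le (w := w)) => [k|n]; first by have /andP[] := w01 k.
  by rewrite leNgt; apply/negP => yn; apply: h; exists n.
have := nondecreasing_cvg_mu (mu := P) mA.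
move=> /(_ (bigcup_measurable (fun n _ => mA n))).
have nd : nondecreasing_seq (fun n => [set o | y < Y n o]).
  by move=> a b ab; apply/subsetPset => o /= h; exact: lt_le_trans (ndY o _ _ ab).
move=> /(_ nd) cvgP; rewrite -(cvg_lim _ cvgP)//.
apply: lime_le; first by apply/cvg_ex; eexists; exact: cvgP.
by apply: nearW => n; exact: gauss_weighted_tail_fin.
Qed.

Lemma gauss_rectangle (B : nat -> set R) (c : nat -> R) (C : R) :
  (forall k, measurable (B k)) ->
  (forall k, ((expR (- c k))%:E <= normal_prob 0 1 (B k))%E) ->
  (forall n, \sum_(0 <= k < n) c k <= C) ->
  ((expR (- C))%:E <= P (\bigcap_k (t k @^-1` B k)))%E.
Proof.
move=> mB cB cC.
pose A n := \bigcap_(k in [set` iota 0 n]) (t k @^-1` B k).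
have mA n : measurable (A n).
  by apply: bigcap_measurableType => k _; exact: mtB.
have -> : \bigcap_k (t k @^-1` B k) = \bigcap_n A n.
  apply/seteqP; split => o h k _; first by move=> j _; exact: h.
  by apply: (h k.+1) => //; change (is_true (k \in iota 0 k.+1)); rewrite mem_iota add0n ltnSn.
have ni : nonincreasing_seq A.
  move=> a b ab; apply/subsetPset => o h k /=; rewrite mem_iota/= add0n => ka.
  by apply: h; rewrite /= mem_iota/= add0n (leq_trans ka).
have := nonincreasing_cvg_mu (mu := P) _ mA (bigcap_measurableType (fun n _ => mA n)) ni.
have PA0 : (P (A 0%N) < +oo)%E by rewrite (le_lt_trans (probability_le1 _ _))// ltry.
move=> /(_ PA0) cvgP; rewrite -(cvg_lim _ cvgP)//.
apply: lime_ge; first by apply/cvg_ex; eexists; exact: cvgP.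
apply: nearW => n /=; rewrite /A t_indep ?iota_uniq//.
apply: (@le_trans _ _ (expR (- \sum_(0 <= k < n) c k))%:E).
  by rewrite lee_fin ler_expR lerN2.
rewrite -sumrN expR_sum /index_iota subn0 -prodEFin.
elim: (iota 0 n) => [|k s IH]; first by rewrite !big_nil.
rewrite !big_cons; apply: lee_pmul => //.
- by rewrite prodEFin lee_fin prodr_ge0// => j _; exact: expR_ge0.
- by move: (cB k); rewrite -(t_gauss k (mB k)).
Qed.

End gaussian_sequences.

(** * Coordinates and the Gaussian series prior *)

Section scale_functionals.
Context {R : realType} (S : hilbert_scale R) (p : R).

Lemma lipschitz_continuous_Hs (f : Hs S p -> R) (C : R) : 0 <= C ->
  (forall g h, `|f g - f h| <= C * `|g - h|) -> continuous f.
Proof.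
move=> C0 lip h; apply/(@cvgrPdist_le _ _ _ (nbhs h)) => e e0; near=> g.
rewrite (le_trans (lip h g))//.
rewrite (le_trans (y := (C + 1) * `|h - g|))//.
  by rewrite ler_wpM2r ?normr_ge0// lerDl.
rewrite mulrC -ler_pdivlMr ?ltr_wpDl//.
near: g; apply/(@nbhs_normP R (Hs S p) h); exists (e / (C + 1)) => /=.
  by rewrite divr_gt0// ltr_wpDl.
by move=> g /ltW.
Unshelve. all: by end_near. Qed.

Lemma continuous_measurable_Hs (f : Hs S p -> R) : continuous f ->
  measurable_fun setT f.
Proof.
move=> cf; apply: (measurability _ (RGenOpens.measurableE R)) => _ [_ [a [b ->]] <-].
rewrite setTI; apply: sub_sigma_algebra.
by move/continuousP : cf; apply; exact: interval_open.
Qed.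

Lemma coef_sub (g h : S) (k : nat) : coef (g - h) k = coef g k - coef h k.
Proof. by rewrite -scaleN1r Defs.coefD Defs.coefZ mulN1r. Qed.

Lemma coef_le_norm (h : Hs S p) (k : nat) :
  `|coef (h : S) k| <= Num.sqrt (weight S (- p) k) * `|h|.
Proof.
have w0 := weight_gt0 S p k.
have -> : weight S (- p) k = (weight S p k)^-1.
  by rewrite -[LHS]mul1r -(mulVf (lt0r_neq0 w0)) -mulrA (mulrC (weight S p k)) weightNM mulr1.
rewrite sqrtrV ?(ltW w0)// [leRHS]mulrC ler_pdivlMr ?sqrtr_gt0// Hs_normrE -sqrtr_sqr.
rewrite -sqrtrM ?sqr_ge0// ler_wsqrtr// mulrC.
apply: le_trans (psum_le_fine (weight_ge0 S p) k.+1 (Hs_fin h)).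
rewrite big_nat_recr//= lerDr sumr_ge0// => j _.
by rewrite mulr_ge0 ?sqr_ge0 ?weight_ge0.
Qed.

Lemma continuous_coef (k : nat) :
  continuous (fun h : Hs S p => coef (h : S) k).
Proof.
apply: (@lipschitz_continuous_Hs _ (Num.sqrt (weight S (- p) k))).
  exact: sqrtr_ge0.
by move=> g h; rewrite -coef_sub; exact: (coef_le_norm (g - h)).
Qed.

Lemma measurable_coef (k : nat) :
  measurable_fun setT (fun h : Hs S p => coef (h : S) k).
Proof. by apply: continuous_measurable_Hs; exact: continuous_coef. Qed.

Lemma measurable_wsum d (T : measurableType d) (w : nat -> R)
    (a : nat -> T -> R) : (forall k, 0 <= w k) ->
  (forall k, measurable_fun setT (a k)) ->
  measurable_fun setT (fun x => wsum w (fun k => a k x)).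
Proof.
move=> w0 ma; apply: ge0_emeasurable_sum => k.
  by move=> x _ _; rewrite lee_fin mulr_ge0 ?sqr_ge0.
move=> _; apply/measurable_EFinP; apply: measurable_funM => //.
exact: measurable_funX.
Qed.

Lemma measurable_wsum_coef (w : nat -> R) (h0 : Hs S p) :
  (forall k, 0 <= w k) ->
  measurable_fun setT (fun h : Hs S p => wsum w (coef ((h - h0 : Hs S p) : S))).
Proof.
move=> w0; rewrite (_ : (fun h => _) =
    (fun h : Hs S p => wsum w (fun k => coef (h : S) k - coef (h0 : S) k))).
  apply: measurable_wsum => // k.
  by apply: measurable_funB => //; exact: measurable_coef.
by apply/funext => h; congr wsum; apply/funext => k; exact: coef_sub.
Qed.

End scale_functionals.

Section prior.
Context {R : realType} (S : hilbert_scale R) (p alpha : R).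
Variable Pi : probability (Hs S p) R.
Hypothesis Pi_prior : gaussian_series_prior alpha Pi.
Local Notation lam := (hs_lam S).
Local Notation dim := ((hs_dim S)%:R : R).

Definition prior_sd (k : nat) : R := lam k `^ (- alpha - dim / 2).

Lemma prior_sd_gt0 k : 0 < prior_sd k.
Proof. by rewrite powR_gt0// hs_lam_gt0. Qed.

Lemma coef_series_limit (c : nat -> R) (h : Hs S p) :
  series (fun k => c k *: Hs_basis S p k) @ \oo --> h ->
  forall k, coef (h : S) k = c k.
Proof.
move=> ch k.
have c1 : (fun n => coef ((series (fun k => c k *: Hs_basis S p k) n : Hs S p) : S) k)
    @ \oo --> (coef (h : S) k : R).
  exact: (cvg_comp _ _ ch (@continuous_coef R S p k h)).
rewrite -(cvg_lim _ c1)//; apply: cvg_lim => //.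
apply: cvg_near_cst; exists k.+1 => // n /= kn.
by rewrite /series/= hval_sum kn.
Qed.

(** Transfers an event on the Gaussian coordinates to the prior. The random
    series has the prescribed coordinates only off a null set, which costs
    nothing. *)
Lemma prior_ge_of_sequence (A : set (Hs S p)) (c : \bar R) : measurable A ->
  (forall d (O : measurableType d) (P : probability O R)
     (t : nat -> {RV P >-> R}) (theta : O -> Hs S p),
   mutually_independent P (fun k => t k) ->
   (forall k (B : set R), measurable B ->
     distribution P (t k) B = normal_prob 0 1 B) ->
   exists2 E : set O, measurable E & (c <= P E)%E /\
    forall o, (forall k, coef (theta o : S) k = prior_sd k * t k o) ->
      E o -> A (theta o)) ->
  (c <= Pi A)%E.
Proof.
move=> mA hA; have [d [Om [P [t [theta [t_ind t_law aes PiE]]]]]] := Pi_prior.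
have [E mE [cE EA]] := hA d Om P t theta t_ind t_law.
rewrite PiE//; apply: (le_trans cE).
have mtA : measurable (theta @^-1` A).
  by rewrite -[X in measurable X]setTI; exact: measurable_funP.
have [N [mN PN hN]] := aes.
rewrite -[leRHS]/(P (theta @^-1` A)).
have EU : E `<=` theta @^-1` A `|` N.
  move=> o Eo; have [No|nNo] := pselect (N o); [by right|left].
  apply: EA Eo; apply: coef_series_limit.
  by apply: contrapT => h; apply: nNo; exact: hN.
apply: (@le_trans _ _ (P (theta @^-1` A `|` N))).
  by apply: le_measure; rewrite ?inE//; exact: measurableU.
apply: le_trans (measureU2 P mtA mN) _.
rewrite -[leRHS]adde0; apply: leeD => //.
by rewrite le_eqVlt; apply/orP; left; apply/eqP; exact: PN.
Qed.

(** Dividing by [b] brings the weights [v k * prior_sd k ^+ 2] into the unit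
    interval, as Chernoff's bound requires; the bound is transferred through
    the complement. *)
Lemma prior_tail (v : nat -> R) (b W y : R) : 0 < b ->
  (forall k, 0 <= v k) -> (forall k, v k * prior_sd k ^+ 2 <= b) ->
  (forall n, \sum_(0 <= k < n) v k * prior_sd k ^+ 2 <= b * W) ->
  (Pi [set h : Hs S p | ((b * y)%:E < wsum v (coef (h : S)))%E]
    <= (expR (gauss_exp_sq * W - y / 4))%:E)%E.
Proof.
move=> b0 v0 vb vW.
set A := [set h | _].
have mA : measurable A.
  have -> : A = (fun h : Hs S p => wsum v (coef (h : S))) @^-1` `](b * y)%:E, +oo[%classic.
    apply/seteqP; split => h /=; rewrite in_itv/= ?andbT//.
  rewrite -[X in measurable X]setTI.
  have : measurable_fun setT (fun h : Hs S p => wsum v (coef (h : S))).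
    by apply: measurable_wsum => // k; exact: measurable_coef.
  by apply => //; exact: emeasurable_itv.
set e := expR _.
suff : ((1 - e%:E) <= Pi (~` A))%E.
  rewrite probability_setC//.
  have : Pi A \is a fin_num by rewrite fin_num_measure.
  by case: (Pi A) => // q _; rewrite -!EFinB !lee_fin; lra.
apply: prior_ge_of_sequence; first exact: measurableC.
move=> d O P t theta ti tg.
pose w k := v k * prior_sd k ^+ 2 / b.
have w01 k : 0 <= w k <= 1.
  by rewrite /w ler_pdivrMr// mul1r vb andbT divr_ge0 ?(ltW b0)// mulr_ge0// sqr_ge0.
have wW n : \sum_(0 <= k < n) w k <= W.
  by rewrite -mulr_suml ler_pdivrMr// mulrC.
have mE : measurable [set o | (y%:E < wsum w (fun k => t k o))%E].
  rewrite (_ : mkset _ = (fun o => wsum w (fun k => t k o)) @^-1` `]y%:E, +oo[%classic).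
    rewrite -[X in measurable X]setTI.
    have : measurable_fun setT (fun o => wsum w (fun k => t k o)).
      by apply: measurable_wsum => // k; have /andP[] := w01 k.
    by apply => //; exact: emeasurable_itv.
  by apply/seteqP; split => o /=; rewrite in_itv/= ?andbT.
exists (~` [set o | (y%:E < wsum w (fun k => t k o))%E]); first exact: measurableC.
split.
  rewrite probability_setC//; apply: leeB => //.
  exact: gauss_weighted_tail.
move=> o ho /= h h'; apply: h; move: h'; rewrite /A/=.
have -> : wsum v (coef (theta o : S)) = (b%:E * wsum w (fun k => t k o))%E.
  rewrite /wsum -nneseriesZl; last first.
    by move=> k _; rewrite lee_fin mulr_ge0 ?sqr_ge0//; have /andP[] := w01 k.
  apply: eq_eseriesr => k _; rewrite ho -EFinM; congr EFin.
  by rewrite /w; field; rewrite gt_eqF.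
by rewrite EFinM lte_pmul2l// lte_fin.
Qed.

Lemma prior_rectangle (B : nat -> set R) (c : nat -> R) (C : R) :
  (forall k, measurable (B k)) ->
  (forall k, ((expR (- c k))%:E <= normal_prob 0 1 (B k))%E) ->
  (forall n, \sum_(0 <= k < n) c k <= C) ->
  ((expR (- C))%:E
    <= Pi [set h : Hs S p | forall k, B k (coef (h : S) k / prior_sd k)%R])%E.
Proof.
move=> mB cB cC; apply: prior_ge_of_sequence.
  rewrite (_ : mkset _ = \bigcap_k ((fun h : Hs S p =>
      coef (h : S) k / prior_sd k) @^-1` B k)); last first.
    by apply/seteqP; split => h /= H k; [move=> _|]; exact: H.
  apply: bigcap_measurableType => k _; rewrite -[X in measurable X]setTI.
  have : measurable_fun setT (fun h : Hs S p => coef (h : S) k / prior_sd k).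
    by apply: measurable_funM => //; exact: measurable_coef.
  by apply.
move=> d O P t theta ti tg.
exists (\bigcap_k (t k @^-1` B k)).
  apply: bigcap_measurableType => k _; rewrite -[X in measurable X]setTI.
  exact: measurable_funP.
split; first exact: gauss_rectangle cB cC.
move=> o ho h k; rewrite ho mulrC mulKf ?gt_eqF ?prior_sd_gt0//.
exact: h.
Qed.

End prior.

(** * Sums of independent observations *)

Lemma integral_probability_cst d (T : measurableType d) (R : realType)
    (P : probability T R) (c : R) : (\int[P]_x c%:E = c%:E)%E.
Proof. by rewrite integral_cst//= -[RHS]mule1; congr (_ * _)%E; exact: probability_setT. Qed.

Section iid_moments.
Local Open Scope ereal_scope.
Context {R : realType} d (X : measurableType d) (P : probability X R).

(** The product law is defined by adding one coordinate in front, which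
    Tonelli's theorem integrates separately. *)
Lemma ge0_integral_iidS n (f : n.+1.-tuple X -> \bar R) :
  measurable_fun setT f -> (forall x, 0 <= f x) ->
  \int[iid_law P n.+1]_x f x =
  \int[P]_a \int[iid_law P n]_x f (tuple_cons (a, x)).
Proof.
move=> mf f0.
transitivity (\int[(P \x iid_law P n)%E]_z f (tuple_cons z)).
  exact: (@ge0_integral_distribution _ _ _ _ _ (P \x iid_law P n)%E (@tuple_cons d X n)).
rewrite fubini_tonelli1//; last exact: measurableT_comp.
Qed.

Lemma integral_iidS n (f : n.+1.-tuple X -> \bar R) :
  (iid_law P n.+1).-integrable setT f ->
  \int[iid_law P n.+1]_x f x =
  \int[P]_a \int[iid_law P n]_x f (tuple_cons (a, x)).
Proof.
move=> fi.
have mf := measurable_int _ fi.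
have fi' : (P \x iid_law P n)%E.-integrable setT (f \o @tuple_cons d X n).
  apply/integrableP; split; first exact: measurableT_comp.
  move/integrableP : fi => [_]; congr (_ < _).
  apply: (@ge0_integral_distribution _ _ _ _ _ (P \x iid_law P n)%E
    (@tuple_cons d X n) (fun x => `|f x|)) => //.
  exact: measurableT_comp.
transitivity (\int[(P \x iid_law P n)%E]_z f (tuple_cons z)).
  exact: (@integral_distribution _ _ _ _ _ (P \x iid_law P n)%E (@tuple_cons d X n)).
by rewrite -integral12_prod_meas1.
Qed.

Lemma measurable_tuple_sum n (Y : X -> R) : measurable_fun setT Y ->
  measurable_fun setT (fun x : n.-tuple X => (\sum_(i < n) Y (tnth x i))%R).
Proof.
move=> mY; apply: measurable_sum => i; apply: measurableT_comp => //.
exact: measurable_tnth.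
Qed.

Lemma measurable_tuple_prod n (g : X -> R) : measurable_fun setT g ->
  measurable_fun setT (fun x : n.-tuple X => (\prod_(i < n) g (tnth x i))%R).
Proof.
move=> mg.
apply: (@measurable_prod _ _ _ _ _ (index_enum _)
  (fun (i : 'I_n) (x : n.-tuple X) => g (tnth x i))) => i _.
by apply: measurableT_comp => //; exact: measurable_tnth.
Qed.

Lemma tuple_cons_sum n (Y : X -> R) (a : X) (x : n.-tuple X) :
  (\sum_(i < n.+1) Y (tnth (tuple_cons (a, x)) i) =
   Y a + \sum_(i < n) Y (tnth x i))%R.
Proof.
by rewrite big_ord_recl/= tnth0; congr (_ + _)%R; apply: eq_bigr => i _; rewrite tnthS.
Qed.

Lemma tuple_cons_prod n (g : X -> R) (a : X) (x : n.-tuple X) :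
  (\prod_(i < n.+1) g (tnth (tuple_cons (a, x)) i) =
   g a * \prod_(i < n) g (tnth x i))%R.
Proof.
by rewrite big_ord_recl/= tnth0; congr (_ * _)%R; apply: eq_bigr => i _; rewrite tnthS.
Qed.

Lemma iid_integral_prod n (g : X -> R) : (forall a, 0 <= g a)%R ->
  measurable_fun setT g -> \int[P]_a (g a)%:E = 1 ->
  \int[iid_law P n]_x (\prod_(i < n) g (tnth x i))%:E = 1.
Proof.
move=> g0 mg g1; elim: n => [|n IH].
  under eq_integral do rewrite big_ord0.
  exact: integral_probability_cst.
rewrite ge0_integral_iidS; last 2 first.
- by apply/measurable_EFinP; exact: measurable_tuple_prod.
- by move=> x; rewrite lee_fin prodr_ge0.
under eq_integral => a _.
  under eq_integral do rewrite tuple_cons_prod EFinM.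
  rewrite ge0_integralZl//; last 3 first.
  - by apply/measurable_EFinP; exact: measurable_tuple_prod.
  - by move=> x _; rewrite lee_fin prodr_ge0.
  - by rewrite lee_fin.
  rewrite IH mule1; over.
exact: g1.
Qed.

(** Induction on the number of coordinates: the cross term of the square
    integrates to zero because the sum of the other coordinates is centred. *)
Lemma iid_sum_moments (Y : X -> R) (v : R) : measurable_fun setT Y ->
  P.-integrable setT (EFin \o Y) -> \int[P]_a (Y a)%:E = 0 ->
  \int[P]_a (Y a ^+ 2)%:E = v%:E -> forall n,
  [/\ (iid_law P n).-integrable setT
        (fun x => (\sum_(i < n) Y (tnth x i))%:E),
      \int[iid_law P n]_x (\sum_(i < n) Y (tnth x i))%:E = 0 &
      \int[iid_law P n]_x ((\sum_(i < n) Y (tnth x i)) ^+ 2)%:E =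
        (n%:R * v)%:E].
Proof.
move=> mY iY Y0 Yv; elim => [|n [iS S0 Sv]].
  split.
  - under eq_fun do rewrite big_ord0.
    exact: finite_measure_integrable_cst.
  - by under eq_integral do rewrite big_ord0; rewrite integral_probability_cst.
  - under eq_integral do rewrite big_ord0 expr0n.
    by rewrite integral_probability_cst mul0r.
have mSn := @measurable_tuple_sum n Y mY.
have mS := @measurable_tuple_sum n.+1 Y mY.
have iS2 : (iid_law P n).-integrable setT
    (fun x => ((\sum_(i < n) Y (tnth x i)) ^+ 2)%:E).
  apply/integrableP; split.
    by apply/measurable_EFinP; exact: measurable_funX.
  under eq_integral do rewrite gee0_abs ?lee_fin ?sqr_ge0//.
  by rewrite Sv ltry.
have inner a : \int[iid_law P n]_x ((\sum_(i < n.+1)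
    Y (tnth (tuple_cons (a, x)) i)) ^+ 2)%:E = (Y a ^+ 2 + n%:R * v)%:E.
  have iL : (iid_law P n).-integrable setT
      (fun x => (2 * Y a)%:E * (\sum_(i < n) Y (tnth x i))%:E).
    exact: integrableZl.
  have iC : (iid_law P n).-integrable setT (fun x => (Y a ^+ 2)%:E).
    exact: finite_measure_integrable_cst.
  transitivity (\int[iid_law P n]_x ((Y a ^+ 2)%:E +
      (2 * Y a)%:E * (\sum_(i < n) Y (tnth x i))%:E +
      ((\sum_(i < n) Y (tnth x i)) ^+ 2)%:E)).
    apply: eq_integral => x _; rewrite tuple_cons_sum -EFinM -!EFinD.
    by congr EFin; ring.
  rewrite (integralD measurableT (integrableD measurableT iC iL) iS2)//.
  rewrite (integralD measurableT iC iL) integralZl// S0 mule0 adde0 Sv.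
  by rewrite integral_probability_cst -EFinD.
have second : \int[iid_law P n.+1]_x ((\sum_(i < n.+1) Y (tnth x i)) ^+ 2)%:E =
    (n.+1%:R * v)%:E.
  rewrite ge0_integral_iidS; last 2 first.
  - by apply/measurable_EFinP; exact: measurable_funX.
  - by move=> x; rewrite lee_fin sqr_ge0.
  under eq_integral do rewrite inner EFinD.
  have v0 : (0 <= n%:R * v)%R.
    rewrite mulr_ge0// -lee_fin -Yv; apply: integral_ge0 => x _.
    by rewrite lee_fin sqr_ge0.
  rewrite ge0_integralD//; last 2 first.
  - by move=> x _; rewrite lee_fin sqr_ge0.
  - by apply/measurable_EFinP; exact: measurable_funX.
  rewrite Yv integral_probability_cst -EFinD.
  by rewrite -nat1r mulrDl mul1r.
have iS' : (iid_law P n.+1).-integrable setT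
    (fun x => (\sum_(i < n.+1) Y (tnth x i))%:E).
  apply/integrableP; split; first exact/measurable_EFinP.
  apply: (@le_lt_trans _ _ (\int[iid_law P n.+1]_x
      (1 + (\sum_(i < n.+1) Y (tnth x i)) ^+ 2)%:E)).
    apply: ge0_le_integral_nonmeasurable => x //=; rewrite lee_fin.
    set s := (\sum_(i < _) _)%R; rewrite -(real_normK (num_real s)).
    by have := normr_ge0 s; nra.
  under eq_integral do rewrite EFinD.
  rewrite ge0_integralD//; last 2 first.
  - by move=> x _; rewrite lee_fin sqr_ge0.
  - by apply/measurable_EFinP; exact: measurable_funX.
  by rewrite second integral_probability_cst -EFinD ltry.
split=> //.
rewrite integral_iidS//.
under eq_integral => a _.
  under eq_integral do rewrite tuple_cons_sum EFinD.
  rewrite integralD//; last exact: finite_measure_integrable_cst.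
  rewrite S0 adde0 integral_probability_cst; over.
exact: Y0.
Qed.

End iid_moments.

(** * Mean, divergence and noise in the exponential family *)

Section dual_pairing.
Context {R : realType} (S : hilbert_scale R) (p : R).

(** Cauchy-Schwarz between a weighted square norm and its dual norm, for
    partial sums of the expansion of [h], to which [f] passes by
    continuity. *)
Lemma dual_le_wsum (f : Hdual S p) (h : Hs S p) (w : nat -> R) (A B : R) :
  (forall k, 0 < w k) -> 0 <= A -> 0 <= B ->
  (wsum (fun k => (w k)^-1)%R (dual_coef f) <= (A ^+ 2)%:E)%E ->
  (wsum w (coef (h : S)) <= (B ^+ 2)%:E)%E ->
  `|f h| <= A * B.
Proof.
move=> w0 A0 B0 fA hB.
have w0' k : 0 <= w k by exact: ltW.
have wV0 k : 0 <= (w k)^-1 by rewrite invr_ge0.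
have fc : (fun n => f (\sum_(0 <= k < n) coef (h : S) k *: Hs_basis S p k))
    @ \oo --> (f h : R).
  exact: (cvg_comp _ _ (Hs_expansion (h := h)) (@dual_continuous _ _ _ f h)).
apply: (ler_cvg_to (cvg_norm fc) (cvg_cst _)); apply: nearW => n /=.
rewrite dual_eval_sum.
have := cauchy_schwarz_sum n (fun k => Num.sqrt (w k) * coef (h : S) k)
  (fun k => Num.sqrt (w k)^-1 * dual_coef f k).
have E (u c : nat -> R) : (forall k, 0 <= u k) ->
    \sum_(0 <= k < n) (Num.sqrt (u k) * c k) ^+ 2 =
    \sum_(0 <= k < n) u k * c k ^+ 2.
  by move=> u0; apply: eq_bigr => k _; rewrite exprMn sqr_sqrtr.
rewrite (E _ _ w0') (E _ _ wV0).
have ww k : Num.sqrt (w k) * Num.sqrt (w k)^-1 = 1.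
  by rewrite -sqrtrM// mulfV ?sqrtr1// gt_eqF.
under eq_bigr do rewrite mulrACA ww mul1r.
move=> CS; rewrite -(@ler_pXn2r _ 2)// ?nnegrE ?mulr_ge0//.
rewrite real_normK ?num_real// (le_trans CS)// exprMn mulrC; apply: ler_pM.
- by apply: sumr_ge0 => k _; rewrite mulr_ge0 ?sqr_ge0.
- by apply: sumr_ge0 => k _; rewrite mulr_ge0 ?sqr_ge0.
- by rewrite -lee_fin (le_trans _ fA)// psum_le_wsum.
- by rewrite -lee_fin (le_trans _ hB)// psum_le_wsum.
Qed.

Lemma measurable_dual_norm :
  measurable_fun setT (fun f : Hdual S p => `|f| : R).
Proof.
have cn : continuous (fun f : Hdual S p => `|f| : R) by exact: norm_continuous.
apply: (measurability _ (RGenOpens.measurableE R)) => _ [_ [a [b ->]] <-].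
rewrite setTI; apply: sub_sigma_algebra.
by move/continuousP : cn; apply; exact: interval_open.
Qed.

End dual_pairing.

Section exponential_family.
Context {R : realType} (S : hilbert_scale R) (p : R) d (X : measurableType d)
  (F : exp_family S p X).
Local Notation Theta := (Hs S p).
Local Notation mu := (ef_mu F).
Local Notation beta := (ef_beta F).
Local Notation M := (logpart F).
Local Notation law := (ef_law F).

Lemma density_ge0 (h : Theta) x : 0 <= density F h x.
Proof. exact: expR_ge0. Qed.

Lemma density_gt0 (h : Theta) x : 0 < density F h x.
Proof. exact: expR_gt0. Qed.

Lemma ge0_integral_law (h : Theta) (f : X -> \bar R) : measurable_fun setT f ->
  (forall x, 0 <= f x)%E ->
  (\int[law h]_x f x = \int[mu]_x (f x * (density F h x)%:E))%E.
Proof.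
apply: (@ge0_integral_density _ _ _ mu (law h) (density F h)) => //.
- exact: density_ge0.
- exact: measurable_density.
Qed.

Section mean.
Variable theta0 : Theta.
Hypothesis fin0 : (\int[law theta0]_x (`|beta x|)%:E < +oo)%E.

Lemma integrable_beta (h : Theta) :
  (law theta0).-integrable setT (fun x => (beta x h : R)%:E).
Proof.
apply/integrableP; split; first by apply/measurable_EFinP; exact: measurable_beta.
apply: (@le_lt_trans _ _ (\int[law theta0]_x (`|h|%:E * (`|beta x|)%:E))%E).
  apply: ge0_le_integral_nonmeasurable => x //=.
  by rewrite lee_fin mulrC; exact: dual_le.
rewrite ge0_integralZl//.
- by rewrite lte_mul_pinfty// lee_fin.
- apply/measurable_EFinP; apply: (measurableT_comp (@measurable_dual_norm R S p)).
  exact: ef_beta_measurable.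
Qed.

(** The mean is taken direction by direction; it is bounded in [h] because the
    norm of the sufficient statistic has a finite mean. *)
Lemma mean_functional : exists T0 : Hdual S p,
  forall h, (\int[law theta0]_x (beta x h : R)%:E = (T0 h : R)%:E)%E.
Proof.
pose T (h : Theta) : R^o := fine (\int[law theta0]_x (beta x h : R)%:E)%E.
have TE h : (\int[law theta0]_x (beta x h : R)%:E = (T h : R)%:E)%E.
  by rewrite /T fineK//; apply: integrable_fin_num => //; exact: integrable_beta.
have Tlin : linear T.
  move=> c g h; apply: EFin_inj; rewrite -TE EFinD EFinM -!TE.
  rewrite -integralZl//; last exact: integrable_beta.
  rewrite -integralD//; last 2 first.
  - by apply: integrableZl => //; exact: integrable_beta.
  - exact: integrable_beta.
  apply: eq_integral => x _; rewrite -EFinM -EFinD; congr EFin.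
  by rewrite linearP.
pose C := fine (\int[law theta0]_x (`|beta x|)%:E)%E.
have CE : (\int[law theta0]_x (`|beta x|)%:E)%E = C%:E.
  by rewrite /C fineK// ge0_fin_numE// integral_ge0.
have C0 : 0 <= C by rewrite fine_ge0// integral_ge0.
have Tb h : `|T h| <= C * `|h|.
  rewrite -lee_fin EFinM -CE -[X in (X <= _)%E]/(`|(T h)%:E|)%E -TE.
  apply: (le_trans (le_abse_integral _ _ _)) => //.
    by apply/measurable_EFinP; exact: measurable_beta.
  rewrite -ge0_integralZr//; last first.
    apply/measurable_EFinP; apply: (measurableT_comp (@measurable_dual_norm R S p)).
    exact: ef_beta_measurable.
  apply: ge0_le_integral_nonmeasurable => x //=.
  by rewrite lee_fin; exact: dual_le.
have TB g h : T g - T h = T (g - h).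
  have := Tlin (-1) h g; rewrite !scaleN1r (addrC (- h)) => ->.
  by rewrite addrC.
have Tc : continuous T.
  apply: (lipschitz_continuous_Hs C0) => g h.
  by rewrite TB.
have Tin : T \in @in_dual R S p by apply/mem_set; split.
by exists (MkHdual Tin) => h; rewrite TE.
Qed.

(** The log-likelihood ratio of one observation is affine in the sufficient
    statistic, so the divergence is the Bregman divergence of the
    log-partition function. *)
Lemma KL_formula (T0 : Hdual S p) (theta : Theta) :
  (forall h, (\int[law theta0]_x (beta x h : R)%:E = (T0 h : R)%:E)%E) ->
  KL F theta theta0 = (M theta - M theta0 - T0 (theta - theta0))%:E.
Proof.
move=> T0E.
have mb h : measurable_fun setT (fun x => beta x h : R) by exact: measurable_beta.
pose f x : R := ln (density F theta0 x / density F theta x).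
have fE x : f x = M theta - M theta0 - beta x (theta - theta0).
  rewrite /f ln_div ?posrE ?density_gt0// /density !expRK linearB/=.
  by ring.
have mf : measurable_fun setT f.
  rewrite (_ : f = fun x => M theta - M theta0 - beta x (theta - theta0)).
    exact: measurable_funB.
  by apply/funext => x.
have iC : (law theta0).-integrable setT (fun x => (M theta - M theta0)%:E).
  exact: finite_measure_integrable_cst.
have iB := integrable_beta (theta - theta0).
have fi : (law theta0).-integrable setT (EFin \o f).
  rewrite (_ : EFin \o f = (fun x => (M theta - M theta0)%:E -
      (beta x (theta - theta0) : R)%:E)%E).
    exact: integrableB.
  by apply/funext => x /=; rewrite fE EFinB.
have [_ H] := @integrable_density _ _ _ mu (law theta0) (density F theta0)
  (@density_ge0 theta0) (measurable_density F theta0) (fun A _ => erefl) f mf fi.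
transitivity (\int[law theta0]_x (f x)%:E)%E; first by rewrite H.
under eq_integral do rewrite fE EFinB.
rewrite integralB// T0E integral_probability_cst.
by rewrite -EFinB.
Qed.

Lemma fisher_basis (C0 : R) (T0 : Hdual S p) (k : nat) :
  (forall h, (\int[law theta0]_x (beta x h : R)%:E = (T0 h : R)%:E)%E) ->
  (forall h : Theta, (fisher F theta0 h <= (C0 * `|hval h| ^+ 2)%:E)%E) ->
  (\int[law theta0]_x ((beta x (Hs_basis S p k) - dual_coef T0 k) ^+ 2)%:E
    <= C0%:E)%E.
Proof.
move=> T0E hC; have := hC (Hs_basis S p k).
have -> : `|hval (Hs_basis S p k)| ^+ 2 = 1.
  by rewrite -hs_ip_norm hs_orthonormal eqxx.
rewrite mulr1; apply: le_trans.
rewrite /fisher /variance unlock !unlock/= T0E/=.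
rewrite le_eqVlt; apply/orP; left; apply/eqP.
by apply: eq_integral => x _; rewrite expr2.
Qed.

(** Each coordinate of the centred empirical mean is an average of independent
    centred variables whose second moment, the Fisher information along a
    basis vector, is at most [C0]. *)
Lemma noise_moment (C0 W : R) (T0 : Hdual S p) (w : nat -> R) (n : nat) :
  (forall h, (\int[law theta0]_x (beta x h : R)%:E = (T0 h : R)%:E)%E) ->
  (forall h : Theta, (fisher F theta0 h <= (C0 * `|hval h| ^+ 2)%:E)%E) ->
  (0 < n)%N -> 0 <= C0 -> (forall k, 0 <= w k) ->
  (forall N, \sum_(0 <= k < N) w k <= W) ->
  (\int[data_law F theta0 n]_x
     wsum w (dual_coef (empirical_beta F x - T0)%R) <= (C0 * W / n%:R)%:E)%E.
Proof.
move=> T0E hC n0 C00 w0 wW.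
have nR0 : 0 < n%:R :> R by rewrite ltr0n.
pose Y k x : R := beta x (Hs_basis S p k) - dual_coef T0 k.
have mY k : measurable_fun setT (Y k).
  by apply: measurable_funB => //; exact: measurable_beta.
pose v k := fine (\int[law theta0]_x (Y k x ^+ 2)%:E)%E.
have Y2 k : (\int[law theta0]_x (Y k x ^+ 2)%:E <= C0%:E)%E by exact: fisher_basis.
have vE k : (\int[law theta0]_x (Y k x ^+ 2)%:E = (v k)%:E)%E.
  rewrite /v fineK// ge0_fin_numE; first by rewrite (le_lt_trans (Y2 k))// ltry.
  by apply: integral_ge0 => x _; rewrite lee_fin sqr_ge0.
have vC k : v k <= C0 by rewrite -lee_fin -vE.
have iB k := integrable_beta (Hs_basis S p k).
have iC k : (law theta0).-integrable setT (fun x => (dual_coef T0 k)%:E).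
  exact: finite_measure_integrable_cst.
have iY k : (law theta0).-integrable setT (EFin \o Y k).
  rewrite (_ : EFin \o Y k = (fun x => (beta x (Hs_basis S p k) : R)%:E -
      (dual_coef T0 k)%:E)%E); first exact: integrableB.
  by apply/funext => x /=; rewrite EFinB.
have Y0 k : (\int[law theta0]_x (Y k x)%:E = 0)%E.
  under eq_integral do rewrite EFinB.
  by rewrite integralB// T0E integral_probability_cst -EFinB subrr.
have coefE k (x : n.-tuple X) : dual_coef (empirical_beta F x - T0) k =
    n%:R^-1 * \sum_(i < n) Y k (tnth x i).
  rewrite sumrB sumr_const card_ord -[dual_coef T0 k *+ n]mulr_natl mulrBr.
  rewrite mulKf ?gt_eqF// -[LHS]/((empirical_beta F x - T0) (Hs_basis S p k)).
  rewrite -[LHS]/(n%:R^-1 * (\sum_(i < n) beta (tnth x i) : Hdual S p) (Hs_basis S p k)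
    - T0 (Hs_basis S p k)).
  congr (_ * _ - _); elim/big_ind2 : _ => // f1 r1 f2 r2 <- <-.
  by [].
rewrite /wsum integral_nneseries//; last 2 first.
- move=> k; apply/measurable_EFinP; apply: measurable_funM => //.
  apply: measurable_funX.
  rewrite (_ : (fun x => _) = (fun x : n.-tuple X =>
      n%:R^-1 * \sum_(i < n) Y k (tnth x i))); last first.
    by apply/funext => x; rewrite coefE.
  by apply: measurable_funM => //; exact: measurable_tuple_sum.
- by move=> k x _; rewrite lee_fin mulr_ge0// sqr_ge0.
have termE k : (\int[data_law F theta0 n]_x
    (w k * dual_coef (empirical_beta F x - T0) k ^+ 2)%:E =
    (w k * (v k / n%:R))%:E)%E.
  have [_ _ S2] := iid_sum_moments (mY k) (iY k) (Y0 k) (vE k) n.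
  under eq_integral do rewrite coefE exprMn mulrA EFinM.
  rewrite ge0_integralZl//; last 3 first.
  - apply/measurable_EFinP; apply: measurable_funX; exact: measurable_tuple_sum.
  - by move=> x _; rewrite lee_fin sqr_ge0.
  - by rewrite lee_fin mulr_ge0// sqr_ge0.
  rewrite S2 -EFinM; congr EFin; field; rewrite gt_eqF//.
under eq_eseriesr do rewrite termE.
apply: lime_le.
  apply: is_cvg_nneseries => k _ _; rewrite lee_fin mulr_ge0// divr_ge0 ?(ltW nR0)//.
  by rewrite -lee_fin -vE; apply: integral_ge0 => x _; rewrite lee_fin sqr_ge0.
apply: nearW => N; rewrite sumEFin lee_fin.
apply: (@le_trans _ _ (\sum_(0 <= k < N) C0 / n%:R * w k)).
  apply: ler_sum => k _; rewrite mulrC ler_wpM2r// ler_wpM2r ?invr_ge0 ?(ltW nR0)//.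
rewrite -mulr_sumr mulrAC; rewrite ler_wpM2r ?invr_ge0 ?(ltW nR0)//.
by rewrite ler_wpM2l.
Qed.

End mean.

End exponential_family.

(** * Weights relative to a cutoff and bounds on the divergence *)

Section wsum_calculus.
Context {R : realType}.
Implicit Types (w a b : nat -> R).

Lemma wsum_mono w w' a : (forall k, 0 <= w k) -> (forall k, w k <= w' k) ->
  (wsum w a <= wsum w' a)%E.
Proof.
move=> w0 ww'; apply: lee_nneseries => k _; first by rewrite lee_fin mulr_ge0 ?sqr_ge0.
by rewrite lee_fin ler_wpM2r ?sqr_ge0.
Qed.

Lemma wsum_scale w a (c : R) : (forall k, 0 <= w k) ->
  wsum (fun k => c * w k) a = (c%:E * wsum w a)%E.
Proof.
move=> w0; rewrite /wsum -nneseriesZl; last first.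
  by move=> k _; rewrite lee_fin mulr_ge0 ?sqr_ge0.
by apply: eq_eseriesr => k _; rewrite -EFinM; congr EFin; ring.
Qed.

Lemma wsum_add w w' a : (forall k, 0 <= w k) -> (forall k, 0 <= w' k) ->
  wsum (fun k => w k + w' k) a = (wsum w a + wsum w' a)%E.
Proof.
move=> w0 w0'; rewrite /wsum -nneseriesD; last 2 first.
- by move=> k _ _; rewrite lee_fin mulr_ge0 ?sqr_ge0.
- by move=> k _ _; rewrite lee_fin mulr_ge0 ?sqr_ge0.
by apply: eq_eseriesr => k _; rewrite -EFinD; congr EFin; ring.
Qed.

Lemma wsum_sub_le w a b (A B : R) : (forall k, 0 <= w k) ->
  (wsum w a <= A%:E)%E -> (wsum w b <= B%:E)%E ->
  (wsum w (fun k => (a k - b k)%R) <= (2 * A + 2 * B)%:E)%E.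
Proof.
move=> w0 hA hB; apply: wsum_le => // n.
have := le_trans (psum_le_wsum w0 a n) hA; rewrite lee_fin => hA'.
have := le_trans (psum_le_wsum w0 b n) hB; rewrite lee_fin => hB'.
apply: (@le_trans _ _ (2 * \sum_(0 <= k < n) w k * a k ^+ 2 +
    2 * \sum_(0 <= k < n) w k * b k ^+ 2)); last by lra.
rewrite !mulr_sumr -big_split/=; apply: ler_sum => k _.
by have := w0 k; have := sqr_ge0 (a k + b k); nra.
Qed.

End wsum_calculus.

Section parseval.
Context {R : realType} (S : hilbert_scale R).

Lemma coef_partial_sum (c : nat -> R) (n : nat) :
  coef (\sum_(0 <= k < n) c k *: hs_basis S k) =
  (fun j => if (j < n)%N then c j else 0).
Proof.
elim: n => [|n IH]; apply/funext => j; first by rewrite big_geq// Defs.coef0.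
rewrite big_nat_recr//= Defs.coefD IH Defs.coefZ coef_basis ltnS [in RHS]leq_eqVlt.
have [->|jn] := eqVneq j n; first by rewrite ltnn add0r mulr1.
by rewrite mulr0 addr0.
Qed.

Lemma norm_partial_sum (c : nat -> R) (n : nat) :
  `|\sum_(0 <= k < n) c k *: hs_basis S k| ^+ 2 = \sum_(0 <= k < n) c k ^+ 2.
Proof.
rewrite -hs_ip_norm; elim: n => [|n IH].
  by rewrite !big_geq// hs_ip_norm normr0 expr0n.
rewrite !big_nat_recr//= -IH; set s := \sum_(0 <= k < n) _.
have sn : hs_ip s (hs_basis S n) = 0.
  by have := congr1 (fun f => f n) (coef_partial_sum c n); rewrite /= ltnn.
rewrite addrC hs_ip_linear (hs_ipC (hs_basis S n)) (hs_ipC s) !hs_ip_linear.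
have ns : hs_ip (hs_basis S n) s = 0 by rewrite hs_ipC.
by rewrite sn ns hs_orthonormal eqxx addr0 mulr0 add0r mulr1 addrC expr2.
Qed.

(** The partial sums of the expansion converge in norm, and their squared
    norms are the partial sums of the series. *)
Lemma parseval (h : S) : wsum (fun=> 1) (coef h) = (`|h| ^+ 2)%:E.
Proof.
apply: cvg_lim => //.
rewrite (_ : (fun n => _) = EFin \o (fun n =>
    `|\sum_(0 <= k < n) coef h k *: hs_basis S k| ^+ 2)); last first.
  apply/funext => n /=; rewrite norm_partial_sum -sumEFin.
  by apply: eq_bigr => k _; rewrite mul1r.
apply: cvg_EFin; first exact: nearW.
have c1 := cvg_norm (@hs_expansion R S h).
by rewrite expr2; apply: cvgM; exact: c1.
Qed.

End parseval.

Section frequency_weights.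
Context {R : realType} (S : hilbert_scale R).
Local Notation lam := (hs_lam S).

(** Weights relative to a cutoff [L]. Up to [L], [mixed_weight] and
    [low_weight] give the H_0 norm and [sieve_weight] the H_a norm divided by
    [L `^ a]; beyond [L], the three give in this order the H_m norm divided by
    [L `^ m], zero, and the H_s norm divided by [L `^ s]. *)
Definition low_weight (L : R) (k : nat) : R :=
  if lam k <= L then 1 else 0.

Definition sieve_weight (L a s : R) (k : nat) : R :=
  if lam k <= L then (lam k / L) `^ (2 * a) else (lam k / L) `^ (2 * s).

Definition mixed_weight (L m : R) (k : nat) : R :=
  if lam k <= L then 1 else (lam k / L) `^ (2 * m).

Lemma low_weight_ge0 L k : 0 <= low_weight L k.
Proof. by rewrite /low_weight; case: ifP. Qed.

Lemma sieve_weight_ge0 L a s k : 0 <= sieve_weight L a s k.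
Proof. by rewrite /sieve_weight; case: ifP => _; exact: powR_ge0. Qed.

Lemma mixed_weight_ge1 (L m : R) k : 0 < L -> 0 <= m -> 1 <= mixed_weight L m k.
Proof.
rewrite /mixed_weight => L0 m0; case: ifPn => // ; rewrite -ltNge => Lk.
by rewrite powR_ge1 ?mulr_ge0// ler_pdivlMr// mul1r ltW.
Qed.

Lemma mixed_weight_gt0 (L m : R) k : 0 < L -> 0 <= m -> 0 < mixed_weight L m k.
Proof. by move=> L0 m0; rewrite (lt_le_trans _ (mixed_weight_ge1 _ L0 m0)). Qed.

Lemma low_weight_le1 L k : low_weight L k <= 1.
Proof. by rewrite /low_weight; case: ifP. Qed.

Section positive_cutoff.
Variable L : R.
Hypothesis L0 : 0 < L.

Let x0 k : 0 < lam k / L.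
Proof. by rewrite divr_gt0// hs_lam_gt0. Qed.

Let x_le1 k : (lam k / L <= 1) = (lam k <= L).
Proof. by rewrite ler_pdivrMr// mul1r. Qed.

Let weightE s k : weight S s k = L `^ (2 * s) * (lam k / L) `^ (2 * s).
Proof.
by rewrite -(powRM _ (ltW L0) (ltW (x0 k))) mulrC divfK ?gt_eqF.
Qed.

Lemma mixed_le_low_sieve (a m s : R) k : m <= s ->
  mixed_weight L m k <= low_weight L k + sieve_weight L a s k.
Proof.
move=> ms; rewrite /mixed_weight /low_weight /sieve_weight; case: ifPn => [_|].
  by rewrite lerDl powR_ge0.
rewrite -x_le1 -ltNge add0r => h; apply: ler_powR; first exact: ltW.
lra.
Qed.

Lemma weight_le_mixed (m' m : R) k : 0 <= m' -> m' <= m ->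
  weight S m' k <= L `^ (2 * m') * mixed_weight L m k.
Proof.
move=> m'0 m'm; rewrite weightE ler_wpM2l ?powR_ge0// /mixed_weight.
case: ifPn => [kL|]; first by rewrite powR_le1_ge0 ?mulr_ge0// x_le1.
by rewrite -ltNge => Lk; apply: ler_powR; [rewrite ler_pdivlMr// mul1r ltW|lra].
Qed.

Lemma low_le_weightN (r : R) k : 0 <= r ->
  low_weight L k <= L `^ (2 * r) * weight S (- r) k.
Proof.
move=> r0; rewrite weightE mulrA -powRD_gt0// mulrN subrr powRr0 mul1r.
rewrite /low_weight; case: (boolP (lam k <= L)) => [kL|_]; last exact: powR_ge0.
by apply: powR_ge1_le0; rewrite ?x_le1// oppr_le0 mulr_ge0.
Qed.

Lemma low_le_sieve (a s : R) k : 0 <= a ->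
  low_weight L k <= (L / lam 0%N) `^ (2 * a) * sieve_weight L a s k.
Proof.
move=> a0; rewrite /low_weight /sieve_weight.
case: (boolP (lam k <= L)) => [kL|_]; last by rewrite mulr_ge0 ?powR_ge0.
have l0 := hs_lam_gt0 S 0%N.
rewrite -powRM ?divr_ge0 ?(ltW (hs_lam_gt0 _ _)) ?(ltW L0)//.
apply: powR_ge1; last by rewrite mulr_ge0.
have -> : L / lam 0%N * (lam k / L) = lam k / lam 0%N by field; rewrite !gt_eqF.
by rewrite ler_pdivlMr// mul1r; exact: hs_lam_ndecr.
Qed.

Lemma sieve_le_weight (a s g : R) k : s <= g -> g <= a ->
  sieve_weight L a s k <= L `^ (- (2 * g)) * weight S g k.
Proof.
move=> sg ga; rewrite weightE mulrA -powRD_gt0// addNr powRr0 mul1r.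
rewrite /sieve_weight; case: ifPn => [kL|].
  by apply: ger_powR; rewrite ?x0 ?x_le1//; lra.
by rewrite -ltNge => Lk; apply: ler_powR; [rewrite ler_pdivlMr// mul1r ltW|lra].
Qed.

End positive_cutoff.

Lemma mixed_split (L a m s u v : R) (h : S) : 0 < L -> m <= s ->
  (wsum (sieve_weight L a s) (coef h) <= v%:E)%E ->
  wsum (low_weight L) (coef h) = (u ^+ 2)%:E ->
  (wsum (mixed_weight L m) (coef h) <= (u ^+ 2 + v)%:E)%E.
Proof.
move=> L0 ms hv hu; rewrite EFinD -hu; apply: le_trans (leeD (lexx _) hv).
rewrite -wsum_add; last 2 first.
- by move=> k; exact: low_weight_ge0.
- by move=> k; exact: sieve_weight_ge0.
apply: wsum_mono => k; last exact: mixed_le_low_sieve.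
by rewrite /mixed_weight; case: ifP => // _; exact: powR_ge0.
Qed.

Lemma mixed_le_low (L a m s u e N : R) (h : S) : 0 < L -> m <= s -> 0 <= N ->
  0 <= e -> e <= u ->
  (wsum (sieve_weight L a s) (coef h) <= (N * e ^+ 2)%:E)%E ->
  wsum (low_weight L) (coef h) = (u ^+ 2)%:E ->
  (wsum (mixed_weight L m) (coef h) <= (((1 + N) * u) ^+ 2)%:E)%E.
Proof.
move=> L0 ms N0 e0 eu hv hu; apply: le_trans (mixed_split L0 ms hv hu) _.
rewrite lee_fin exprMn.
have ee : e ^+ 2 <= u ^+ 2 by rewrite lerXn2r ?nnegrE ?(le_trans e0 eu).
have -> : (1 + N) ^+ 2 * u ^+ 2 = u ^+ 2 + N * u ^+ 2 + N * (1 + N) * u ^+ 2.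
  by ring.
rewrite -[leLHS]addr0 lerD// ?lerD2l ?ler_wpM2l//.
by rewrite mulr_ge0 ?sqr_ge0// mulr_ge0// addr_ge0.
Qed.

Lemma weight_embedding (s s' : R) : s <= s' -> exists2 C : R, 0 < C &
  forall k, weight S s k <= C * weight S s' k.
Proof.
move=> ss; exists (lam 0%N `^ (2 * s - 2 * s')) => [|k].
  by rewrite powR_gt0// hs_lam_gt0.
have l0 := hs_lam_gt0 S.
rewrite /weight (_ : 2 * s = (2 * s - 2 * s') + 2 * s'); last by ring.
rewrite powRD_gt0// (_ : _ + _ - _ = 2 * s - 2 * s'); last by ring.
rewrite ler_wpM2r ?powR_ge0//; apply: ler_powR_le0 => //; last by lra.
exact: hs_lam_ndecr.
Qed.

Lemma hnorm_le (s : R) (h : S) (c : R) : 0 <= c ->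
  (wsum (weight S s) (coef h) <= (c ^+ 2)%:E)%E -> (hnorm s h <= c%:E)%E.
Proof.
move=> c0; rewrite /hnorm /seqnorm.
have := wsum_ge0 (weight_ge0 S s) (coef h).
case: wsum => //= r; rewrite !lee_fin => r0 rc.
by rewrite -(ger0_norm c0) -sqrtr_sqr ler_wsqrtr.
Qed.

End frequency_weights.

Section divergence_bounds.
Context {R : realType} (S : hilbert_scale R) (p : R).
Variables (K : Hs S p -> R).
Variables (c0 C0 m q CK RK cphi r a s g : R) (phi : R -> R).
Hypotheses (m0 : 0 <= m) (mp : m <= p) (q0 : 0 < q) (CK0 : 0 < CK) (RK0 : 0 < RK).
Hypotheses (c00 : 0 < c0) (C00 : 0 <= C0).
Hypothesis K_low : forall (h : Hs S p) (b : R), 0 <= b -> b <= RK ->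
  (wsum (weight S m) (coef (h : S)) <= (b ^+ 2)%:E)%E ->
  c0 / 2 * `|hval h| ^+ 2 - CK * b `^ (2 + q) <= K h.
Hypothesis K_up : forall (h : Hs S p) (b : R), 0 <= b -> b <= RK ->
  (wsum (weight S m) (coef (h : S)) <= (b ^+ 2)%:E)%E ->
  K h <= C0 / 2 * `|hval h| ^+ 2 + CK * b `^ (2 + q).
Local Notation lam := (hs_lam S).

Let exp_split (L u : R) : 0 < L -> 0 < u ->
  (L `^ m * u) `^ (2 + q) = L `^ ((2 + q) * m) * u `^ q * u ^+ 2.
Proof.
move=> L0 u0; rewrite powRM ?powR_ge0 ?(ltW u0)// -powRrM (mulrC m).
rewrite powRD_gt0// -mulrA; congr (_ * _); rewrite mulrC; congr (_ * _).
exact: (powR_mulrn 2 (ltW u0)).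
Qed.

Lemma mixed_ge_norm (L : R) (h : Hs S p) (c : R) : 0 < L ->
  (wsum (mixed_weight S L m) (coef (h : S)) <= c%:E)%E -> `|hval h| ^+ 2 <= c.
Proof.
move=> L0 hc; rewrite -lee_fin -parseval; apply: le_trans hc.
by apply: wsum_mono => // k; exact: mixed_weight_ge1.
Qed.

Lemma weight_of_mixed (L : R) (h : Hs S p) (u : R) : 0 < L ->
  (wsum (mixed_weight S L m) (coef (h : S)) <= (u ^+ 2)%:E)%E ->
  (wsum (weight S m) (coef (h : S)) <= ((L `^ m * u) ^+ 2)%:E)%E.
Proof.
move=> L0 hu; apply: (@le_trans _ _ (wsum (fun k => L `^ (2 * m) *
    mixed_weight S L m k) (coef (h : S)))).
  apply: wsum_mono => k; first exact: weight_ge0.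
  by apply: weight_le_mixed.
rewrite wsum_scale; last by move=> k; rewrite ltW// mixed_weight_gt0.
rewrite exprMn EFinM (_ : (L `^ m) ^+ 2 = L `^ (2 * m)); last first.
  by rewrite -powR_mulrn ?powR_ge0// -powRrM mulrC.
by apply: lee_pmul => //; rewrite ?lee_fin ?powR_ge0//;
  apply: wsum_ge0 => k; rewrite ltW// mixed_weight_gt0.
Qed.

(** In a ball of radius of order [L `^ (- g)] for the mixed norm, the H_m norm
    is of order [L `^ (m - g)]: it enters the domain of the expansion, and the
    remainder, of order [L `^ ((2 + q) * (m - g))], is below the square of the
    radius. *)
Lemma divergence_upper (c : R) : (2 + q) * m < q * g -> m < g -> 0 < c ->
  exists C L0 : R, 1 <= L0 /\ forall L (h : Hs S p), L0 <= L ->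
    (wsum (mixed_weight S L m) (coef (h : S)) <= ((c * L `^ (- g)) ^+ 2)%:E)%E ->
    K h <= C * (L `^ (- g)) ^+ 2.
Proof.
move=> qmg mg c_gt0.
have [La La1 hLa] := @powR_small R (c / RK) (m - g) ltac:(lra).
have [Lb Lb1 hLb] := @powR_small R (CK * c `^ q * c ^+ 2) ((2 + q) * m - q * g)
  ltac:(lra).
exists (C0 / 2 * c ^+ 2 + 1), (Num.max La Lb); split; first by rewrite le_max La1.
move=> L h; rewrite ge_max => /andP[LaL LbL] hc.
have L1 : 1 <= L by lra.
have L0 : 0 < L by lra.
have e0 : 0 < L `^ (- g) by rewrite powR_gt0.
have u0 : 0 < c * L `^ (- g) by rewrite mulr_gt0.
have wm := weight_of_mixed L0 hc.
have b0 : 0 <= L `^ m * (c * L `^ (- g)) by rewrite mulr_ge0 ?powR_ge0 ?ltW.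
have bRK : L `^ m * (c * L `^ (- g)) <= RK.
  have := hLa _ LaL; rewrite powRD_gt0// mulrAC -mulrA => h1.
  have -> : L `^ m * (c * L `^ (- g)) =
      (c * (L `^ m * L `^ (- g)) / RK) * RK by field; rewrite gt_eqF.
  by rewrite ler_piMl ?(ltW RK0)// -mulrA.
apply: le_trans (K_up b0 bRK wm) _; rewrite exp_split// [leRHS]mulrDl mul1r.
apply: lerD.
  rewrite -[leRHS]mulrA; apply: ler_wpM2l; first by rewrite divr_ge0.
  by rewrite (le_trans (mixed_ge_norm L0 hc))// exprMn.
have -> : CK * (L `^ ((2 + q) * m) * (c * L `^ (- g)) `^ q * (c * L `^ (- g)) ^+ 2) =
    CK * c `^ q * c ^+ 2 * (L `^ ((2 + q) * m) * L `^ (- (q * g))) *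
    L `^ (- g) ^+ 2.
  rewrite (powRM q (ltW c_gt0) (ltW e0)) -powRrM mulNr (mulrC g); ring.
apply: ler_piMl; first exact: sqr_ge0.
by rewrite -powRD_gt0// hLb.
Qed.

Hypothesis phi_ge0 : forall u : R, 0 <= u -> 0 <= phi u.
Hypothesis phi_mono : forall u v : R, 0 <= u -> u <= v -> phi u <= phi v.
Hypothesis phi_quad : exists2 c : R, 0 < c &
  \forall u \near (0 : R)^'+, c * u ^+ 2 <= phi u.
Hypotheses (cphi0 : 0 < cphi) (r0 : 0 <= r).
Hypothesis K_phi : forall h : Hs S p,
  phi (cphi * fine (hnorm (- r) (h : S))) <= K h.

Lemma hnorm_negative_ge (h : Hs S p) (b : R) : 0 <= b ->
  ((b ^+ 2)%:E <= wsum (weight S (- r)) (coef (h : S)))%E ->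
  b <= fine (hnorm (- r) (h : S)).
Proof.
move=> b0 hb; have rp : - r <= p by move: r0 m0 mp; lra.
have [C Cgt0 hC] := weight_embedding S rp.
have : (wsum (weight S (- r)) (coef (h : S)) < +oo)%E.
  apply: (@le_lt_trans _ _ (wsum (fun k => C * weight S p k) (coef (h : S)))).
    by apply: wsum_mono => // k; exact: weight_ge0.
  rewrite wsum_scale; last by move=> k; exact: weight_ge0.
  by rewrite lte_mul_pinfty ?lee_fin ?(ltW Cgt0)//; exact: Hs_fin.
have := wsum_ge0 (weight_ge0 S (- r)) (coef (h : S)).
move: hb; rewrite /hnorm /seqnorm; case: wsum => //= v; rewrite !lee_fin => bv v0 _.
by rewrite -(ger0_norm b0) -sqrtr_sqr ler_wsqrtr.
Qed.

(** Being quadratic near zero and nondecreasing, [phi] dominates a truncated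
    square. *)
Lemma divergence_global : exists c eta : R, [/\ 0 < c, 0 < eta &
  forall (h : Hs S p) (b : R), 0 <= b ->
  ((b ^+ 2)%:E <= wsum (weight S (- r)) (coef (h : S)))%E ->
  c * Num.min (cphi * b) eta ^+ 2 <= K h].
Proof.
have [c cgt0 hphi] := phi_quad.
have /nbhs_ballP[e /= e0 he] := hphi.
exists c, (e / 2); split; rewrite ?divr_gt0// => h b b0 hb.
have bh := hnorm_negative_ge b0 hb.
set u := Num.min _ _.
have u0 : 0 <= u by rewrite le_min mulr_ge0 ?(ltW cphi0)//= divr_ge0// ltW.
have ub : u <= cphi * fine (hnorm (- r) (h : S)).
  by rewrite (le_trans (y := cphi * b)) ?ge_min ?lexx// ler_wpM2l// ltW.
apply: (@le_trans _ _ (phi u)); last first.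
  by apply: le_trans (K_phi h); exact: phi_mono.
move: u0; rewrite le_eqVlt => /orP[/eqP <-|ugt0].
  by rewrite expr0n mulr0 phi_ge0.
apply: he => //; rewrite /ball/= sub0r normrN gtr0_norm//.
have : u <= e / 2 by rewrite ge_min lexx orbT.
by move: e0; lra.
Qed.

Hypotheses (a0 : 0 <= a) (ms : m <= s).

(** For [u] at most of order [L `^ (2 * r - g)], the H_m norm is at most of
    order [L `^ (m + 2 * r - g)], the expansion applies and its remainder is
    below [c0 / 4 * u ^+ 2]. For larger [u] the global bound is used. Before
    truncation it is of order [L `^ (- 2 * r) * u ^+ 2], which for such [u]
    exceeds [L `^ (- g) * u]. After truncation it is a constant, and the sieve
    forces [u] to be at most of order [L `^ (a - g)], so that [L `^ (- g) * u]
    tends to zero. *)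
Lemma divergence_lower (M1 M' : R) :
  m + 2 * r < g -> (2 + q) * m + 2 * r * q < q * g -> a < 2 * g ->
  0 < M1 -> 0 < M' ->
  exists M2 L0 : R, [/\ 1 <= M2, 1 <= L0 & forall L (h : Hs S p) (u : R),
    L0 <= L ->
    (wsum (sieve_weight S L a s) (coef (h : S))
      <= (M' * (L `^ (- g)) ^+ 2)%:E)%E ->
    wsum (low_weight S L) (coef (h : S)) = (u ^+ 2)%:E ->
    M2 * L `^ (- g) <= u ->
    3 * M1 * L `^ (- g) * u <= K h].
Proof.
move=> mrg qg ag M10 M'0.
have [c [eta [cgt0 eta0 hK]]] := divergence_global.
have [N NE N1] : exists2 N : R, N = 1 + M' & 1 <= N.
  by exists (1 + M'); rewrite ?lerDl ?(ltW M'0).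
have N0 : 0 < N by lra.
have ccphi : 0 < c * cphi ^+ 2 by rewrite mulr_gt0// exprn_gt0.
have [C3 C3E C30] : exists2 C3 : R, C3 = 3 * M1 / (c * cphi ^+ 2) & 0 < C3.
  by exists (3 * M1 / (c * cphi ^+ 2)); rewrite ?divr_gt0// mulr_gt0.
have [La La1 hLa] := @powR_small R (N * C3 / RK) (m + 2 * r - g) ltac:(lra).
have [Lb Lb1 hLb] := @powR_small R (4 / c0 * CK * (N * C3) `^ q * N ^+ 2)
  ((2 + q) * m + (2 * r - g) * q) ltac:(lra).
have l00 := hs_lam_gt0 S 0%N.
have [Lc Lc1 hLc] := @powR_small R (3 * M1 * N * lam 0%N `^ (- a) / (c * eta ^+ 2))
  (a - 2 * g) ltac:(lra).
exists (Num.max 1 (12 * M1 / c0)), (Num.max (Num.max La Lb) Lc); split.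
- by rewrite le_max lexx.
- by rewrite !le_max La1.
move=> L h u; rewrite !ge_max => /andP[/andP[LaL LbL] LcL] hsieve hu Mu.
have L0 : 0 < L by lra.
set e := L `^ (- g) in hsieve Mu *.
have e0 : 0 < e by rewrite powR_gt0.
have eu : e <= u.
  by apply: le_trans Mu; rewrite ler_peMl ?(ltW e0)// le_max lexx.
have Mu' : 12 * M1 / c0 * e <= u.
  by apply: le_trans Mu; rewrite ler_wpM2r ?(ltW e0)// le_max lexx orbT.
have u0 : 0 < u by lra.
have Nu0 : 0 < N * u by rewrite mulr_gt0.
have mix : (wsum (mixed_weight S L m) (coef (h : S)) <= ((N * u) ^+ 2)%:E)%E.
  by rewrite NE; exact: (mixed_le_low L0 ms (ltW M'0) (ltW e0) eu hsieve hu).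
have lowh : u ^+ 2 <= `|hval h| ^+ 2.
  rewrite -lee_fin -parseval -hu; apply: wsum_mono => k; first exact: low_weight_ge0.
  exact: low_weight_le1.
have [uC|Cu] := leP u (C3 * L `^ (2 * r - g)).
- have wm := weight_of_mixed L0 mix.
  have b0 : 0 <= L `^ m * (N * u) by rewrite mulr_ge0 ?powR_ge0 ?(ltW Nu0).
  have bRK : L `^ m * (N * u) <= RK.
    apply: (@le_trans _ _ (L `^ m * (N * (C3 * L `^ (2 * r - g))))).
      by rewrite ler_wpM2l ?powR_ge0// ler_wpM2l// ltW.
    have -> : L `^ m * (N * (C3 * L `^ (2 * r - g))) =
        (N * C3 / RK * (L `^ m * L `^ (2 * r - g))) * RK by field; rewrite gt_eqF.
    by rewrite ler_piMl ?(ltW RK0)// -powRD_gt0// addrA hLa.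
  apply: le_trans (K_low b0 bRK wm); rewrite exp_split//.
  have err : CK * (L `^ ((2 + q) * m) * (N * u) `^ q * (N * u) ^+ 2) <=
      c0 / 4 * u ^+ 2.
    apply: (@le_trans _ _ (CK * (L `^ ((2 + q) * m) *
        (N * (C3 * L `^ (2 * r - g))) `^ q * (N * u) ^+ 2))).
      rewrite ler_wpM2l ?(ltW CK0)// ler_wpM2r ?sqr_ge0// ler_wpM2l ?powR_ge0//.
      apply: ge0_ler_powR; rewrite ?nnegrE ?(ltW q0) ?(ltW Nu0)//.
        by rewrite !mulr_ge0 ?powR_ge0 ?(ltW N0) ?(ltW C30).
      by rewrite ler_wpM2l ?(ltW N0).
    have -> : (N * (C3 * L `^ (2 * r - g))) `^ q =
        (N * C3) `^ q * L `^ ((2 * r - g) * q).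
      by rewrite mulrA powRM ?powR_ge0 ?mulr_ge0 ?(ltW N0) ?(ltW C30)// -powRrM.
    have -> : CK * (L `^ ((2 + q) * m) * ((N * C3) `^ q * L `^ ((2 * r - g) * q)) *
        (N * u) ^+ 2) = c0 / 4 * u ^+ 2 * (4 / c0 * CK * (N * C3) `^ q * N ^+ 2 *
        (L `^ ((2 + q) * m) * L `^ ((2 * r - g) * q))).
      by field; rewrite gt_eqF.
    rewrite ler_piMr ?mulr_ge0 ?divr_ge0 ?(ltW c00) ?(ltW u0)//.
    by rewrite -powRD_gt0// hLb.
  have quad : 3 * M1 * e * u <= c0 / 4 * u ^+ 2.
    rewrite expr2 mulrA ler_wpM2r ?(ltW u0)//.
    have -> : 3 * M1 * e = c0 / 4 * (12 * M1 / c0 * e) by field; rewrite gt_eqF.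
    by rewrite ler_wpM2l// divr_ge0 ?(ltW c00).
  have : c0 / 2 * u ^+ 2 <= c0 / 2 * `|hval h| ^+ 2.
    by rewrite ler_wpM2l// divr_ge0 ?(ltW c00).
  by move: err quad; lra.
have b0 : 0 <= L `^ (- r) * u by rewrite mulr_ge0 ?powR_ge0 ?(ltW u0).
have hb : (((L `^ (- r) * u) ^+ 2)%:E <= wsum (weight S (- r)) (coef (h : S)))%E.
  have : (wsum (low_weight S L) (coef (h : S)) <=
      wsum (fun k => (L `^ (2 * r) * weight S (- r) k)%R) (coef (h : S)))%E.
    apply: wsum_mono => k; first exact: low_weight_ge0.
    exact: low_le_weightN.
  rewrite wsum_scale; last by move=> k; exact: weight_ge0.
  rewrite hu muleC -lee_pdivrMr ?powR_gt0// => /(le_trans _); apply.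
  rewrite lee_fin exprMn mulrC ler_wpM2l ?sqr_ge0//.
  by rewrite -powRN -powR_mulrn ?powR_ge0// -powRrM mulNr mulrC.
apply: le_trans (hK _ _ b0 hb).
have [cb|cb] := leP (cphi * (L `^ (- r) * u)) eta.
- have -> : c * (cphi * (L `^ (- r) * u)) ^+ 2 =
      c * cphi ^+ 2 * (L `^ (- r) * L `^ (- r)) * u * u by ring.
  rewrite ler_wpM2r ?(ltW u0)// -powRD_gt0//.
  apply: (@le_trans _ _ (c * cphi ^+ 2 * L `^ (- r + - r) *
      (C3 * L `^ (2 * r - g)))); last first.
    by rewrite ler_wpM2l ?mulr_ge0 ?powR_ge0 ?(ltW cgt0) ?sqr_ge0// ltW.
  have -> : c * cphi ^+ 2 * L `^ (- r + - r) * (C3 * L `^ (2 * r - g)) =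
      3 * M1 * (L `^ (- r + - r) * L `^ (2 * r - g)).
    by rewrite C3E; field; rewrite !gt_eqF.
  rewrite -powRD_gt0// (_ : - r - r + (2 * r - g) = - g); last by ring.
  by rewrite /e.
(* Truncated regime: up to the cutoff the sieve weights are at least that
   of the first frequency, so the sieve bounds [u]. *)
have usq : u <= (L / lam 0%N) `^ a * N * e.
  have : (wsum (low_weight S L) (coef (h : S)) <=
      wsum (fun k => ((L / lam 0%N) `^ (2 * a) * sieve_weight S L a s k)%R)
      (coef (h : S)))%E.
    apply: wsum_mono => k; first exact: low_weight_ge0.
    exact: low_le_sieve.
  rewrite wsum_scale; last by move=> k; exact: sieve_weight_ge0.
  rewrite hu => hus.
  have : ((u ^+ 2)%:E <= ((L / lam 0%N) `^ (2 * a))%:E * (M' * e ^+ 2)%:E)%E.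
    apply: (le_trans hus); apply: lee_pmul => //.
      by rewrite lee_fin powR_ge0.
    by apply: wsum_ge0 => k; exact: sieve_weight_ge0.
  rewrite -EFinM lee_fin => hu2.
  rewrite -(@ler_pXn2r _ 2)// ?nnegrE ?(ltW u0)//; last first.
    by rewrite !mulr_ge0 ?powR_ge0 ?(ltW N0) ?(ltW e0).
  apply: (le_trans hu2); rewrite !exprMn -mulrA.
  rewrite -[X in _ <= X * _]powR_mulrn ?powR_ge0// -powRrM (mulrC a).
  rewrite ler_wpM2l ?powR_ge0// ler_wpM2r ?sqr_ge0// NE; nra.
apply: (@le_trans _ _ (3 * M1 * e * ((L / lam 0%N) `^ a * N * e))).
  by rewrite ler_wpM2l// !mulr_ge0 ?(ltW M10) ?(ltW e0).
rewrite powR_div ?(ltW L0) ?(ltW l00)//.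
have -> : 3 * M1 * e * (L `^ a / lam 0%N `^ a * N * e) =
    c * eta ^+ 2 * (3 * M1 * N * lam 0%N `^ (- a) / (c * eta ^+ 2) *
      (L `^ a * e * e)).
  rewrite powRN; field.
  by rewrite !gt_eqF ?powR_gt0.
rewrite ler_piMr ?mulr_ge0 ?(ltW cgt0) ?(ltW eta0)//.
rewrite -!powRD_gt0// (_ : a + - g + - g = a - 2 * g); last by ring.
exact: hLc.
Qed.

End divergence_bounds.

(** * Prior mass of the sieve and of small balls *)

Section prior_mass.
Context {R : realType} (S : hilbert_scale R) (p alpha : R).
Variable Pi : probability (Hs S p) R.
Hypothesis Pi_prior : gaussian_series_prior alpha Pi.
Local Notation lam := (hs_lam S).
Local Notation dim := ((hs_dim S)%:R : R).
Local Notation a := (alpha + dim / 2).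
Local Notation sd := (@prior_sd R S alpha).

Let x0 (L : R) k : 0 < L -> 0 < lam k / L.
Proof. by move=> L0; rewrite divr_gt0// hs_lam_gt0. Qed.

Let x_le1 (L : R) k : 0 < L -> (lam k / L <= 1) = (lam k <= L).
Proof. by move=> L0; rewrite ler_pdivrMr// mul1r. Qed.

Lemma prior_sd_sq (L : R) k : 0 < L ->
  sd k ^+ 2 = L `^ (- (2 * a)) * (lam k / L) `^ (- (2 * a)).
Proof.
move=> L0; rewrite -(powRM _ (ltW L0) (ltW (x0 k L0))).
rewrite [X in X `^ _]mulrC divfK ?gt_eqF// /prior_sd.
rewrite -powR_mulrn ?powR_ge0// -powRrM; congr (_ `^ _); lra.
Qed.

Lemma spectral_profile_ge (kappa x : R) : 0 < x ->
  (if x <= 1 then 1 else x `^ (- kappa)) <= spectral_profile S kappa x.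
Proof.
move=> xgt0; rewrite /spectral_profile; case: ifPn => // x1.
by apply: powR_ge1_le0 => //; rewrite oppr_le0 divr_ge0.
Qed.

Lemma mixed_weight_inv_sum (m : R) : dim < 2 * m -> exists2 C : R, 0 < C &
  forall (L : R) (n : nat), 1 <= L ->
  \sum_(0 <= k < n) (mixed_weight S L m k)^-1 <= C * L `^ dim.
Proof.
move=> dm; have [C C0 hC] := spectral_count dm.
exists C => // L n L1; apply: le_trans (hC L n L1).
have L0 : 0 < L by lra.
apply: ler_sum => k _; apply: le_trans (spectral_profile_ge (2 * m) (x0 k L0)).
rewrite /mixed_weight x_le1//; case: ifP => _; first by rewrite invr1.
by rewrite powRN.
Qed.

(** The sieve weights cancel the prior variances up to the cutoff, which
    leaves as many weights of size one as there are frequencies, and beyond it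
    they leave a power that is summable because [s < alpha]. *)
Lemma prior_sieve_tail (s : R) : s < alpha -> exists2 C : R, 0 < C &
  forall L y : R, 1 <= L ->
  (Pi [set h : Hs S p |
     ((L `^ (- (2 * a)) * y)%:E < wsum (sieve_weight S L a s) (coef (h : S)))%E]
   <= (expR (C * L `^ dim - y / 4))%:E)%E.
Proof.
move=> sa; have d0 := hs_dimR_gt0 S.
have ds : dim < 2 * a - 2 * s by lra.
have [C C0 hC] := spectral_count ds.
exists (gauss_exp_sq * C) => [|L y L1]; first by rewrite mulr_gt0// gauss_exp_sq_gt0.
have L0 : 0 < L by lra.
rewrite -mulrA.
have vE k : sieve_weight S L a s k * sd k ^+ 2 = L `^ (- (2 * a)) *
    (if lam k / L <= 1 then 1 else (lam k / L) `^ (- (2 * a - 2 * s))).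
  rewrite (prior_sd_sq k L0) mulrCA; congr (_ * _).
  rewrite /sieve_weight x_le1//; case: ifP => _; rewrite -powRD_gt0 ?x0//.
    by rewrite subrr powRr0.
  by congr (_ `^ _); ring.
apply: (prior_tail Pi_prior).
- by rewrite powR_gt0.
- by move=> k; exact: sieve_weight_ge0.
- move=> k; rewrite vE ler_piMr ?powR_ge0//; case: ifPn => //.
  by rewrite -ltNge => x1; apply: powR_le1; lra.
- move=> n; under eq_bigr do rewrite vE.
  rewrite -mulr_sumr ler_wpM2l ?powR_ge0//; apply: le_trans (hC L n L1).
  apply: ler_sum => k _; exact: spectral_profile_ge (x0 k L0).
Qed.

Section small_ball.
Variables (m g B : R) (theta0 : Hs S p).
Hypotheses (dm : dim / 2 < m) (mg : m <= g) (ga : g <= alpha) (ma : m < alpha).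
Hypothesis B0 : 0 <= B.
Hypothesis theta0_smooth : (wsum (weight S g) (coef (theta0 : S)) <= B%:E)%E.

Local Notation delta := ((alpha - m) / 2).

(** Intervals for the standardised coordinates. Up to the cutoff they are
    centred at those of [theta0], and their lengths make each frequency
    contribute [L `^ (- (2 * a))] to the squared distance. Beyond the cutoff
    they are centred at zero and widen, slowly enough for the squared distance
    to stay summable and fast enough for all of them to hold together with
    fair probability. *)
Definition ball_radius (L : R) (k : nat) : R :=
  if lam k <= L then (lam k / L) `^ a else (lam k / L) `^ delta.

Definition ball_center (L : R) (k : nat) : R :=
  if lam k <= L then coef (theta0 : S) k / sd k else 0.

Definition ball_side (L : R) (k : nat) : set R :=
  `[(ball_center L k - ball_radius L k)%R,
    (ball_center L k + ball_radius L k)%R]%classic.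

(** Up to the cutoff there are about [L `^ dim] terms, which gives
    [L `^ (dim - 2 * a) = L `^ (- 2 * alpha)]; beyond it the two points are
    bounded separately, the second by the smoothness of [theta0]. *)
Lemma ball_side_sum : exists2 C : R, 0 < C &
  forall (L : R) (h : Hs S p), 1 <= L ->
  (forall k, ball_side L k (coef (h : S) k / sd k)) ->
  (wsum (mixed_weight S L m) (coef (((h - theta0)%R : Hs S p) : S))
    <= ((C * L `^ (- g)) ^+ 2)%:E)%E.
Proof.
have d0 := hs_dimR_gt0 S.
move: (dm) (mg) (ga) (ma) (B0) => dm' mg' ga' ma' B0'.
have dk : dim < dim + (alpha - m) by lra.
have [C1 C10 hC1] := spectral_count dk.
exists (1 + 2 * C1 + 2 * B) => [|L h L1 hh]; first by move: B0; lra.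
have L0 : 0 < L by lra.
have m0 : 0 <= m by lra.
have term k : mixed_weight S L m k * coef (((h - theta0)%R : Hs S p) : S) k ^+ 2 <=
    2 * L `^ (- (2 * a)) * spectral_profile S (dim + (alpha - m)) (lam k / L) +
    2 * L `^ (- (2 * g)) * (weight S g k * coef (theta0 : S) k ^+ 2).
  have sd0 : 0 < sd k by exact: prior_sd_gt0.
  have -> : coef (((h - theta0)%R : Hs S p) : S) k = coef (h : S) k - coef (theta0 : S) k.
    exact: coef_sub.
  have := hh k; rewrite /ball_side /= in_itv/= /ball_center /ball_radius.
  set y := coef (h : S) k; set z := coef (theta0 : S) k.
  have xg0 := x0 k L0.
  have prof := spectral_profile_ge (dim + (alpha - m)) xg0.
  have sq2 := prior_sd_sq k L0.
  have z0 : 0 <= 2 * L `^ (- (2 * g)) * (weight S g k * z ^+ 2).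
    by apply: mulr_ge0; rewrite mulr_ge0 ?powR_ge0 ?sqr_ge0 ?weight_ge0.
  rewrite /mixed_weight -(x_le1 k L0); move: prof.
  case: ifPn => [x1 prof|]; last rewrite -ltNge => x1 prof.
    move=> /andP[y1 y2]; rewrite mul1r.
    set t := (lam k / L) `^ a in y1 y2.
    have t0 : 0 <= t by exact: powR_ge0.
    have sq1 : (y - z) ^+ 2 <= (sd k * t) ^+ 2.
      have e1 : y - z = sd k * (y / sd k - z / sd k) by field; rewrite gt_eqF.
      rewrite e1 !exprMn ler_wpM2l ?sqr_ge0//; nra.
    have sq3 : (sd k * t) ^+ 2 = L `^ (- (2 * a)).
      rewrite exprMn sq2 /t -(powR_mulrn 2 (powR_ge0 _ _)) -powRrM -mulrA.
      by rewrite [_ * 2]mulrC -powRD_gt0// addNr powRr0 mulr1.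
    have La0 : 0 <= L `^ (- (2 * a)) by exact: powR_ge0.
    rewrite sq3 in sq1; apply: (le_trans sq1); rewrite -[leLHS]addr0 lerD//.
    nra.
  rewrite sub0r add0r => hy.
  set t := (lam k / L) `^ delta in hy.
  have t0 : 0 <= t by exact: powR_ge0.
  have sq1 : y ^+ 2 <= (sd k * t) ^+ 2.
    have [u uE] : {u | u = y / sd k} by exists (y / sd k).
    have e1 : y = sd k * u by rewrite uE; field; rewrite gt_eqF.
    rewrite e1 !exprMn ler_wpM2l ?sqr_ge0//.
    by move: hy; rewrite -uE => /andP[y1 y2]; nra.
  have sq3 : (lam k / L) `^ (2 * m) * (sd k * t) ^+ 2 =
      L `^ (- (2 * a)) * (lam k / L) `^ (- (dim + (alpha - m))).
    rewrite exprMn sq2 /t -(powR_mulrn 2 (powR_ge0 _ _)) -powRrM.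
    have -> : - (dim + (alpha - m)) = 2 * m + (- (2 * a) + delta * 2) by field.
    by rewrite !powRD_gt0//; ring.
  have X0 : 0 <= (lam k / L) `^ (2 * m) by exact: powR_ge0.
  have lowz : (lam k / L) `^ (2 * m) * z ^+ 2 <=
      L `^ (- (2 * g)) * (weight S g k * z ^+ 2).
    rewrite mulrA ler_wpM2r ?sqr_ge0//.
    have -> : L `^ (- (2 * g)) * weight S g k = (lam k / L) `^ (2 * g).
      rewrite powR_div ?(ltW L0) ?(ltW (hs_lam_gt0 _ _))// powRN mulrC.
      by [].
    by apply: ler_powR; [exact: ltW|lra].
  have La0 : 0 <= L `^ (- (2 * a)) by exact: powR_ge0.
  have h1 : (lam k / L) `^ (2 * m) * (y - z) ^+ 2 <=
      2 * ((lam k / L) `^ (2 * m) * (sd k * t) ^+ 2) +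
      2 * ((lam k / L) `^ (2 * m) * z ^+ 2).
    have : (y - z) ^+ 2 <= 2 * (sd k * t) ^+ 2 + 2 * z ^+ 2.
      by have := sqr_ge0 (y + z); move: sq1; nra.
    by move=> /(ler_wpM2l X0); lra.
  apply: (le_trans h1); rewrite sq3; apply: lerD.
    rewrite -mulrA ler_wpM2l// ler_wpM2l//.
  by rewrite -mulrA ler_wpM2l.
apply: wsum_le => [k|n]; first by rewrite ltW// mixed_weight_gt0.
apply: (@le_trans _ _ (2 * L `^ (- (2 * a)) * (C1 * L `^ dim) +
    2 * L `^ (- (2 * g)) * B)).
  apply: le_trans (ler_sum _ (fun k _ => term k)) _.
  rewrite big_split/= -!mulr_sumr; apply: lerD.
    by rewrite ler_wpM2l ?mulr_ge0 ?powR_ge0// hC1.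
  rewrite ler_wpM2l ?mulr_ge0 ?powR_ge0// -lee_fin.
  by rewrite (le_trans _ theta0_smooth)// psum_le_wsum// => k; exact: weight_ge0.
have Lg : L `^ (- (2 * a)) * L `^ dim <= L `^ (- (2 * g)).
  by rewrite -powRD_gt0//; apply: ler_powR => //; lra.
have sqg : L `^ (- g) ^+ 2 = L `^ (- (2 * g)).
  by rewrite -powR_mulrn ?powR_ge0// -powRrM; congr (_ `^ _); ring.
rewrite exprMn sqg.
set E := L `^ (- (2 * g)) in Lg *; have E0 : 0 <= E by exact: powR_ge0.
have l1 : C1 * (L `^ (- (2 * a)) * L `^ dim) <= C1 * E by rewrite ler_wpM2l// ltW.
apply: (@le_trans _ _ ((2 * C1 + 2 * B) * E)); first by move: l1; lra.
by rewrite ler_wpM2r//; move: B0 C10; nra.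
Qed.

(** Up to the cutoff the cost of an interval is the square of its centre,
    whose sum is controlled by the smoothness of [theta0], plus minus the
    logarithm of its length, which the profile dominates. Beyond the cutoff it
    is a tail of polynomial order, high enough to be summable. *)
Lemma ball_side_prob : exists2 C : R, 0 < C & forall L : R, 1 <= L ->
  exists c : nat -> R,
    (forall k, ((expR (- c k))%:E <= normal_prob 0 1 (ball_side L k))%E) /\
    forall n, \sum_(0 <= k < n) c k <= C * L `^ (2 * a - 2 * g).
Proof.
have d0 := hs_dimR_gt0 S.
move: (dm) (mg) (ga) (ma) (B0) => dm' mg' ga' ma' B0'.
have delta0 : 0 < delta by rewrite divr_gt0// subr_gt0.
have [j hj] : exists j : nat, dim < 2 * delta * j.+1%:R.
  exists (Num.truncn (dim / (2 * delta))).
  by rewrite [ltRHS]mulrC -ltr_pdivrMr ?truncnS_gt// mulr_gt0.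
have [C1 C10 hC1] := spectral_count hj.
have [C2 C20 hC2] := @gauss_ball_ge_tail R j.
have [G cG hG] : exists2 G : R, 0 < G & forall b t : R, 0 <= t <= 1 ->
    ((G * t * expR (- (b ^+ 2 / 2)))%:E
      <= normal_prob 0 1 `[(b - t)%R, (b + t)%R]%classic)%E.
  by exists gauss_ball_const; [exact: gauss_ball_const_gt0|exact: gauss_ball_ge].
(* [G] is the constant of the density bound, and [2 * a / dim] comes from
   bounding the logarithm by the profile. *)
pose D := `|ln G| + 2 * a / dim.
have D0 : 0 <= D.
  rewrite addr_ge0// divr_ge0// ?(ltW d0)//.
  by move: dm ma d0; lra.
exists ((D + C2) * C1 + B / 2) => [|L L1].
  by rewrite ltr_pwDl ?divr_ge0// mulr_gt0// ltr_wpDl.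
have L0 : 0 < L by lra.
exists (fun k => (D + C2) * spectral_profile S (2 * delta * j.+1%:R) (lam k / L) +
   L `^ (2 * a - 2 * g) * (weight S g k * coef (theta0 : S) k ^+ 2) / 2).
split=> [k|n].
  have xg0 := x0 k L0.
  have z0 : 0 <= L `^ (2 * a - 2 * g) * (weight S g k * coef (theta0 : S) k ^+ 2) / 2.
    rewrite divr_ge0//; apply: mulr_ge0; first exact: powR_ge0.
    by rewrite mulr_ge0 ?sqr_ge0 ?weight_ge0.
  rewrite /ball_side /ball_center /ball_radius /spectral_profile -(x_le1 k L0).
  case: ifPn => [x1|]; last rewrite -ltNge => x1.
    set b := coef _ _ / _; set t := (lam k / L) `^ a.
    have a0 : 0 <= a by move: dm ma d0; lra.
    have t0 : 0 < t by rewrite powR_gt0.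
    have t1 : t <= 1 by exact: powR_le1_ge0.
    apply: le_trans (hG b t _); last by rewrite (ltW t0).
    rewrite lee_fin -{1}(lnK (x := G * t)) ?posrE ?mulr_gt0//.
    rewrite -expRD ler_expR lnM ?posrE// ln_powR.
    set X := (lam k / L) `^ (- (dim / 2)).
    have X1 : 1 <= X.
      by apply: powR_ge1_le0 => //; rewrite oppr_le0 divr_ge0// ltW.
    have lnx : - ln (lam k / L) <= 2 / dim * X.
      have : ln X < X by apply: ln_sublinear; rewrite powR_gt0.
      rewrite /X ln_powR => /ltW h1.
      have -> : - ln (lam k / L) = 2 / dim * (- (dim / 2) * ln (lam k / L)).
        by field; rewrite gt_eqF.
      by rewrite ler_wpM2l// divr_ge0// ltW.
    have bb : b ^+ 2 <= L `^ (2 * a - 2 * g) * (weight S g k * coef (theta0 : S) k ^+ 2).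
      rewrite /b expr_div_n (prior_sd_sq k L0) mulrA mulrC.
      rewrite ler_wpM2r ?sqr_ge0//.
      have -> : weight S g k = L `^ (2 * g) * (lam k / L) `^ (2 * g).
        by rewrite -(powRM _ (ltW L0) (ltW xg0)) mulrC divfK ?gt_eqF.
      rewrite mulrA -powRD_gt0// (_ : 2 * a - 2 * g + 2 * g = 2 * a); last by ring.
      rewrite invfM -!powRN !opprK ler_wpM2l ?powR_ge0//.
      by apply: ger_powR; [rewrite xg0|move: ga d0; lra].
    have al : a * - ln (lam k / L) <= a * (2 / dim * X) by rewrite ler_wpM2l.
    have lc : - ln G <= `|ln G| * X.
      apply: (@le_trans _ _ `|ln G|).
        by rewrite -normrN ler_norm.
      by rewrite ler_peMr.
    have C2X : 0 <= C2 * X by rewrite mulr_ge0 ?(ltW C20)//; lra.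
    have DE : D * X = `|ln G| * X + a * (2 / dim * X).
      by rewrite /D; field; rewrite gt_eqF.
    by move: al lc C2X bb DE; lra.
  set t := (lam k / L) `^ delta.
  have t1 : 1 <= t by apply: powR_ge1; exact: ltW.
  rewrite sub0r add0r; apply: le_trans (hC2 t t1); rewrite lee_fin ler_expR lerN2.
  have -> : C2 / t ^+ (2 * j.+1) = C2 * (lam k / L) `^ (- (2 * delta * j.+1%:R)).
    rewrite /t powRN -powR_mulrn ?powR_ge0// -powRrM natrM.
    by congr (_ / _ `^ _); ring.
  set X := (lam k / L) `^ _; have X0 : 0 <= X by exact: powR_ge0.
  have : 0 <= D * X by rewrite mulr_ge0.
  by move: z0; lra.
rewrite big_split/= -mulr_sumr -mulr_suml -mulr_sumr [leRHS]mulrDl; apply: lerD.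
  rewrite -[leRHS]mulrA ler_wpM2l ?(addr_ge0 D0 (ltW C20))//.
  apply: le_trans (hC1 L n L1) _; rewrite ler_wpM2l ?(ltW C10)//.
  by apply: ler_powR => //; move: ga; lra.
rewrite [leRHS]mulrC mulrA ler_pM2r ?invr_gt0// ler_wpM2l ?powR_ge0//.
by rewrite -lee_fin (le_trans _ theta0_smooth)// psum_le_wsum// => k; exact: weight_ge0.
Qed.

Lemma prior_small_ball : exists c C : R, [/\ 0 < c, 0 < C &
  forall L : R, 1 <= L ->
  ((expR (- (C * L `^ (2 * a - 2 * g))))%:E <= Pi [set h : Hs S p |
    (wsum (mixed_weight S L m) (coef (((h - theta0)%R : Hs S p) : S))
      <= ((c * L `^ (- g)) ^+ 2)%:E)%E])%E].
Proof.
have [c c0 hc] := ball_side_sum; have [C C0 hC] := ball_side_prob.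
exists c, C; split=> // L L1; have [e [he1 he2]] := hC L L1.
have L0 : 0 < L by lra.
have mB k : measurable (ball_side L k) by exact: measurable_itv.
apply: le_trans (prior_rectangle Pi_prior mB he1 he2) _.
apply: le_measure; rewrite ?inE.
- rewrite (_ : mkset _ = \bigcap_k ((fun h : Hs S p =>
      coef (h : S) k / sd k) @^-1` ball_side L k)); last first.
    by apply/seteqP; split => h /= H k; [move=> _|]; exact: H.
  apply: bigcap_measurableType => k _; rewrite -[X in measurable X]setTI.
  have : measurable_fun setT (fun h : Hs S p => coef (h : S) k / sd k).
    by apply: measurable_funM => //; exact: measurable_coef.
  by apply.
- rewrite (_ : mkset _ = (fun h : Hs S p => wsum (mixed_weight S L m)
    (coef (((h - theta0)%R : Hs S p) : S))) @^-1`
    `]-oo, ((c * L `^ (- g)) ^+ 2)%:E]%classic); last first.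
    by apply/seteqP; split => h /=; rewrite in_itv.
  rewrite -[X in measurable X]setTI.
  have : measurable_fun setT (fun h : Hs S p => wsum (mixed_weight S L m)
      (coef (((h - theta0)%R : Hs S p) : S))).
    apply: measurable_wsum_coef => k; rewrite ltW// mixed_weight_gt0//.
    by move: dm (hs_dimR_gt0 S); lra.
  by apply => //; exact: emeasurable_itv.
- by move=> h /= H; exact: hc.
Qed.

End small_ball.
End prior_mass.

(** * Likelihood ratio and posterior *)

Section likelihood_ratio.
Context {R : realType} (S : hilbert_scale R) (p : R) d (X : measurableType d)
  (F : exp_family S p X).
Local Notation Theta := (Hs S p).
Local Notation mu := (ef_mu F).
Local Notation beta := (ef_beta F).
Local Notation M := (logpart F).
Local Notation law := (ef_law F).
Variable theta0 : Theta.

Definition loglik_ratio n (x : n.-tuple X) (theta : Theta) : R :=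
  n%:R * (empirical_beta F x theta - M theta) -
  n%:R * (empirical_beta F x theta0 - M theta0).

Lemma empirical_beta_sum n (x : n.-tuple X) (h : Theta) : (0 < n)%N ->
  n%:R * empirical_beta F x h = \sum_(i < n) beta (tnth x i) h.
Proof.
move=> n0; have nR0 : n%:R != 0 :> R by rewrite gt_eqF// ltr0n.
rewrite -[empirical_beta F x h]/(n%:R^-1 *
  (\sum_(i < n) beta (tnth x i) : Hdual S p) h) mulVKf//.
by elim/big_ind2 : _ => // f1 r1 f2 r2 <- <-.
Qed.

(** The exact splitting into a noise term, linear in [theta - theta0], and the
    divergence. *)
Lemma loglik_ratio_centred (T0 : Hdual S p) n (x : n.-tuple X) (theta : Theta) :
  loglik_ratio x theta = n%:R * ((empirical_beta F x - T0) (theta - theta0) -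
    (M theta - M theta0 - T0 (theta - theta0))).
Proof.
rewrite /loglik_ratio -[(empirical_beta F x - T0) _]/(empirical_beta F x (theta - theta0)
  - T0 (theta - theta0)) linearB/=.
ring.
Qed.

Lemma loglik_ratio_prod n (x : n.-tuple X) (theta : Theta) : (0 < n)%N ->
  expR (loglik_ratio x theta) =
  \prod_(i < n) (density F theta (tnth x i) / density F theta0 (tnth x i)).
Proof.
move=> n0; rewrite /loglik_ratio !mulrBr !empirical_beta_sum//.
have E (c : R) : n%:R * c = \sum_(i < n) c.
  by rewrite sumr_const card_ord mulr_natl.
rewrite !E -!sumrB expR_sum; apply: eq_bigr => i _.
by rewrite /density -expRB.
Qed.

Lemma loglik_ratio_mean n (theta : Theta) : (0 < n)%N ->
  (\int[data_law F theta0 n]_x (expR (loglik_ratio x theta))%:E = 1)%E.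
Proof.
move=> n0; under eq_integral do rewrite loglik_ratio_prod//.
have d0 h x : 0 < density F h x by exact: density_gt0.
have md h := measurable_density F h.
have mg : measurable_fun setT (fun x => density F theta x / density F theta0 x).
  rewrite (_ : (fun x => _) = (fun x =>
      expR (beta x theta - M theta - (beta x theta0 - M theta0)))).
    apply: measurableT_comp => //.
    by apply: measurable_funB; apply: measurable_funB => //; exact: measurable_beta.
  by apply/funext => x; rewrite /density -expRB.
apply: (@iid_integral_prod _ _ _ (law theta0) n
  (fun x => density F theta x / density F theta0 x)) => //.
  by move=> x; rewrite divr_ge0// ltW.
rewrite ge0_integral_law; last 2 first.
- exact/measurable_EFinP.
- by move=> x; rewrite lee_fin divr_ge0// ltW.
under eq_integral do rewrite -EFinM divfK ?gt_eqF//.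
exact: (@probability_setT _ _ _ (law theta)).
Qed.

(** The pairing is the pointwise limit of the pairings with the partial sums
    of the expansion of the parameter, which are measurable in both
    variables. *)
Lemma measurable_beta_joint :
  measurable_fun setT (fun z : X * Theta => beta z.1 z.2 : R).
Proof.
apply: (measurable_fun_cvg (h := fun N (z : X * Theta) =>
  \sum_(0 <= k < N) coef (z.2 : S) k * beta z.1 (Hs_basis S p k))).
  move=> N; apply: measurable_sum => k; apply: measurable_funM.
    by apply: (measurableT_comp (@measurable_coef R S p k)).
  exact: (measurableT_comp (measurable_beta F (Hs_basis S p k))).
move=> [x h] _ /=.
under eq_fun do rewrite -dual_eval_sum.
exact: (cvg_comp _ _ (Hs_expansion (h := h)) (@dual_continuous _ _ _ (beta x) h)).
Qed.

Hypothesis mM : measurable_fun setT M.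

Lemma measurable_loglik_ratio_joint n : (0 < n)%N ->
  measurable_fun setT (fun z : n.-tuple X * Theta => loglik_ratio z.1 z.2).
Proof.
move=> n0.
rewrite (_ : (fun z => _) = (fun z : n.-tuple X * Theta =>
    (\sum_(i < n) beta (tnth z.1 i) z.2 - n%:R * M z.2) -
    (\sum_(i < n) beta (tnth z.1 i) theta0 - n%:R * M theta0))); last first.
  by apply/funext => z; rewrite /loglik_ratio !mulrBr !empirical_beta_sum.
apply: measurable_funB; apply: measurable_funB.
- apply: measurable_sum => i.
  apply: (measurableT_comp measurable_beta_joint
    (g := fun z : n.-tuple X * Theta => (tnth z.1 i, z.2))).
  apply: measurable_fun_pair => //.
  exact: (measurableT_comp (measurable_tnth i)).
- by apply: measurable_funM => //; exact: (measurableT_comp mM).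
- apply: measurable_sum => i.
  apply: (measurableT_comp (measurable_beta F theta0)).
  exact: (measurableT_comp (measurable_tnth i)).
- exact: measurable_cst.
Qed.

Lemma measurable_loglik_ratio n (x : n.-tuple X) : measurable_fun setT (loglik_ratio x).
Proof.
apply: measurable_funB => //; apply: measurable_funM => //.
apply: measurable_funB => //; apply: continuous_measurable_Hs.
exact: dual_continuous.
Qed.

Variable Pi : probability Theta R.

Definition partial_evidence n (x : n.-tuple X) (A : set Theta) : \bar R :=
  (\int[Pi]_(theta in A) (expR (loglik_ratio x theta))%:E)%E.

Let evidence_indic n (x : n.-tuple X) (A : set Theta) :
  partial_evidence x A =
  (\int[Pi]_theta (expR (loglik_ratio x theta) * \1_A theta)%:E)%E.
Proof.
rewrite /partial_evidence integral_mkcond; apply: eq_integral => t _.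
by rewrite epatch_indic EFinM.
Qed.

Let measurable_evidence_joint n (A : set Theta) : (0 < n)%N -> measurable A ->
  measurable_fun setT (fun z : n.-tuple X * Theta =>
    (expR (loglik_ratio z.1 z.2) * \1_A z.2)%:E).
Proof.
move=> n0 mA; apply/measurable_EFinP; apply: measurable_funM.
  by apply: measurableT_comp => //; exact: measurable_loglik_ratio_joint.
by apply: (measurableT_comp (measurable_indic mA)).
Qed.

Lemma measurable_partial_evidence n (A : set Theta) : (0 < n)%N ->
  measurable A ->
  measurable_fun setT (fun x : n.-tuple X => partial_evidence x A).
Proof.
move=> n0 mA; under eq_fun do rewrite evidence_indic.
apply: (@measurable_fun_fubini_tonelli_F _ _ _ _ _ Pi
  (fun z : n.-tuple X * Theta => (expR (loglik_ratio z.1 z.2) * \1_A z.2)%:E)).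
  exact: measurable_evidence_joint.
by move=> z; rewrite lee_fin mulr_ge0 ?expR_ge0.
Qed.

(** For each fixed parameter the likelihood ratio has mean one, so the mean of
    its prior integral over a set is the prior mass of the set. *)
Lemma mean_partial_evidence n (A : set Theta) : (0 < n)%N -> measurable A ->
  (\int[data_law F theta0 n]_x partial_evidence x A = Pi A)%E.
Proof.
move=> n0 mA; under eq_integral do rewrite evidence_indic.
rewrite (@fubini_tonelli _ _ _ _ _ (data_law F theta0 n) Pi
  (fun z => (expR (loglik_ratio z.1 z.2) * \1_A z.2)%:E))//=; last exact: measurable_evidence_joint.
transitivity (\int[Pi]_t (\1_A t)%:E)%E; last by rewrite integral_indic// setIT.
apply: eq_integral => t _.
have mt : measurable_fun setT (fun x : n.-tuple X => (expR (loglik_ratio x t))%:E).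
  apply/measurable_EFinP; apply: measurableT_comp => //.
  exact: (measurable_fun_pair1 t (measurable_loglik_ratio_joint n0)).
under eq_integral do rewrite mulrC EFinM.
by rewrite ge0_integralZl// ?loglik_ratio_mean// ?mule1//; move=> x _; rewrite lee_fin expR_ge0.
Qed.

Section posterior_bound.
Variables (n : nat) (x : n.-tuple X).
Hypothesis fin_mass : (posterior_mass F Pi x setT < +oo)%E.

Let c : R := n%:R * (empirical_beta F x theta0 - M theta0).

Let mass_integrand (theta : Theta) :
  expR (n%:R * (empirical_beta F x theta - M theta)) =
  expR c * expR (loglik_ratio x theta).
Proof. by rewrite -expRD; congr expR; rewrite /loglik_ratio -/c addrCA subrr addr0. Qed.

Let mass_ge0 (B : set Theta) : (0 <= posterior_mass F Pi x B)%E.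
Proof. by apply: integral_ge0 => t _; rewrite lee_fin expR_ge0. Qed.

Let mass_mono (B : set Theta) :
  (posterior_mass F Pi x B <= posterior_mass F Pi x setT)%E.
Proof.
rewrite /posterior_mass integral_mkcond.
apply: ge0_le_integral_nonmeasurable => t; rewrite epatch_indic.
  by rewrite mule_ge0//= ?lee_fin ?expR_ge0.
by rewrite -EFinM lee_fin ler_piMr ?expR_ge0// indicE; case: (_ \in _).
Qed.

Let mass_fin (B : set Theta) : posterior_mass F Pi x B \is a fin_num.
Proof. by rewrite ge0_fin_numE// (le_lt_trans (mass_mono B)). Qed.

Lemma posterior_ge0 (B : set Theta) : 0 <= posterior F Pi x B.
Proof. by rewrite /posterior divr_ge0// fine_ge0. Qed.

Lemma posterior_le1 (B : set Theta) : posterior F Pi x B <= 1.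
Proof.
rewrite /posterior.
have : fine (posterior_mass F Pi x B) <= fine (posterior_mass F Pi x setT).
  by rewrite fine_le.
have : 0 <= fine (posterior_mass F Pi x setT) by rewrite fine_ge0.
rewrite le_eqVlt => /orP[/eqP <-|h0]; first by rewrite invr0 mulr0.
by move=> h; rewrite ler_pdivrMr// mul1r.
Qed.

(** The set [G] bounds the evidence from below; the numerator is split along
    [A], where the likelihood ratio is kept for later averaging, and off [A],
    where it is small. *)
Lemma posterior_le_evidence (A B G : set Theta) (l b u : R) :
  measurable A -> measurable G ->
  (forall t, G t -> l <= loglik_ratio x t) -> ((expR (- b))%:E <= Pi G)%E ->
  (forall t, B t -> ~ A t -> loglik_ratio x t <= - u) ->
  ((posterior F Pi x B)%:E <=
   (expR (b - l))%:E * partial_evidence x A + (expR (b - l - u))%:E)%E.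
Proof.
move=> mA mG hG hPi hB.
have mE : measurable_fun setT (fun t => (expR (loglik_ratio x t))%:E).
  by apply/measurable_EFinP; apply: measurableT_comp => //; exact: measurable_loglik_ratio.
have q0 : (0 <= partial_evidence x A)%E.
  by apply: integral_ge0 => t _; rewrite lee_fin expR_ge0.
have massB : (posterior_mass F Pi x B <=
    (expR c)%:E * (partial_evidence x A + (expR (- u))%:E))%E.
  have mI : measurable_fun setT (fun t => (expR (loglik_ratio x t) * \1_A t)%:E).
    apply/measurable_EFinP; apply: measurable_funM; first exact/measurable_EFinP.
    exact: measurable_indic.
  have mS : measurable_fun setT (fun t =>
      (expR (loglik_ratio x t) * \1_A t)%:E + (expR (- u))%:E)%E.
    exact: emeasurable_funD.
  have -> : (partial_evidence x A + (expR (- u))%:E =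
      \int[Pi]_t ((expR (loglik_ratio x t) * \1_A t)%:E + (expR (- u))%:E))%E.
    by rewrite ge0_integralD// evidence_indic integral_probability_cst.
  have S0 t : (0 <= (expR (loglik_ratio x t) * \1_A t)%:E + (expR (- u))%:E)%E.
    by rewrite -EFinD lee_fin addr_ge0 ?mulr_ge0 ?expR_ge0.
  have -> : ((expR c)%:E * (\int[Pi]_t ((expR (loglik_ratio x t) * \1_A t)%:E +
      (expR (- u))%:E)) = \int[Pi]_t ((expR c)%:E *
      ((expR (loglik_ratio x t) * \1_A t)%:E + (expR (- u))%:E)))%E.
    by rewrite ge0_integralZl// lee_fin expR_ge0.
  rewrite /posterior_mass integral_mkcond.
  apply: ge0_le_integral_nonmeasurable => t; rewrite epatch_indic.
    by rewrite mule_ge0//= ?lee_fin ?expR_ge0.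
  rewrite mass_integrand -EFinM -EFinD -EFinM lee_fin -mulrA.
  rewrite ler_wpM2l ?expR_ge0// !indicE.
  have [Bt|nBt] := pselect (B t); last first.
    by rewrite memNset// mulr0 addr_ge0 ?mulr_ge0 ?expR_ge0.
  rewrite [in leLHS]mem_set// mulr1.
  have [At|nAt] := pselect (A t).
    by rewrite mem_set// mulr1 lerDl expR_ge0.
  by rewrite memNset// mulr0 add0r ler_expR hB.
have massT : ((expR (c + l - b))%:E <= posterior_mass F Pi x setT)%E.
  apply: le_trans (mass_mono G).
  apply: (@le_trans _ _ (\int[Pi]_(t in G) (expR (c + l))%:E)%E).
    rewrite integral_cst//= expRD EFinM; apply: lee_pmul => //.
  apply: ge0_le_integral => //.
  - apply: measurable_funTS; apply/measurable_EFinP.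
    under eq_fun do rewrite mass_integrand.
    by apply: measurable_funM => //; exact/measurable_EFinP.
  - by move=> t /hG lt; rewrite lee_fin mass_integrand -expRD ler_expR lerD2l.
have mT0 : 0 < fine (posterior_mass F Pi x setT).
  rewrite -lte_fin fineK//; apply: lt_le_trans massT.
  by rewrite lte_fin expR_gt0.
have : partial_evidence x A = +oo%E \/ partial_evidence x A \is a fin_num.
  by case: (partial_evidence x A) q0 => //; [right|left].
move=> [->|/fineK qE].
  by rewrite gt0_muley ?lte_fin ?expR_gt0// addye ?leey.
rewrite -qE -EFinM -EFinD lee_fin /posterior ler_pdivrMr//.
set q := fine (partial_evidence x A) in qE *.
have Q0 : 0 <= q by rewrite -lee_fin qE.
have B1 : fine (posterior_mass F Pi x B) <= expR c * (q + expR (- u)).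
  by rewrite -lee_fin fineK// EFinM EFinD qE.
have T1 : expR (c + l - b) <= fine (posterior_mass F Pi x setT).
  by rewrite -lee_fin fineK.
apply: (le_trans B1).
apply: (@le_trans _ _ ((expR (b - l) * q + expR (b - l - u)) * expR (c + l - b))).
  have -> : expR c = expR (b - l) * expR (c + l - b).
    by rewrite -expRD; congr expR; ring.
  have -> : expR (b - l - u) = expR (b - l) * expR (- u) by rewrite -expRD.
  rewrite le_eqVlt; apply/orP; left; apply/eqP; ring.
by rewrite ler_wpM2l// addr_ge0 ?mulr_ge0 ?expR_ge0.
Qed.

End posterior_bound.

End likelihood_ratio.

(** * Posterior mass at a fixed level *)

Section contraction.
Context {R : realType} (S : hilbert_scale R) (p alpha : R).
Context (d : measure_display) (X : measurableType d) (F : exp_family S p X).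
Variables (theta0 : Hs S p) (Pi : probability (Hs S p) R) (T0 : Hdual S p).
Variables (m g s C0 B : R).
Local Notation dim := ((hs_dim S)%:R : R).
Local Notation a := (alpha + dim / 2).
Local Notation M := (logpart F).
Local Notation K h := (M (theta0 + h) - M theta0 - T0 h).

Hypothesis Pi_prior : gaussian_series_prior alpha Pi.
Hypothesis fin0 : (\int[ef_law F theta0]_x (`|ef_beta F x|)%:E < +oo)%E.
Hypothesis T0E : forall h,
  (\int[ef_law F theta0]_x (ef_beta F x h : R)%:E = (T0 h : R)%:E)%E.
Hypothesis fisher_le :
  forall h : Hs S p, (fisher F theta0 h <= (C0 * `|hval h| ^+ 2)%:E)%E.
Hypothesis M_measurable : measurable_fun setT M.
Hypothesis evidence_fin : forall (n : nat) (tau : Hdual S p),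
  (\int[Pi]_theta (expR (n%:R * (tau theta - M theta)))%:E < +oo)%E.
Hypothesis C00 : 0 <= C0.
Hypotheses (dm : dim / 2 < m) (mg : m < g) (ga : g <= alpha).
Hypotheses (s0 : 0 <= s) (sg : s < g).
Hypothesis B0 : 0 <= B.
Hypothesis theta0_smooth : (wsum (weight S g) (coef (theta0 : S)) <= B%:E)%E.
Hypothesis K_upper : forall c : R, 0 < c ->
  exists C L0 : R, 1 <= L0 /\ forall L (h : Hs S p), L0 <= L ->
    (wsum (mixed_weight S L m) (coef (h : S)) <= ((c * L `^ (- g)) ^+ 2)%:E)%E ->
    K h <= C * (L `^ (- g)) ^+ 2.
Hypothesis K_lower : forall M1 M' : R, 0 < M1 -> 0 < M' ->
  exists M2 L0 : R, [/\ 1 <= M2, 1 <= L0 & forall L (h : Hs S p) (u : R),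
    L0 <= L ->
    (wsum (sieve_weight S L a (Num.max s m)) (coef (h : S))
      <= (M' * (L `^ (- g)) ^+ 2)%:E)%E ->
    wsum (low_weight S L) (coef (h : S)) = (u ^+ 2)%:E ->
    M2 * L `^ (- g) <= u ->
    3 * M1 * L `^ (- g) * u <= K h].

(** The frequency at which the prior variance and the sampling variance
    balance. *)
Definition resolution (n : nat) : R := n%:R `^ (2 * alpha + dim)^-1.

Lemma low_radius (L : R) (h : S) : exists2 u : R, 0 <= u &
  wsum (low_weight S L) (coef h) = (u ^+ 2)%:E.
Proof.
exists (Num.sqrt (fine (wsum (low_weight S L) (coef h)))).
  exact: sqrtr_ge0.
have l0 : (0 <= wsum (low_weight S L) (coef h))%E.
  by apply: wsum_ge0 => k; exact: low_weight_ge0.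
rewrite sqr_sqrtr ?fine_ge0// fineK// ge0_fin_numE//.
apply: (@le_lt_trans _ _ (wsum (fun=> 1) (coef h))).
  by apply: wsum_mono => k; [exact: low_weight_ge0|exact: low_weight_le1].
by rewrite parseval ltry.
Qed.

(** The true parameter lies in the sieve since its smoothness [g] is between
    the two orders that define it. *)
Lemma sieve_theta0 (L : R) : 1 <= L ->
  (wsum (sieve_weight S L a (Num.max s m)) (coef (theta0 : S)) <=
   (B * (L `^ (- g)) ^+ 2)%:E)%E.
Proof.
move=> L_1; have L0 : 0 < L by exact: lt_le_trans L_1.
have s1g : Num.max s m <= g by rewrite ge_max !ltW.
have g_a : g <= a.
  by apply: le_trans ga _; rewrite lerDl divr_ge0 ?ler0n.
apply: (@le_trans _ _ (wsum (fun k => L `^ (- (2 * g)) * weight S g k)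
    (coef (theta0 : S)))).
  apply: wsum_mono => k; first exact: sieve_weight_ge0.
  exact: sieve_le_weight.
rewrite wsum_scale; last by move=> k; exact: weight_ge0.
have -> : (L `^ (- g)) ^+ 2 = L `^ (- (2 * g)).
  by rewrite -powR_mulrn ?powR_ge0// -powRrM mulNr mulrC.
rewrite [leRHS]EFinM muleC; apply: lee_pmul => //.
- by apply: wsum_ge0 => k; exact: weight_ge0.
- by rewrite lee_fin powR_ge0.
Qed.

(** High frequencies of a point of the sieve contribute only a multiple of
    [L `^ (s - g)] to its H_s norm, so a larger norm comes from the low
    frequencies. *)
Lemma far_low_frequency (L M2 M' u : R) (h : S) : 1 <= L -> 1 <= M2 -> 0 < M' ->
  (wsum (sieve_weight S L a (Num.max s m)) (coef h)
    <= (M' * (L `^ (- g)) ^+ 2)%:E)%E ->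
  0 <= u -> wsum (low_weight S L) (coef h) = (u ^+ 2)%:E ->
  (((M2 + M' + 1) * L `^ (s - g))%:E < hnorm s h)%E ->
  M2 * L `^ (- g) <= u.
Proof.
move=> L_1 M2_1 M'0 hv u0 hu; have L0 : 0 < L by exact: lt_le_trans L_1.
move=> far; rewrite leNgt; apply/negP => uM2; move: far; apply/negP.
rewrite -leNgt.
have c0 : 0 <= M2 + M' + 1 by lra.
apply: hnorm_le; first by rewrite mulr_ge0 ?powR_ge0.
apply: (@le_trans _ _ (wsum (fun k => L `^ (2 * s) *
    mixed_weight S L (Num.max s m) k) (coef h))).
  apply: wsum_mono => k; first exact: weight_ge0.
  by apply: weight_le_mixed => //; rewrite le_max lexx.
rewrite wsum_scale; last by move=> k; rewrite ltW// mixed_weight_gt0// le_max s0.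
apply: (@le_trans _ _ ((L `^ (2 * s))%:E *
    (u ^+ 2 + M' * (L `^ (- g)) ^+ 2)%:E)%E).
  by apply: lee_wpmul2l; [rewrite lee_fin powR_ge0|exact: (mixed_split L0 (lexx _) hv hu)].
move: uM2; rewrite -EFinM lee_fin powRD_gt0//.
have : 0 < L `^ (- g) by exact: powR_gt0.
move: (L `^ (- g)) => e e0 uM2.
have -> : L `^ (2 * s) = (L `^ s) ^+ 2.
  by rewrite -powR_mulrn ?powR_ge0// -powRrM mulrC.
rewrite (mulrCA _ (L `^ s)) [leRHS]exprMn ler_wpM2l ?sqr_ge0//.
have M2e : 0 <= M2 * e by rewrite mulr_ge0 ?(ltW e0)//; lra.
have u2 : u ^+ 2 <= (M2 * e) ^+ 2 by rewrite lerXn2r ?nnegrE// ltW.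
apply: (@le_trans _ _ ((M2 ^+ 2 + M') * e ^+ 2)).
  by rewrite mulrDl -exprMn lerD2r.
by rewrite exprMn ler_wpM2r ?sqr_ge0//; nra.
Qed.

Lemma noise_pairing n (x : n.-tuple X) (L b c : R) (h : Hs S p) :
  0 < L -> 0 <= b -> 0 <= c ->
  (wsum (fun k => (mixed_weight S L m k)^-1%R)
     (dual_coef (empirical_beta F x - T0)%R) <= (b ^+ 2)%:E)%E ->
  (wsum (mixed_weight S L m) (coef (h : S)) <= (c ^+ 2)%:E)%E ->
  `|(empirical_beta F x - T0) h| <= b * c.
Proof.
move=> L0 b0 c0 hb hc; apply: dual_le_wsum hb hc => // k.
apply: mixed_weight_gt0 => //; apply: le_trans (ltW dm).
by rewrite divr_ge0 ?ler0n.
Qed.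

Lemma loglik_ratio_ball n (x : n.-tuple X) (L b c C : R) (t : Hs S p) :
  0 < L -> 0 <= b -> 0 <= c ->
  (wsum (fun k => (mixed_weight S L m k)^-1%R)
     (dual_coef (empirical_beta F x - T0)%R)
     <= ((b * L `^ (- g)) ^+ 2)%:E)%E ->
  (wsum (mixed_weight S L m) (coef (((t - theta0)%R : Hs S p) : S))
    <= ((c * L `^ (- g)) ^+ 2)%:E)%E ->
  K (t - theta0) <= C * (L `^ (- g)) ^+ 2 ->
  - ((b * c + C) * (n%:R * (L `^ (- g)) ^+ 2)) <= loglik_ratio F theta0 x t.
Proof.
move=> L0 b0 c0 hb hc; rewrite (loglik_ratio_centred F theta0 T0).
have tE : theta0 + (t - theta0) = t by rewrite addrC subrK.
have e0 : 0 <= L `^ (- g) by exact: powR_ge0.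
have := noise_pairing L0 (mulr_ge0 b0 e0) (mulr_ge0 c0 e0) hb hc.
rewrite tE ler_norml => /andP[h1 _] h2.
rewrite -mulNr mulrCA ler_wpM2l ?ler0n//.
have -> : - (b * c + C) * (L `^ (- g)) ^+ 2 =
    - (b * L `^ (- g) * (c * L `^ (- g))) - C * L `^ (- g) ^+ 2 by ring.
by apply: lerB.
Qed.

(** The noise is at most [b * (1 + M') * e * u] and the divergence is at least
    three times that plus [3 * c * e * u], where [M' = 2 * M3 + 2 * B] is the
    sieve radius of the difference; since [e <= u], the surplus is at least
    [c * e ^+ 2]. *)
Lemma loglik_ratio_sieve n (x : n.-tuple X) (L b c M2 M3 : R) (t : Hs S p) :
  1 <= L -> 0 <= b -> 0 <= c -> 1 <= M2 -> 0 < M3 ->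
  (wsum (fun k => (mixed_weight S L m k)^-1%R)
     (dual_coef (empirical_beta F x - T0)%R)
     <= ((b * L `^ (- g)) ^+ 2)%:E)%E ->
  (wsum (sieve_weight S L a (Num.max s m)) (coef (t : S))
    <= (M3 * (L `^ (- g)) ^+ 2)%:E)%E ->
  (((M2 + (2 * M3 + 2 * B) + 1) * L `^ (s - g))%:E
    < hnorm s (t - theta0)%R)%E ->
  (forall (h : Hs S p) (u : R),
    (wsum (sieve_weight S L a (Num.max s m)) (coef (h : S))
      <= ((2 * M3 + 2 * B) * (L `^ (- g)) ^+ 2)%:E)%E ->
    wsum (low_weight S L) (coef (h : S)) = (u ^+ 2)%:E ->
    M2 * L `^ (- g) <= u ->
    3 * (b * (1 + (2 * M3 + 2 * B)) + c) * L `^ (- g) * u <= K h) ->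
  loglik_ratio F theta0 x t <= - (c * (n%:R * (L `^ (- g)) ^+ 2)).
Proof.
move=> L_1 b0 c0 M2_1 M30 hb ht far Klow.
have L0 : 0 < L by exact: lt_le_trans L_1.
have sieve_h : (wsum (sieve_weight S L a (Num.max s m))
    (coef (((t - theta0)%R : Hs S p) : S)) <=
    ((2 * M3 + 2 * B) * (L `^ (- g)) ^+ 2)%:E)%E.
  rewrite (_ : coef _ = fun k => coef (t : S) k - coef (theta0 : S) k);
    last by apply/funext => k; exact: coef_sub.
  apply: le_trans (wsum_sub_le _ ht (sieve_theta0 L_1)) _.
    by move=> k; exact: sieve_weight_ge0.
  by rewrite lee_fin [leRHS]mulrDl -!mulrA.
have M'0 : 0 < 2 * M3 + 2 * B by move: B0 => ?; lra.
move: (2 * M3 + 2 * B) M'0 sieve_h far Klow => M' M'0 sieve_h far Klow.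
have [u u0 hu] := low_radius L (((t - theta0)%R : Hs S p) : S).
have M2u := far_low_frequency L_1 M2_1 M'0 sieve_h u0 hu far.
have h2 := Klow _ _ sieve_h hu M2u.
have tE : theta0 + (t - theta0) = t by rewrite addrC subrK.
have e0 : 0 < L `^ (- g) by exact: powR_gt0.
move: h2; rewrite (loglik_ratio_centred F theta0 T0) tE => h2.
rewrite -mulNr mulrCA ler_wpM2l ?ler0n//.
move: (L `^ (- g)) e0 hb sieve_h M2u h2 => e e0 hb sieve_h M2u h2.
have eu : e <= u by apply: le_trans M2u; rewrite ler_peMl// ltW.
have Mu0 : 0 <= (1 + M') * u by rewrite mulr_ge0//; lra.
have mix2 : (wsum (mixed_weight S L m) (coef (((t - theta0)%R : Hs S p) : S)) <=
    (((1 + M') * u) ^+ 2)%:E)%E.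
  apply: (mixed_le_low L0 _ (ltW M'0) (ltW e0) eu sieve_h hu).
  by rewrite le_max lexx orbT.
have := noise_pairing L0 (mulr_ge0 b0 (ltW e0)) Mu0 hb mix2.
rewrite ler_norml => /andP[_ h1].
move: h1 h2.
set N := (empirical_beta F x - T0) _; set KK := _ - _ - _.
have ceu : c * e ^+ 2 <= c * (e * u) by rewrite ler_wpM2l// expr2 ler_wpM2l// ltW.
have ceu0 : 0 <= c * (e * u) by rewrite !mulr_ge0// ltW.
have beu0 : 0 <= b * (1 + M') * (e * u).
  by rewrite !mulr_ge0 ?(ltW e0)//; lra.
have -> : b * e * ((1 + M') * u) = b * (1 + M') * (e * u) by ring.
have -> : 3 * (b * (1 + M') + c) * e * u =
  3 * (b * (1 + M') * (e * u)) + 3 * (c * (e * u)) by ring.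
move: ceu ceu0 beu0; rewrite mulNr; lra.
Qed.

(** The constants are chosen in this order: the noise level [M1] from the
    error allowed, the exponent [C5] of the evidence from [M1], the sieve
    radius [M3] from [C5], and the distance from the sieve radius. *)
Lemma contraction_level (eta : R) : 0 < eta -> exists (Mbig L0 : R),
  1 <= L0 /\
  forall (n : nat) (A : set (Hs S p)), (0 < n)%N -> L0 <= resolution n ->
  (forall theta, A theta ->
    ((Mbig * resolution n `^ (s - g))%:E < hnorm s (theta - theta0)%R)%E) ->
  ('E_(data_law F theta0 n)[fun x => posterior F Pi x A] <= eta%:E)%E.
Proof.
move=> eta0; have d0 := hs_dimR_gt0 S.
move: (dm) (mg) (ga) (sg) (B0) (C00) (s0) => dm' mg' ga' sg' B0' C00' s0'.
pose s1 := Num.max s m.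
have s1g : s1 < g by rewrite gt_max sg mg.
have m0 : 0 < m by lra.
have a0 : 0 < 2 * alpha + dim by lra.
have dm2 : dim < 2 * m by lra.
have s1a : s1 < alpha by lra.
have malpha : m < alpha by lra.
(* Markov's inequality at level [M1] leaves probability at most [eta / 3]. *)
have [Cw Cw0 hCw] := mixed_weight_inv_sum dm2.
pose M1 := 1 + 3 * C0 * Cw / eta.
have M1_1 : 1 <= M1 by rewrite lerDl divr_ge0 ?mulr_ge0 ?(ltW Cw0) ?(ltW eta0).
have M10 : 0 < M1 by exact: lt_le_trans M1_1.
have hM1 : C0 * Cw <= eta / 3 * M1 ^+ 2.
  have : C0 * Cw <= eta / 3 * M1.
    rewrite /M1 mulrDr mulr1.
    have -> : eta / 3 * (3 * C0 * Cw / eta) = C0 * Cw by field; rewrite gt_eqF.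
    by rewrite lerDr divr_ge0// ltW.
  move=> h; apply: (le_trans h); rewrite ler_wpM2l ?divr_ge0 ?(ltW eta0)//.
  by rewrite expr2 ler_peMl//; lra.
clearbody M1.
(* [cG] is the radius of the ball, [C4] the exponent of its prior mass and [C2]
   bounds the divergence on it; together with the noise they give the exponent
   [C5] of the evidence. *)
have [cG [C4 [cG0 C40 hG]]] := prior_small_ball Pi_prior dm (ltW mg) ga malpha B0 theta0_smooth.
have [C2 [L1 [L1_1 hK2]]] := K_upper cG0.
pose C5 := Num.max 0 (M1 * cG + C2) + C4.
have C50 : 0 < C5 by rewrite ltr_wpDl// le_max lexx.
have C5E : M1 * cG + C2 + C4 <= C5 by rewrite lerD2r le_max lexx orbT.
clearbody C5.
(* The exponent of the complement of the sieve exceeds that of the evidence by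
   one; [M'] is the sieve radius of the differences with [theta0]. *)
have [C6 C60 hA] := prior_sieve_tail Pi_prior s1a.
have [M3 M3E] : {x | x = 4 * (C6 + C5 + 1)} by eexists.
have [M' M'E] : {x | x = 2 * M3 + 2 * B} by eexists.
have M30 : 0 < M3 by rewrite M3E; lra.
have M'0 : 0 < M' by rewrite M'E; lra.
have M1N0 : 0 < M1 * (1 + M') by apply: mulr_gt0; lra.
have [M1' M1'E] : {x | x = M1 * (1 + M') + C5 + 1} by eexists.
have M1'0 : 0 < M1' by rewrite M1'E; lra.
have [M2 [L2 [M2_1 L2_1 hK1]]] := K_lower M1'0 M'0.
have [L3 L3_1 hL3] := @powR_small R (3 / eta) (- dim) ltac:(lra).
exists (M2 + M' + 1), (Num.max (Num.max L1 L2) L3); split.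
  by rewrite !le_max L1_1.
move=> n A n0; have [L LE] : {L | L = resolution n} by eexists.
rewrite -LE.
rewrite !ge_max => /andP[/andP[L1L L2L] L3L] hAs.
have L_1 : 1 <= L by exact: le_trans L1L.
have L0 : 0 < L by exact: lt_le_trans L_1.
have nR0 : 0 < n%:R :> R by rewrite ltr0n.
have nE : n%:R = L `^ (2 * alpha + dim).
  by rewrite LE /resolution -powRrM mulVf ?gt_eqF// powRr1 ?ler0n.
have [e eD] : {e | e = L `^ (- g)} by eexists.
have e0 : 0 < e by rewrite eD powR_gt0.
have eE : e ^+ 2 = L `^ (- (2 * g)).
  by rewrite eD -powR_mulrn ?powR_ge0// -powRrM mulNr mulrC.
have [rho rhoD] : {r | r = L `^ (2 * a - 2 * g)} by eexists.
have rhoE : n%:R * e ^+ 2 = rho.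
  by rewrite nE eE rhoD -powRD_gt0//; congr (_ `^ _); field.
have Ldrho : L `^ dim <= rho by rewrite rhoD; apply: ler_powR => //; lra.
have rho0 : 0 < rho by rewrite rhoD powR_gt0.
have exprho : expR (- rho) <= eta / 3.
  have h1 : 3 / eta <= rho.
    apply: le_trans Ldrho; have := hL3 _ L3L.
    by rewrite powRN ler_pdivrMr ?powR_gt0// mul1r.
  rewrite expRN -[leRHS]invrK lef_pV2 ?posrE ?expR_gt0 ?invr_gt0 ?divr_gt0//.
  by rewrite invf_div (le_trans h1)// (le_trans _ (expR_ge1Dx _))// lerDr.
pose w k := (mixed_weight S L m k)^-1.
have mw0 k : 0 < mixed_weight S L m k by rewrite mixed_weight_gt0// ltW.
have w0 k : 0 <= w k by rewrite invr_ge0 ltW.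
pose W (x : n.-tuple X) := wsum w (dual_coef (empirical_beta F x - T0)).
have EW : (\int[data_law F theta0 n]_x W x <= (eta / 3 * (M1 * e) ^+ 2)%:E)%E.
  apply: le_trans (noise_moment fin0 T0E fisher_le n0 C00 w0
    (fun N => hCw L N L_1)) _.
  rewrite lee_fin exprMn mulrA [leRHS]mulrA.
  have -> : C0 * Cw * L `^ dim / n%:R = C0 * Cw * L `^ (- (2 * alpha)).
    by rewrite nE -powRN -mulrA -powRD_gt0//; congr (_ * _ `^ _); ring.
  apply: ler_pM => //; rewrite ?mulr_ge0 ?powR_ge0 ?(ltW Cw0)//.
  by rewrite eE; apply: ler_powR => //; lra.
pose Bad := [set h : Hs S p | ((L `^ (- (2 * a)) * (M3 * rho))%:E
  < wsum (sieve_weight S L a s1) (coef (h : S)))%E].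
pose G := [set h : Hs S p | (wsum (mixed_weight S L m)
  (coef (((h - theta0)%R : Hs S p) : S)) <= ((cG * L `^ (- g)) ^+ 2)%:E)%E].
have mBad : measurable Bad.
  rewrite (_ : Bad = (fun h : Hs S p => wsum (sieve_weight S L a s1) (coef (h : S)))
    @^-1` `](L `^ (- (2 * a)) * (M3 * rho))%:E, +oo[%classic); last first.
    by apply/seteqP; split => h /=; rewrite /Bad/= in_itv/= ?andbT.
  rewrite -[X in measurable X]setTI.
  have : measurable_fun setT (fun h : Hs S p =>
      wsum (sieve_weight S L a s1) (coef (h : S))).
    apply: measurable_wsum; first by move=> k; exact: sieve_weight_ge0.
    by move=> k; exact: measurable_coef.
  by apply => //; exact: emeasurable_itv.
have mG : measurable G.
  rewrite (_ : G = (fun h : Hs S p => wsum (mixed_weight S L m)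
    (coef (((h - theta0)%R : Hs S p) : S))) @^-1`
    `]-oo, ((cG * L `^ (- g)) ^+ 2)%:E]%classic); last first.
    by apply/seteqP; split => h /=; rewrite /G/= in_itv.
  rewrite -[X in measurable X]setTI.
  have : measurable_fun setT (fun h : Hs S p => wsum (mixed_weight S L m)
      (coef (((h - theta0)%R : Hs S p) : S))).
    by apply: measurable_wsum_coef => k; rewrite ltW.
  by apply => //; exact: emeasurable_itv.
have PiBad : (Pi Bad <= (expR (- ((C5 + 1) * rho)))%:E)%E.
  apply: le_trans (hA L (M3 * rho) L_1) _; rewrite lee_fin ler_expR.
  have : C6 * L `^ dim <= C6 * rho by rewrite ler_wpM2l// ltW.
  have -> : M3 * rho / 4 = (C6 + C5 + 1) * rho by rewrite M3E; field.
  lra.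
have finmass (x : n.-tuple X) : (posterior_mass F Pi x setT < +oo)%E.
  exact: evidence_fin.
(* On the bad event for the noise the first term is at least one; otherwise the
   evidence is at least [expR (- (C5 * rho))]. *)
have pointwise (x : n.-tuple X) : ((posterior F Pi x A)%:E <=
    ((M1 * e) ^+ 2)^-1%:E * W x + ((expR (C5 * rho))%:E *
      partial_evidence F theta0 Pi x Bad + (expR (- rho))%:E))%E.
  have M1e0 : 0 < (M1 * e) ^+ 2 by rewrite exprn_gt0// mulr_gt0.
  have W0 : (0 <= W x)%E by exact: wsum_ge0.
  have PE0 : (0 <= partial_evidence F theta0 Pi x Bad)%E.
    by apply: integral_ge0 => t _; rewrite lee_fin expR_ge0.
  have RHS0 : (0 <= (expR (C5 * rho))%:E * partial_evidence F theta0 Pi x Bad +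
      (expR (- rho))%:E)%E.
    by rewrite adde_ge0 ?mule_ge0 ?lee_fin ?expR_ge0.
  have [Wbad|Wgood] := ltP ((M1 * e) ^+ 2)%:E (W x).
    apply: (@le_trans _ _ 1%:E); first by rewrite lee_fin posterior_le1.
    rewrite -[leLHS]adde0; apply: leeD => //.
    by rewrite muleC lee_pdivlMr// mul1e ltW.
  rewrite -[leLHS]add0e; apply: leeD.
    by rewrite mule_ge0 ?lee_fin ?invr_ge0 ?(ltW M1e0).
  have hl t : G t -> - ((M1 * cG + C2) * rho) <= loglik_ratio F theta0 x t.
    move=> Gt; rewrite -rhoE eD; apply: loglik_ratio_ball => //.
    - exact: ltW.
    - exact: ltW.
    - by rewrite -eD.
    - exact: hK2.
  have hu t : A t -> ~ Bad t -> loglik_ratio F theta0 x t <= - ((C5 + 1) * rho).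
    move=> At nBt; rewrite -rhoE eD.
    apply: (@loglik_ratio_sieve _ _ L M1 (C5 + 1) M2 M3) => //.
    - exact: ltW.
    - by rewrite addr_ge0 ?(ltW C50).
    - by rewrite -eD.
    - rewrite -eD leNgt; apply/negP => nbt; apply: nBt; rewrite /Bad/=.
      by rewrite mulrCA rhoD -powRD_gt0// (_ : _ + _ = - (2 * g)) -?eE//; ring.
    - by rewrite -M'E; exact: hAs.
    - by rewrite -M'E addrA -M1'E => h u; exact: hK1.
  have := posterior_le_evidence M_measurable (finmass x) mBad mG hl
    (hG L L_1) hu.
  move=> /le_trans; apply; apply: leeD.
    apply: lee_wpmul2r => //; rewrite lee_fin ler_expR -rhoD opprK -mulrDl.
    by rewrite ler_wpM2r ?(ltW rho0)// addrC.
  rewrite lee_fin ler_expR -rhoD.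
  have : (M1 * cG + C2 + C4) * rho <= C5 * rho by rewrite ler_wpM2r ?(ltW rho0).
  lra.
rewrite unlock.
have mW : measurable_fun setT W.
  apply: measurable_wsum => // k.
  rewrite (_ : (fun x => _) = (fun x : n.-tuple X => n%:R^-1 *
      (\sum_(i < n) ef_beta F (tnth x i) (Hs_basis S p k)) - dual_coef T0 k)); last first.
    apply/funext => x.
    rewrite -[LHS]/(empirical_beta F x (Hs_basis S p k) - dual_coef T0 k).
    by rewrite -empirical_beta_sum// mulKf ?gt_eqF.
  apply: measurable_funB => //; apply: measurable_funM => //.
  exact: (measurable_tuple_sum (measurable_beta F (Hs_basis S p k))).
have mPE := measurable_partial_evidence theta0 M_measurable Pi n0 mBad.
have PE0 (x : n.-tuple X) : (0 <= partial_evidence F theta0 Pi x Bad)%E.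
  by apply: integral_ge0 => t _; rewrite lee_fin expR_ge0.
have W0 (x : n.-tuple X) : (0 <= W x)%E by exact: wsum_ge0.
have M1e0 : 0 < (M1 * e) ^+ 2 by rewrite exprn_gt0// mulr_gt0.
apply: le_trans (ge0_le_integral_nonmeasurable _ _ pointwise) _.
  by move=> x; rewrite lee_fin posterior_ge0.
have i1 : measurable_fun setT (fun x => ((M1 * e) ^+ 2)^-1%:E * W x)%E.
  exact: emeasurable_funM.
have i2 : measurable_fun setT (fun x : n.-tuple X => (expR (C5 * rho))%:E *
    partial_evidence F theta0 Pi x Bad)%E.
  exact: emeasurable_funM.
rewrite ge0_integralD//; last 3 first.
- by move=> x _; rewrite mule_ge0// lee_fin invr_ge0 ltW.
- by move=> x _; rewrite adde_ge0 ?mule_ge0 ?lee_fin ?expR_ge0.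
- exact: emeasurable_funD.
rewrite ge0_integralD//; last by move=> x _; rewrite mule_ge0// lee_fin expR_ge0.
rewrite !ge0_integralZl//; last by rewrite lee_fin invr_ge0 ltW.
rewrite mean_partial_evidence// integral_probability_cst.
apply: (@le_trans _ _ ((eta / 3)%:E + ((eta / 3)%:E + (eta / 3)%:E))%E); last first.
  by rewrite -!EFinD lee_fin; lra.
apply: leeD; last apply: leeD; last by rewrite lee_fin.
  by rewrite muleC lee_pdivrMr.
apply: (@le_trans _ _ ((expR (C5 * rho))%:E * (expR (- ((C5 + 1) * rho)))%:E)%E).
  by apply: lee_wpmul2l; rewrite ?lee_fin ?expR_ge0.
rewrite -EFinM -expRD lee_fin; apply: le_trans exprho.
by rewrite ler_expR; lra.
Qed.

End contraction.

(** * Convergence *)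

Lemma cvge0_eventually_le (R : realType) (u : (\bar R)^nat) :
  (forall n, (0 <= u n)%E) ->
  (forall e : R, 0 < e -> \forall n \near \oo, (u n <= e%:E)%E) ->
  u n @[n --> \oo] --> 0%E.
Proof.
move=> u0 ue; apply/fine_cvgP; split.
  near=> n; rewrite ge0_fin_numE//; apply: (@le_lt_trans _ _ 1%:E).
    by near: n; exact: ue.
  by rewrite ltry.
apply/cvgrPdist_le => e e0; near=> n.
have h : (u n <= e%:E)%E by near: n; exact: ue.
rewrite /= sub0r normrN ger0_norm ?fine_ge0//.
by rewrite -lee_fin fineK// ge0_fin_numE// (le_lt_trans h)// ltry.
Unshelve. all: by end_near. Qed.

Section conclusion.
Context {R : realType} (S : hilbert_scale R) (p : R).
Context (d : measure_display) (X : measurableType d) (F : exp_family S p X).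
Variables (theta0 : Hs S p) (T0 : Hdual S p).
Local Notation dim := ((hs_dim S)%:R : R).
Local Notation M := (logpart F).

Lemma resolution_cvg (alpha : R) : 0 < 2 * alpha + dim ->
  forall L0 : R, 1 <= L0 -> \forall n \near \oo, L0 <= resolution S alpha n.
Proof.
move=> a0 L0 L01.
exists (Num.truncn (L0 `^ (2 * alpha + dim))).+1 => // n /= hn.
rewrite /resolution -[leLHS]powRr1; last by apply: le_trans L01.
rewrite -{1}(mulfV (lt0r_neq0 a0)) powRrM.
apply: ge0_ler_powR; rewrite ?nnegrE ?powR_ge0 ?ler0n ?invr_ge0 ?(ltW a0)//.
by apply: le_trans (ltW (truncnS_gt _)) _; rewrite ler_nat.
Qed.

Lemma measurable_logpart : C2_frechet M -> measurable_fun setT M.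
Proof.
move=> [DM [dM _ _]]; apply: continuous_measurable_Hs => h.
exact: (differentiable_continuous (dM h).1).
Qed.

(** The expansion squeezes the divergence between multiples of the squared H_0
    norm once the information is; the norm in the remainder is replaced by any
    bound [b] on it. *)
Lemma KL_quadratic (c0 C0 m q CK RK : R) :
  0 < CK -> 0 < q ->
  (forall h : Hs S p,
    KL F (theta0 + h) theta0 = (M (theta0 + h) - M theta0 - T0 h)%:E) ->
  (forall h : Hs S p, (fisher F theta0 h <= (C0 * `|hval h| ^+ 2)%:E)%E) ->
  (forall h : Hs S p, ((c0 * `|hval h| ^+ 2)%:E <= fisher F theta0 h)%E) ->
  (forall theta : Hs S p, (hnorm m (theta - theta0) <= RK%:E)%E ->
    (`|KL F theta theta0 - 2^-1%:E * fisher F theta0 (theta - theta0)|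
      <= CK%:E * hnorm m (theta - theta0) `^ (2 + q)%R)%E) ->
  forall (h : Hs S p) (b : R), 0 <= b -> b <= RK ->
  (wsum (weight S m) (coef (h : S)) <= (b ^+ 2)%:E)%E ->
  c0 / 2 * `|hval h| ^+ 2 - CK * b `^ (2 + q) <= M (theta0 + h) - M theta0 - T0 h
    <= C0 / 2 * `|hval h| ^+ 2 + CK * b `^ (2 + q).
Proof.
move=> CK0 q0 KLE Iup Ilow KLexp h b b0 bR hb.
have := hnorm_le b0 hb.
have := KLexp (theta0 + h); rewrite KLE (_ : theta0 + h - theta0 = h); last first.
  by rewrite addrC addKr.
have n0 : (0 <= hnorm m h)%E by exact: sqrte_ge0.
move: (Iup h) (Ilow h); case: (fisher F theta0 h) => [f|//|//].
rewrite !lee_fin => fC fc.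
case: (hnorm m h) n0 => [x|//|//]; rewrite !lee_fin => x0 H xb.
have {}H := H (le_trans xb bR).
have xbq : CK * x `^ (2 + q) <= CK * b `^ (2 + q).
  apply: ler_wpM2l; first exact: ltW.
  by apply: ge0_ler_powR; rewrite ?nnegrE//; lra.
move: H; rewrite ler_norml => /andP[h1 h2].
move: h1 h2 xbq fC fc.
have -> : c0 / 2 * `|hval h| ^+ 2 = (c0 * `|hval h| ^+ 2) / 2 by ring.
have -> : C0 / 2 * `|hval h| ^+ 2 = (C0 * `|hval h| ^+ 2) / 2 by ring.
move: (c0 * _) (C0 * _) (CK * _) (CK * _) (M _ - _ - _) => u v w y z.
move=> *; apply/andP; split; lra.
Qed.

End conclusion.

Theorem theorem3p5 (R : realType) (S : hilbert_scale R) (p alpha beta : R)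
    (dX : measure_display) (X : measurableType dX) (F : exp_family S p X)
    (theta0 : Hs S p) (Pi : probability (Hs S p) R)
    (R0 c0 C0 mK qK CK RK cphi rK AT : R) (phi : R -> R) :
  0 <= p -> p < beta -> p < alpha ->
  (hnorm beta theta0 < +oo)%E ->
  gaussian_series_prior alpha Pi ->
  (* standing assumption on the prior *)
  (forall (n : nat) (tau : Hdual S p),
    (\int[Pi]_theta (expR (n%:R * (tau theta - logpart F theta)))%:E
      < +oo)%E) ->
  (* (1) *)
  0 < R0 -> 0 < c0 -> c0 <= C0 ->
  (forall theta : Hs S p, `|theta - theta0| <= R0 ->
    (\int[ef_law F theta]_x (`|ef_beta F x|)%:E < +oo)%E) ->
  (forall h : Hs S p, (fisher F theta0 h <= (C0 * `|hval h| ^+ 2)%:E)%E) ->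
  (forall h theta : Hs S p, `|theta - theta0| <= R0 ->
    ((c0 * `|hval h| ^+ 2)%:E <= fisher F theta h)%E) ->
  (* (2) *)
  C2_frechet (logpart F) ->
  (hs_dim S)%:R / 2 < mK -> mK <= p -> 0 < qK -> qK <= 1 -> 0 < CK -> 0 < RK ->
  (forall theta : Hs S p, (hnorm mK (theta - theta0) <= RK%:E)%E ->
    (`|KL F theta theta0 - 2^-1%:E * fisher F theta0 (theta - theta0)|
      <= CK%:E * hnorm mK (theta - theta0) `^ (2 + qK)%R)%E) ->
  (* (3) *)
  (forall u : R, 0 <= u -> 0 <= phi u) ->
  (forall u v : R, 0 <= u -> u <= v -> phi u <= phi v) ->
  (forall u : R, 0 < u -> 0 < phi u) ->
  (exists2 c : R, 0 < c & \forall u \near (0 : R)^'+, c * u ^+ 2 <= phi u) ->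
  0 < cphi -> 0 <= rK ->
  (forall theta : Hs S p,
    ((phi (cphi * fine (hnorm (- rK) (theta - theta0))))%:E
      <= KL F theta theta0)%E) ->
  (* (4) *)
  0 < AT ->
  (\int[ef_law F theta0]_x
     expeR (dual_hnorm (- mK) (ef_beta F x - mean_beta F theta0)%R * (AT^-1)%:E)
    < +oo)%E ->
  (* conditions on the exponents *)
  Num.max ((2 + qK) * p + 2 * rK) ((2 + qK) * mK + (hs_dim S)%:R)
    < qK * Num.min alpha beta ->
  (beta < alpha ->
    alpha < ((2 + qK) * (beta - mK) - (hs_dim S)%:R) / 2) ->
  forall s : R, 0 <= s -> s < Num.min alpha beta ->
  forall Mn : nat -> R, Mn n @[n --> \oo] --> +oo ->
  ('E_(data_law F theta0 n)[fun x => posterior F Pi x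
      [set theta : Hs S p |
        ((Mn n * n%:R `^ (- ((Num.min alpha beta - s)
                             / (2 * alpha + (hs_dim S)%:R))))%:E
         < hnorm s (theta - theta0))%E]])%E
    @[n --> \oo] --> 0%E.
Proof.
move=> p0 pbeta palpha theta0_beta prior evid R00 c00 c0C0 fin_law Iup Ilow C2
  dm mp q0 q1 CK0 RK0 KLexp phi0 phi_mono _ phi_quad cphi0 r0 KLphi _ _ expo
  alpha_small s s0 sg Mn Mn_infty.
have d0 := hs_dimR_gt0 S.
have near0 : `|theta0 - theta0| <= R0 by rewrite subrr normr0 ltW.
have fin0 := fin_law _ near0.
have [T0 T0E] := mean_functional fin0.
have shift (h : Hs S p) : theta0 + h - theta0 = h by rewrite addrC addKr.
have KLE (h : Hs S p) : KL F (theta0 + h) theta0 =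
    (logpart F (theta0 + h) - logpart F theta0 - T0 h)%:E.
  by rewrite (KL_formula fin0 _ T0E) shift.
have Kquad := KL_quadratic CK0 q0 KLE Iup (fun h => Ilow h _ near0) KLexp.
have C00 : 0 <= C0 by lra.
have m0 : 0 < mK by lra.
have [g gE] : {g | g = Num.min alpha beta} by eexists.
rewrite -gE in expo sg *.
have ga : g <= alpha by rewrite gE ge_min lexx.
have gb : g <= beta by rewrite gE ge_min lexx orbT.
have pg : p < g by rewrite gE lt_min palpha.
(* If the prior is smoother than the truth, this is what the bound on [alpha]
   provides, as [2 + qK <= 3]. *)
have g2 : alpha + (hs_dim S)%:R / 2 < 2 * g.
  have [ab|ba] := leP alpha beta; first by rewrite gE min_l//; lra.
  have h := alpha_small ba; rewrite gE min_r ?(ltW ba)//.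
  have : (2 + qK) * (beta - mK) <= 3 * (beta - mK) by rewrite ler_wpM2r//; lra.
  lra.
move: expo; rewrite gt_max => /andP[expo1 expo2].
have qmg : (2 + qK) * mK < qK * g by lra.
have qrm : (2 + qK) * mK + 2 * rK * qK < qK * g.
  have h1 : (2 + qK) * mK <= (2 + qK) * p by rewrite ler_wpM2l//; lra.
  have h2 : 2 * rK * qK <= 2 * rK by rewrite ler_piMr// mulr_ge0.
  lra.
have mrg : mK + 2 * rK < g.
  have h1 : p <= (2 + qK) * p by rewrite ler_peMl//; lra.
  have h2 : qK * g <= g by rewrite ler_piMl//; lra.
  lra.
have [B B0 smooth] : exists2 B : R, 0 <= B &
    (wsum (weight S g) (coef (theta0 : S)) <= B%:E)%E.
  have [C C_gt0 hC] := weight_embedding S gb.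
  move: theta0_beta; rewrite /hnorm seqnorm_fin => fb.
  exists (C * fine (wsum (weight S beta) (coef (theta0 : S)))).
    by rewrite mulr_ge0 ?(ltW C_gt0)// fine_ge0// wsum_ge0//; exact: weight_ge0.
  apply: (@le_trans _ _ (wsum (fun k => C * weight S beta k) (coef (theta0 : S)))).
    by apply: wsum_mono => k; [exact: weight_ge0|exact: hC].
  rewrite wsum_scale; last by move=> k; exact: weight_ge0.
  by rewrite EFinM fineK//; apply: wsum_fin => //; exact: weight_ge0.
have Kphi (h : Hs S p) : phi (cphi * fine (hnorm (- rK) (h : S))) <=
    logpart F (theta0 + h) - logpart F theta0 - T0 h.
  by have := KLphi (theta0 + h); rewrite KLE lee_fin shift.
have K_upper c (cgt0 : 0 < c) := divergence_upper (ltW m0) RK0 C00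
  (fun h b b0 bR hb => proj2 (andP (Kquad h b b0 bR hb))) qmg
  (le_lt_trans mp pg) cgt0.
have a0 : 0 <= alpha + (hs_dim S)%:R / 2 by lra.
have ms : mK <= Num.max s mK by rewrite le_max lexx orbT.
have K_lower M1 M' (M10 : 0 < M1) (M'0 : 0 < M') := divergence_lower (ltW m0) mp
  q0 CK0 RK0 c00 (fun h b b0 bR hb => proj1 (andP (Kquad h b b0 bR hb))) phi0
  phi_mono phi_quad cphi0 r0 Kphi a0 ms mrg qrm g2 M10 M'0.
apply: cvge0_eventually_le => [n|eta eta0].
  by apply: expectation_ge0 => x; exact: posterior_ge0.
have [Mbig [L0 [L01 level]]] := contraction_level prior fin0 T0E Iup
  (measurable_logpart C2) evid C00 dm (le_lt_trans mp pg) ga s0 sg B0 smooth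
  K_upper K_lower eta0.
have res0 : 0 < 2 * alpha + (hs_dim S)%:R by lra.
near=> n; apply: level.
- by near: n; exact: nbhs_infty_gt.
- by near: n; exact: resolution_cvg.
move=> theta /=; apply: le_lt_trans; rewrite lee_fin.
have -> : n%:R `^ (- ((g - s) / (2 * alpha + (hs_dim S)%:R))) =
    resolution S alpha n `^ (s - g).
  by rewrite /resolution -powRrM; congr (_ `^ _); field; rewrite gt_eqF.
apply: ler_wpM2r; first exact: powR_ge0.
by near: n; move/cvgryPge : Mn_infty; exact.
Unshelve. all: by end_near. Qed.
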